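(* Let $\tilde m$ be a weight on $\{0,1,\dots\}$ and $m$ a weight on $\{0,1,\dots\}^s$, and let $v=v(t,x)$ be a time-dependent vector field on (an open subset of) $\mathbb R\times\mathbb R^s$ of class $E^{\tilde m\cdot m}$ with respect to time and space. If $\tilde m\cdot m$ is strictly FdB, then its flow $\varphi$, wherever defined, is also of class $E^{\tilde m\cdot m}$ with respect to time and space.
   Context: A weight on $\{0,1,\dots\}^d$ is any map from $\{0,1,\dots\}^d$ to $(0,\infty)$, $k\mapsto m_k$. For a multiindex $k$, $|k|=k_1+\cdots+k_d$. Class $E^w$ for a weight $w$ on $\{0,1,\dots\}^d$: for a smooth function $f$ near $a\in\mathbb R^d$ let $f_k(a)=\frac1{k!}\partial^kf(a)$ and $\|f\|^w_{a,r}=\sum_{k\ne0}\frac{|f_k(a)|}{w_k}r^{|k|}\in[0,\infty]$; for vector valued $f$ take the maximum over the components. $f$ is of class $E^w$ if every point in its domain has a neighbourhood $U$ and an $r>0$ with $\sup_{a\in U}\|f\|^w_{a,r}<\infty$. The product weight $\tilde m\cdot m$ on $\{0,1,\dots\}^{1+s}$ is $(\tilde m\cdot m)_{(\tilde n,n)}=\tilde m_{\tilde n}\,m_n$ for $\tilde n\in\{0,1,\dots\}$, $n\in\{0,1,\dots\}^s$; the first index refers to time, the second to space. A weight $w$ on $\{0,1,\dots\}^d$ is strictly FdB if there is $\lambda\ge1$ such that for all multiindices $l\ne0$ and, with $r=|l|$, all multiindices $k_1,\dots,k_r\ne0$: $w_l\,w_{k_1}\cdots w_{k_r}\le\lambda^r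 w_{k_1+\cdots+k_r}$. The flow: for an initial time $t_0$, $\varphi(t,x)$ denotes the solution of $\partial_t\varphi(t,x)=v(t,\varphi(t,x))$, $\varphi(t_0,x)=x$. *)

(* Defs.v *)
From HB Require Import structures.
From mathcomp Require Import all_boot all_order all_algebra.
From mathcomp Require Import all_classical all_reals all_analysis.
Set Implicit Arguments.
Unset Strict Implicit.
Unset Printing Implicit Defensive.
Import Order.TTheory GRing.Theory Num.Theory.
Import numFieldNormedType.Exports.
Local Open Scope classical_set_scope.
Local Open Scope ring_scope.

(* Multiindices in {0,1,...}^d are row vectors of naturals; their zero, sum and
   finite sums are those of the nmodType structure of ['rV[nat]_d]. *)

Definition mdeg (d : nat) (k : 'rV[nat]_d) : nat := (\sum_(i < d) k ord0 i)%N.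

Definition mfact (d : nat) (k : 'rV[nat]_d) : nat := (\prod_(i < d) (k ord0 i)`!)%N.

Definition prod_weight (R : realType) (s : nat) (mt : nat -> R)
    (m : 'rV[nat]_s -> R) (k : 'rV[nat]_(1 + s)) : R :=
  mt (lsubmx k 0 0) * m (rsubmx k).

Definition strictly_FdB (R : realType) (d : nat) (w : 'rV[nat]_d -> R) : Prop :=
  exists2 lambda : R, 1 <= lambda &
    forall (l : 'rV[nat]_d) (k : 'I_(mdeg l) -> 'rV[nat]_d),
      l != 0 -> (forall i, k i != 0) ->
      w l * \prod_(i < mdeg l) w (k i)
        <= lambda ^+ mdeg l * w (\sum_(i < mdeg l) k i).

(* [iter_partial [:: i1; ...; ip] f] is d_{i1} ... d_{ip} f. *)
Definition iter_partial (R : realType) (d : nat) (p : seq 'I_d)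
    (f : 'rV[R]_d -> R) : 'rV[R]_d -> R :=
  foldr (fun i (g : 'rV[R]_d -> R) => 'D_(delta_mx 0 i) g) f p.

Definition mpartial (R : realType) (d : nat) (k : 'rV[nat]_d)
    (f : 'rV[R]_d -> R) : 'rV[R]_d -> R :=
  iter_partial (flatten [seq nseq (k ord0 i) i | i <- enum 'I_d]) f.

(* C^oo on an open set A: the iterated partial derivatives of all orders, taken
   in any order, exist and are continuous on A.  Functions are total, but since
   A is open their values outside A do not matter. *)
Definition smooth_on (R : realType) (d : nat) (A : set 'rV[R]_d)
    (f : 'rV[R]_d -> R) : Prop :=
  forall (p : seq 'I_d) (a : 'rV[R]_d), A a ->
    {for a, continuous (iter_partial p f)} /\
    (forall i : 'I_d, derivable (iter_partial p f) a (delta_mx 0 i)).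

Definition taylor_coef (R : realType) (d : nat) (k : 'rV[nat]_d)
    (f : 'rV[R]_d -> R) (a : 'rV[R]_d) : R :=
  (mfact k)%:R^-1 * mpartial k f a.

Definition norm1E (R : realType) (d : nat) (w : 'rV[nat]_d -> R)
    (f : 'rV[R]_d -> R) (a : 'rV[R]_d) (r : R) : \bar R :=
  \esum_(k in [set k : 'rV[nat]_d | k != 0])
    (`|taylor_coef k f a| / w k * r ^+ mdeg k)%:E.

Definition coord (R : realType) (d n : nat) (f : 'rV[R]_d -> 'rV[R]_n)
    (j : 'I_n) : 'rV[R]_d -> R := fun a => f a 0 j.

Definition normE (R : realType) (d n : nat) (w : 'rV[nat]_d -> R)
    (f : 'rV[R]_d -> 'rV[R]_n) (a : 'rV[R]_d) (r : R) : \bar R :=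
  \big[maxe/0%E]_(j < n) norm1E w (coord f j) a r.

(* f, with domain the open set A, is smooth and of class E^w. *)
Definition classE (R : realType) (d n : nat) (w : 'rV[nat]_d -> R)
    (A : set 'rV[R]_d) (f : 'rV[R]_d -> 'rV[R]_n) : Prop :=
  [/\ open A,
      forall j : 'I_n, smooth_on A (coord f j) &
      forall a, A a -> exists U : set 'rV[R]_d, exists r : R,
        [/\ nbhs a U, U `<=` A, 0 < r &
            (ereal_sup [set normE w f b r | b in U] < +oo)%E]].

Definition tpoint (R : realType) (s : nat) (t : R) (x : 'rV[R]_s)
    : 'rV[R]_(1 + s) := row_mx (const_mx t : 'rV[R]_1) x.

(* c is a solution on the open interval ]a, b[, which contains t0, of
   c'(t) = v(t, c(t)), c(t0) = x, with graph in the domain D of v. *)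
Definition is_solution (R : realType) (s : nat) (D : set 'rV[R]_(1 + s))
    (v : 'rV[R]_(1 + s) -> 'rV[R]_s) (t0 : R) (x : 'rV[R]_s)
    (a b : R) (c : R -> 'rV[R]_s) : Prop :=
  [/\ a < t0 < b, c t0 = x &
      forall t : R, a < t < b ->
        D (tpoint t (c t)) /\ is_derive t 1 c (v (tpoint t (c t)))].

(* The (maximal) set of the (t, x) where the flow is defined. *)
Definition flow_domain (R : realType) (s : nat) (D : set 'rV[R]_(1 + s))
    (v : 'rV[R]_(1 + s) -> 'rV[R]_s) (t0 : R) : set 'rV[R]_(1 + s) :=
  [set z | exists t x, z = tpoint t x /\
     exists a b c, is_solution D v t0 x a b c /\ a < t < b].

Definition is_flow (R : realType) (s : nat) (D : set 'rV[R]_(1 + s))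
    (v : 'rV[R]_(1 + s) -> 'rV[R]_s) (t0 : R)
    (phi : 'rV[R]_(1 + s) -> 'rV[R]_s) : Prop :=
  (forall x, flow_domain D v t0 (tpoint t0 x) -> phi (tpoint t0 x) = x) /\
  (forall t x, flow_domain D v t0 (tpoint t x) ->
     D (tpoint t (phi (tpoint t x))) /\
     is_derive t 1 (fun u => phi (tpoint u x)) (v (tpoint t (phi (tpoint t x))))).

(* Main.v *)
(* Idea.  Work with partial derivatives indexed by words [p : seq 'I_d] instead of
   multiindices: since [k! <= |k|!] and [|k|! <= 2^(d|k|) k!], class E^w means locally
   [|d_p f| <= M (w p) |p|! rho^|p|], and FdB becomes a property of [w] on words.

   Composition: every derivative of [f o g] is a sum of monomials
   [(d_j f o g) * prod_i d_(q_i) g_(j_i)], to which FdB applies factor by factor; the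
   remaining numerical factors are exactly the Taylor coefficients at 0 of [P o Q]
   for one-variable polynomial majorants [P] of [f] and [Q] of [g].  With
   [Q = sum_n (kappa / n^2) X^n], whose powers are dominated by [Q] itself, the
   composition reproduces the bound of [g] up to a factor not depending on [g].

   Flow: add the equation [t' = 1], so that time becomes a coordinate, and consider
   the Picard iterates on a small box.  Integration in time gains a small factor, and
   a derivative in time is estimated by rescaling [w] in the time direction;
   hence all iterates obey the same derivative bounds.  They converge
   pointwise, and pointwise limits of smooth functions with uniformly bounded
   derivatives of each order are smooth with the same bounds.  This yields the flow
   near each point for every nearby initial time, and an arbitrary time is
   reached by composing finitely many such local flows. *)
Require Import Defs.
From HB Require Import structures.
From mathcomp Require Import all_boot all_order all_algebra.
From mathcomp Require Import all_classical all_reals all_analysis.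
From mathcomp Require Import ring lra zify measurable_realfun.
Import Order.TTheory GRing.Theory Num.Theory.
Import numFieldNormedType.Exports.
Local Open Scope classical_set_scope.
Local Open Scope ring_scope.
Set Implicit Arguments.
Unset Strict Implicit.
Unset Printing Implicit Defensive.

(** * Mean value estimates along coordinate lines *)

(** The weight of the field is prescribed, but that of the iterates is not: FdB persists when the
    inner weight is multiplied by [s ^+ size p * T ^+ count_mem tau p], since such factors multiply
    along concatenation of words. This freedom closes the induction. The constants are fixed in a
    definite order: [kap] small, so that the majorants compose; [s] large, to leave room for the
    derivative of the identity; [T] large, for derivatives in time; and only then the size [e] of
    the box.

    The obstacle is that a time derivative cancels the primitive and loses its small factor [2 * e].
    The factor [T] pays for it, together with an inequality between the weights of [p] and of [p]
    with one more time index, which is FdB for an outer word of length two.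

    The sequence 1/n^2 is chosen because its convolution with itself is at most 8 times itself; a
    purely geometric sequence would lose a factor n.

    The box size is found before the initial time [t'], so one box serves all initial times near its
    centre. Continuation along an integral curve relies on this. *)

Section Lines.
Context {R : realType} {d : nat}.
Implicit Types (f : 'rV[R]_d -> R) (a x y z v : 'rV[R]_d) (i : 'I_d).

Lemma ball_rVP z (e : R) y : 0 < e ->
  ball z e y <-> forall i, `|y 0 i - z 0 i| < e.
Proof.
move=> e0; split=> [[_ b] i|b]; first by rewrite distrC; exact: b.
by split=> // k i; rewrite (ord1 k) /ball /= distrC.
Qed.

Lemma norm_rV_coord x i : `|x 0 i| <= `|x|.
Proof.
rewrite [leRHS]/Num.Def.normr /= mx_normrE.
exact: (@le_bigmax _ _ _ _ (fun ij : 'I_1 * 'I_d => `|x ij.1 ij.2|) (0, i)).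
Qed.

Lemma norm_rV_le x (e : R) : 0 <= e -> (forall i, `|x 0 i| <= e) -> `|x| <= e.
Proof.
move=> e0 xe; rewrite [leLHS]/Num.Def.normr /= mx_normrE.
by apply: bigmax_le => // -[k i] _ /=; rewrite (ord1 k).
Qed.

Lemma is_derive_slice {V : normedModType R} (f : V -> R) (a v : V) (h df : R) :
  is_derive (h *: v + a) v f df <-> is_derive h 1 (fun t => f (t *: v + a)) df.
Proof.
have E : (fun t : R => t^-1 *: ((f \o shift (h *: v + a)) (t *: v) - f (h *: v + a)))
  = (fun t : R => t^-1 *: (((fun t => f (t *: v + a)) \o shift h) (t *: 1) - f (h *: v + a))).
  by apply/funext => t /=; rewrite addrA -scalerDl [t%:A]mulr1.
split=> -[D1 D2]; apply: DeriveDef.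
- by move: D1; rewrite /derivable E.
- by rewrite -D2 /derive E.
- by move: D1; rewrite /derivable E.
- by rewrite -D2 /derive E.
Qed.

Lemma is_derive_line f a v (h df : R) :
  is_derive (h *: v + a) v f df <-> is_derive h 1 (fun t => f (t *: v + a)) df.
Proof. exact: is_derive_slice. Qed.

(** The intermediate point is written [t * h] with [t] in [0, 1], so that one statement covers both
    signs of [h] and the case [h = 0]. *)
Lemma MVT_between (F dF : R -> R) (h : R) :
  (forall t : R, 0 <= t <= 1 -> is_derive (t * h) 1 F (dF (t * h))) ->
  exists2 t : R, 0 <= t <= 1 & F h - F 0 = h * dF (t * h).
Proof.
move=> FdF; have [->|h0] := eqVneq h 0.
  by exists 0; rewrite ?lexx ?ler01 // subrr mul0r.
have FdF' (x : R) : 0 <= x / h <= 1 -> is_derive x 1 F (dF x).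
  by move=> /FdF; rewrite divfK.
have P (a b : R) : a <= b -> (forall x : R, a <= x <= b -> 0 <= x / h <= 1) ->
    exists2 t : R, 0 <= t <= 1 & F b - F a = (b - a) * dF (t * h).
  move=> ab xab; have [||t] := @MVT_segment R F dF a b ab.
  - by move=> x; rewrite in_itv /= => /andP[x0 x1]; apply/FdF'/xab; rewrite !ltW.
  - apply: derivable_within_continuous => x; rewrite in_itv /= => x01.
    by have [] := FdF' x (xab _ x01).
  - by rewrite in_itv /= => t01 ->; exists (t / h); [exact: xab|rewrite divfK// mulrC].
have [hp|hn|h0'] := ltgtP 0 h.
- have [|x /andP[x0 xh]|t t01 E] := P 0 h; first exact: ltW.
    by rewrite divr_ge0 ?(ltW hp) // ler_pdivrMr // mul1r.
  by exists t; rewrite // E subr0.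
- have [|x /andP[x0 xh]|t t01 E] := P h 0; first exact: ltW.
    by rewrite ler_ndivrMr // mul1r x0 andbT -[0](mul0r h^-1) ler_wnM2r // invr_le0 ltW.
  by exists t; rewrite // -opprB E; lra.
- by rewrite -h0' eqxx in h0.
Qed.

Lemma MVT_line f (df : R -> R) a v (h : R) :
  (forall t : R, 0 <= t <= 1 -> is_derive ((t * h) *: v + a) v f (df (t * h))) ->
  exists2 t : R, 0 <= t <= 1 & f (h *: v + a) - f a = h * df (t * h).
Proof.
move=> D; have [t t01|t t01] := @MVT_between (fun t => f (t *: v + a)) df h.
  exact/is_derive_line/D.
by rewrite scale0r add0r; exists t.
Qed.

Local Notation ee i := (delta_mx 0 i : 'rV[R]_d).

Lemma scale_delta_coord (t : R) i x j :
  (t *: ee i + x) 0 j = t * (j == i)%:R + x 0 j.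
Proof. by rewrite !mxE eqxx. Qed.

(** Balls of the sup norm are boxes, hence convex; only segments parallel to an axis occur. *)
Lemma ball_segment z (e : R) x y (t : R) i : ball z e x -> ball z e y ->
  0 <= t <= 1 -> (forall j, j != i -> y 0 j = x 0 j) ->
  ball z e ((t * (y 0 i - x 0 i)) *: ee i + x).
Proof.
move=> bx bz /andP[t0 t1] yx; have e0 : 0 < e by case: bx.
move: bx bz => /(ball_rVP _ _ e0) bx /(ball_rVP _ _ e0) bz.
apply/(ball_rVP _ _ e0) => j; rewrite scale_delta_coord.
have [->|ji] := eqVneq j i; last by rewrite mulr0 add0r.
rewrite mulr1 (_ : _ - _ = (1 - t) * (x 0 i - z 0 i) + t * (y 0 i - z 0 i)); last by ring.
rewrite (le_lt_trans (ler_normD _ _)) // !normrM (ger0_norm t0).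
rewrite (ger0_norm (_ : 0 <= 1 - t)) ?subr_ge0 //.
have [->|tn] := eqVneq t 0; first by rewrite subr0 mul1r mul0r addr0.
have tp : 0 < t by rewrite lt_neqAle eq_sym tn.
rewrite [ltRHS](_ : e = (1 - t) * e + t * e); last by ring.
by apply: ler_ltD; [apply: ler_wpM2l; [rewrite subr_ge0|exact/ltW/bx] | rewrite ltr_pM2l].
Qed.

Lemma lip_coord z (e : R) f i (B : R) x y :
  (forall y, ball z e y -> derivable f y (ee i)) ->
  (forall y, ball z e y -> `|'D_(ee i) f y| <= B) ->
  ball z e x -> ball z e y -> (forall j, j != i -> y 0 j = x 0 j) ->
  `|f y - f x| <= B * `|y 0 i - x 0 i|.
Proof.
move=> df dB bx bz yx.
have [t t01|t t01] := @MVT_line f (fun t => 'D_(ee i) f (t *: ee i + x)) x (ee i) (y 0 i - x 0 i).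
  by apply/derivableP/df/ball_segment.
have -> : (y 0 i - x 0 i) *: ee i + x = y.
  apply/rowP => j; rewrite scale_delta_coord.
  have [->|ji] := eqVneq j i; first by rewrite mulr1 subrK.
  by rewrite mulr0 add0r yx.
move=> ->; rewrite normrM mulrC ler_wpM2r // dB //.
exact: ball_segment.
Qed.

(** Corners of a path from [x] to [y] that moves one coordinate at a time and stays in any box
    containing both ends. *)
Definition splice x y (k : nat) : 'rV[R]_d :=
  \row_i (if (i < k)%N then y 0 i else x 0 i).

Lemma lip_ball z (e : R) f (B : 'I_d -> R) x y :
  (forall y i, ball z e y -> derivable f y (ee i)) ->
  (forall y i, ball z e y -> `|'D_(ee i) f y| <= B i) ->
  ball z e x -> ball z e y ->
  `|f y - f x| <= \sum_i B i * `|y 0 i - x 0 i|.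
Proof.
move=> df dB bx bz.
have e0 : 0 < e by case: bx.
have bs k : ball z e (splice x y k).
  move: bx bz => /(ball_rVP _ _ e0) bx /(ball_rVP _ _ e0) bz.
  by apply/(ball_rVP _ _ e0) => j; rewrite mxE; case: ifP.
have s0 : splice x y 0 = x by apply/rowP => j; rewrite mxE.
have sd : splice x y d = y by apply/rowP => j; rewrite mxE ltn_ord.
have := telescope_sumr (fun k => f (splice x y k)) (leq0n d).
rewrite sd s0 => <-.
rewrite big_mkord; apply: le_trans (ler_norm_sum _ _ _) _; apply: ler_sum => i _.
have -> : `|y 0 i - x 0 i| = `|splice x y i.+1 0 i - splice x y i 0 i|.
  by rewrite !mxE ltnSn ltnn.
apply: (@lip_coord z e) => //.
- by move=> *; apply: df.
- by move=> *; apply: dB.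
- by move=> j ji; rewrite !mxE ltnS leq_eqVlt (inj_eq val_inj) (negPf ji).
Qed.

End Lines.

(** * Functions with continuous partial derivatives *)

Lemma is_diff_expansion {R : realType} (V W : normedModType R) (f : V -> W)
    (L : {linear V -> W}) (a : V) : continuous L ->
  (forall eps : R, 0 < eps ->
     \forall h \near (0 : V), `|f (h + a) - f a - L h| <= eps * `|h|) ->
  is_diff a f L.
Proof.
move=> cL fL; have E : f \o shift a = cst (f a) + L +o_ (0 : V) id.
  apply/eqaddoP => eps eps0; have := fL _ eps0.
  by apply: filterS => h; rewrite /= -[X in _ -> `|X| <= _]/(f (h + a) - (f a + L h)) opprD addrA.
have dE := diff_unique cL E.
by apply: DiffDef => //; apply/diff_locallyP; rewrite dE.
Qed.

Section C1.
Context {R : realType} {d : nat}.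
Implicit Types (f : 'rV[R]_d -> R) (a x y z v : 'rV[R]_d) (i : 'I_d).
Local Notation ee i := (delta_mx 0 i : 'rV[R]_d).

(** Near [a] the function minus its linear part has small partial derivatives, so [lip_ball] bounds
    its increments by a small multiple of the displacement. *)
Lemma C1_expansion f a :
  (\forall y \near a, forall i, derivable f y (ee i)) ->
  (forall i, {for a, continuous ('D_(ee i) f)}) ->
  forall eps : R, 0 < eps -> \forall h \near (0 : 'rV[R]_d),
   `|f (h + a) - f a - \sum_i h 0 i * 'D_(ee i) f a| <= eps * `|h|.
Proof.
(* The sum of [d] such bounds is at most [eps]; the successor avoids a division by zero when
   [d = 0]. *)
move=> df cf eps eps0; pose B : R := eps / d.+1%:R.
have B0 : 0 < B by rewrite divr_gt0.
have nB : \forall y \near a, forall i, `|'D_(ee i) f y - 'D_(ee i) f a| <= B.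
  apply: (@filter_forall _ _ (fun i y => `|'D_(ee i) f y - 'D_(ee i) f a| <= B) (nbhs a) _) => i.
  move: (cf i) => /cvgrPdist_le /(_ _ B0).
  by apply: filterS => y; rewrite distrC.
have [r /= r0 br] := (nbhs_ballP _ _).1 (filterI df nB).
apply/nbhs_ballP; exists r => //= h bh.
pose F y := f y - \sum_i (y 0 i) * 'D_(ee i) f a.
have dF y i : ball a r y -> is_derive y (ee i) F ('D_(ee i) f y - 'D_(ee i) f a).
  move=> /br[dfy _].
  have dL : is_derive y (ee i) (fun y => \sum_i (y 0 i) * 'D_(ee i) f a) ('D_(ee i) f a).
    rewrite -[y]add0r -(scale0r (ee i)); apply/is_derive_line.
    have -> : (fun t : R => \sum_j ((t *: ee i + y) 0 j) * 'D_(ee j) f a)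
      = (fun t : R => t * 'D_(ee i) f a + \sum_j (y 0 j) * 'D_(ee j) f a).
      apply/funext => t; under eq_bigr do rewrite scale_delta_coord mulrDl.
      rewrite big_split /= (bigD1 i) //= eqxx mulr1 big1 ?addr0 // => j ji.
      by rewrite (negPf ji) mulr0 mul0r.
    set c := 'D_(ee i) f a; set k := \sum_j _.
    have -> : (fun t : R => t * c + k) = (fun t : R => t *: c) + cst k by [].
    by apply: is_derive_eq; rewrite addr0 scaler0 add0r [_%:A]mulr1.
  exact: is_deriveB (derivableP (dfy i)) dL.
have := @lip_ball R d a r F (fun _ => B) a (h + a) _ _ _ _.
have -> : F (h + a) - F a = f (h + a) - f a - \sum_i h 0 i * 'D_(ee i) f a.
  have -> : F (h + a) = f (h + a) - (\sum_i h 0 i * 'D_(ee i) f a + \sum_i a 0 i * 'D_(ee i) f a).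
    by congr (_ - _); rewrite -big_split /=; apply: eq_bigr => i _; rewrite mxE mulrDl.
  by rewrite /F; ring.
move=> H; apply: le_trans (H _ _ _ _) _.
- by move=> y i /(dF _ i)[].
- by move=> y i by_; have [_ ->] := dF _ i by_; have [_ ] := br _ by_; exact.
- exact: ballxx.
- apply/ball_rVP => // i; move/ball_rVP : bh => /(_ r0 i).
  by rewrite !mxE addrK subr0.
- apply: (@le_trans _ _ (\sum_(i < d) B * `|h|)).
    apply: ler_sum => i _; rewrite ler_pM2l // mxE addrK; exact: norm_rV_coord.
  rewrite sumr_const card_ord -mulrnAl ler_wpM2r // /B -mulr_natr -mulrA ger_pMr //.
  by rewrite mulrC ler_pdivrMr // mul1r ler_nat.
Qed.

Lemma C1_differentiable f a :
  (\forall y \near a, forall i, derivable f y (ee i)) ->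
  (forall i, {for a, continuous ('D_(ee i) f)}) ->
  differentiable f a /\ forall v, 'd f a v = \sum_i v 0 i * 'D_(ee i) f a.
Proof.
move=> df cf.
pose L v := \sum_i v 0 i * 'D_(ee i) f a.
have linL : linear L.
  move=> k u v; rewrite /L scaler_sumr -big_split /=; apply: eq_bigr => i _.
  by rewrite !mxE mulrDl -mulrA.
pose LL := GRing.isLinear.Build _ _ _ _ _ linL.
pose LM : {linear 'rV[R]_d -> R} := HB.pack L LL.
have cL : continuous LM.
  move=> x; apply: differentiable_continuous.
  have -> : (LM : _ -> _) = \sum_i (fun v : 'rV[R]_d => v 0 i * 'D_(ee i) f a).
    by apply/funext => v; rewrite fct_sumE.
  apply: differentiable_sum => i.
  exact/differentiableM/differentiable_cst/differentiable_coord.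
have [D1 D2] := @is_diff_expansion R _ _ f LM a cL (C1_expansion df cf).
by split=> // v; rewrite D2.
Qed.

End C1.

(** Along the line through [a] in direction [v], [g] becomes a curve in one variable, for which
    derivable and differentiable agree; the chain rule for differentials then applies to [f] and
    this curve. *)
Lemma is_derive_chain {R : realType} {m d : nat} (f : 'rV[R]_d -> R)
    (g : 'rV[R]_m -> 'rV[R]_d) (a v : 'rV[R]_m) (dg : 'I_d -> R) :
  (\forall y \near g a, forall i, derivable f y (delta_mx 0 i)) ->
  (forall i, {for g a, continuous ('D_(delta_mx 0 i) f)}) ->
  (forall j, is_derive a v (fun y => g y 0 j) (dg j)) ->
  is_derive a v (f \o g) (\sum_j dg j * 'D_(delta_mx 0 j) f (g a)).
Proof.
move=> df cf hg; have [D1 D2] := C1_differentiable df cf.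
pose c (t : R) := g (t *: v + a).
have dc : derivable c 0 1.
  apply/derivable_mxP => i j; rewrite (ord1 i).
  have := hg j; rewrite -{1}[a]add0r -(scale0r v) => /is_derive_line[].
  by [].
have dcj j : 'D_1 c 0 0 j = dg j.
  rewrite derive_mx // mxE.
  have := hg j; rewrite -{1}[a]add0r -(scale0r v) => /is_derive_line[_ <-].
  by [].
rewrite -[a]add0r -(scale0r v); apply/is_derive_line.
have c0 : c 0 = g a by rewrite /c scale0r add0r.
have dc' : differentiable c 0 := (derivable1_diffP _ _).1 dc.
have dfc : differentiable (f \o c) 0 by apply: differentiable_comp; rewrite ?c0.
apply: DeriveDef; first exact: ((derivable1_diffP _ _).2 dfc).
rewrite deriveE // -[X in 'd X _]/(f \o c) diff_comp //; last by rewrite c0.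
rewrite /= c0 D2 scale0r add0r; apply: eq_bigr => j _.
by rewrite -deriveE ?dcj.
Qed.

(** * Smooth functions *)

Lemma iter_partial_cat {R : realType} {d : nat} (p q : seq 'I_d) (f : 'rV[R]_d -> R) :
  iter_partial (p ++ q) f = iter_partial p (iter_partial q f).
Proof. by rewrite /iter_partial foldr_cat. Qed.

Lemma iter_partial_rcons {R : realType} {d : nat} (p : seq 'I_d) i (f : 'rV[R]_d -> R) :
  iter_partial (rcons p i) f = iter_partial p ('D_(delta_mx 0 i) f).
Proof. by rewrite -cats1 iter_partial_cat. Qed.

Section Smooth.
Context {R : realType} {d : nat}.
Implicit Types (f g : 'rV[R]_d -> R) (a x y z : 'rV[R]_d) (i j : 'I_d) (p q : seq 'I_d).
Implicit Types (A : set 'rV[R]_d).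
Local Notation ee i := (delta_mx 0 i : 'rV[R]_d).
Local Notation pd i f := ('D_(ee i) f).

Lemma open_near A f g a : open A -> A a -> {in A, f =1 g} -> \forall y \near a, f y = g y.
Proof.
move=> oA Aa fg; have := open_nbhs_nbhs (conj oA Aa).
by apply: filterS => y Ay; apply: fg; rewrite inE.
Qed.

Lemma iter_partial_eq A f g p : open A -> {in A, f =1 g} ->
  {in A, iter_partial p f =1 iter_partial p g}.
Proof.
move=> oA fg; elim: p => [//|i p IH] a /set_mem Aa /=.
exact/near_eq_derive/open_near/IH.
Qed.

(** A form of smoothness that unfolds from the innermost derivative: closure under sums, products
    and composition becomes an induction on [n] that replaces functions by their first
    derivatives. *)
Fixpoint Ck (n : nat) A f : Prop :=
  (forall a, A a -> {for a, continuous f}) /\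
  if n is n'.+1 then forall i, (forall a, A a -> derivable f a (ee i)) /\ Ck n' A (pd i f)
  else True.

Lemma smooth_on_pd A f i : smooth_on A f -> smooth_on A (pd i f).
Proof. by move=> sf p a Aa; rewrite -iter_partial_rcons; exact: sf. Qed.

Lemma smooth_on_iter A f p : smooth_on A f -> smooth_on A (iter_partial p f).
Proof. by move=> sf q a Aa; rewrite -iter_partial_cat; exact: sf. Qed.

Lemma smooth_on_cont A f a : smooth_on A f -> A a -> {for a, continuous f}.
Proof. by move=> sf Aa; have [] := sf [::] a Aa. Qed.

Lemma smooth_on_derivable A f a i : smooth_on A f -> A a -> derivable f a (ee i).
Proof. by move=> sf Aa; have [] := sf [::] a Aa. Qed.

Lemma smooth_on_is_derive A f a i : smooth_on A f -> A a -> is_derive a (ee i) f (pd i f a).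
Proof. by move=> sf Aa; apply/derivableP; exact: smooth_on_derivable sf Aa. Qed.

Lemma smooth_onP A f : smooth_on A f <-> forall n, Ck n A f.
Proof.
split=> [sf n|cf p].
  elim: n f sf => [|n IH] f sf /=; split=> //; do ?by move=> a; exact: smooth_on_cont.
  move=> i; split; last exact/IH/smooth_on_pd.
  by move=> a; exact: smooth_on_derivable.
elim/last_ind: p f cf => [|p i IH] f cf a Aa.
  have [c1 c2] := cf 1%N; split; first exact: c1.
  by move=> i; have [+ _] := c2 i; exact.
by rewrite !iter_partial_rcons; apply: IH => // n; have [_ /(_ i)[]] := cf n.+1.
Qed.

Lemma smooth_on_sub A B f : B `<=` A -> smooth_on A f -> smooth_on B f.
Proof. by move=> BA sf p a /BA; exact: sf. Qed.

Lemma Ck_cont n A f : Ck n A f -> forall a, A a -> {for a, continuous f}.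
Proof. by case: n => [|n] []. Qed.

Lemma CkW n A f : Ck n.+1 A f -> Ck n A f.
Proof.
elim: n f => [|n IH] f [cf Df] //; split=> // i.
by have [D1 D2] := Df i; split=> //; exact: IH.
Qed.

Lemma Ck_eq n A f g : open A -> {in A, f =1 g} -> Ck n A f -> Ck n A g.
Proof.
move=> oA; elim: n f g => [|n IH] f g fg [cf Df].
  split=> // a Aa; have nfg := open_near oA Aa fg.
  suff : g x @[x --> a] --> g a by [].
  rewrite -(nbhs_singleton nfg).
  by apply: cvg_trans (cf a Aa); exact: near_eq_cvg nfg.
split=> [a Aa|i]; first exact: (Ck_cont (IH _ _ fg (CkW (conj cf Df)))).
have [D1 D2] := Df i; split.
  by move=> a Aa; apply: near_eq_derivable (D1 _ Aa); exact: open_near fg.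
by apply: IH D2; exact: (@iter_partial_eq A f g [:: i]).
Qed.

Lemma smooth_on_eq A f g : open A -> {in A, f =1 g} -> smooth_on A f -> smooth_on A g.
Proof.
by move=> oA fg /smooth_onP sf; apply/smooth_onP => n; exact: Ck_eq (sf n).
Qed.

Lemma Ck_cst n A (c : R) : Ck n A (cst c).
Proof.
elim: n c => [|n IH] c; first by split=> // a _; exact: cst_continuous.
split; first by move=> a _; exact: cst_continuous.
move=> i; have dc a : is_derive a (ee i) (cst c : 'rV[R]_d -> R) 0 by exact: is_derive_cst.
split; first by move=> a _; have [] := dc a.
have E : pd i (cst c : 'rV[R]_d -> R) = cst 0.
  by apply/funext => x; have [_ ->] := dc x.
by rewrite E; exact: IH.
Qed.

Lemma Ck_add n A f g : open A -> Ck n A f -> Ck n A g -> Ck n A (fun x => f x + g x).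
Proof.
move=> oA; elim: n f g => [|n IH] f g [cf Df] [cg Dg].
  by split=> // a Aa; exact: continuousD (cf a Aa) (cg a Aa).
split=> [a Aa|i]; first exact: continuousD (cf a Aa) (cg a Aa).
have [D1 D2] := Df i; have [E1 E2] := Dg i; split.
  by move=> a Aa; exact: derivableD (D1 _ Aa) (E1 _ Aa).
apply: Ck_eq (IH _ _ D2 E2) => // a /set_mem Aa.
by rewrite -deriveD //; [exact: D1|exact: E1].
Qed.

Lemma Ck_mul n A f g : open A -> Ck n A f -> Ck n A g -> Ck n A (fun x => f x * g x).
Proof.
move=> oA; elim: n f g => [|n IH] f g Cf Cg; have [cf Df] := Cf; have [cg Dg] := Cg.
  by split=> // a Aa; exact: continuousM (cf a Aa) (cg a Aa).
split=> [a Aa|i]; first exact: continuousM (cf a Aa) (cg a Aa).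
have [D1 D2] := Df i; have [E1 E2] := Dg i; split.
  by move=> a Aa; exact: derivableM (D1 _ Aa) (E1 _ Aa).
apply: Ck_eq (Ck_add oA (IH _ _ (CkW Cf) E2) (IH _ _ (CkW Cg) D2)) => // a /set_mem Aa.
by have := deriveM (D1 a Aa) (E1 a Aa) => /esym; exact.
Qed.

Lemma Ck_sum n A (I : Type) (r : seq I) (F : I -> 'rV[R]_d -> R) : open A ->
  (forall k, Ck n A (F k)) -> Ck n A (fun x => \sum_(k <- r) F k x).
Proof.
move=> oA CF; elim: r => [|k r IH].
  by apply: Ck_eq (Ck_cst n A 0) => // x _; rewrite big_nil.
by apply: Ck_eq (Ck_add oA (CF k) IH) => // x _; rewrite big_cons.
Qed.

End Smooth.

(** * Smoothness of compositions *)

Section SmoothComp.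
Context {R : realType} {m d : nat}.
Implicit Types (f : 'rV[R]_d -> R) (g : 'rV[R]_m -> 'rV[R]_d) (A : set 'rV[R]_m) (D : set 'rV[R]_d).

Lemma rV_continuous g a : (forall j, {for a, continuous (Defs.coord g j)}) -> {for a, continuous g}.
Proof.
move=> cg; suff : g y @[y --> a] --> g a by [].
apply/(@cvgrPdist_le R 'rV[R]_d 'rV[R]_m (nbhs a) _ g (g a)) => eps eps0.
have : \forall y \near a, forall j, `|Defs.coord g j a - Defs.coord g j y| <= eps.
  apply: (@filter_forall _ _ (fun j y => `|Defs.coord g j a - Defs.coord g j y| <= eps) (nbhs a) _) => j.
  by move: (cg j) => /cvgrPdist_le /(_ _ eps0).
by apply: filterS => y yg; apply: norm_rV_le; [exact: ltW|move=> j; rewrite !mxE; exact: yg].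
Qed.

Lemma is_derive_comp f g A D a i : open D -> A a -> D (g a) ->
  Ck 1 D f -> (forall j, Ck 1 A (Defs.coord g j)) ->
  is_derive a (delta_mx 0 i) (f \o g)
    (\sum_j 'D_(delta_mx 0 i) (Defs.coord g j) a * 'D_(delta_mx 0 j) f (g a)).
Proof.
move=> oD Aa Dga [_ Df] Cg; apply: is_derive_chain.
- have := open_nbhs_nbhs (conj oD Dga); apply: filterS => y Dy j.
  by have [+ _] := Df j; exact.
- by move=> j; have [_ [+ _]] := Df j; exact.
- by move=> j; apply/derivableP; have [_ /(_ i)[+ _]] := Cg j; exact.
Qed.

Lemma CkSW (d' n : nat) (A' : set 'rV[R]_d') h : Ck n.+1 A' h -> Ck 1 A' h.
Proof. by elim: n h => // n IH h Ch; exact/IH/CkW. Qed.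

(** By the chain rule each first derivative is a sum of products of a derivative of [g] with a
    composition ['D f \o g], to which the induction hypothesis applies. *)
Lemma Ck_comp n f g A D : open A -> open D -> (forall a, A a -> D (g a)) ->
  Ck n D f -> (forall j, Ck n A (Defs.coord g j)) -> Ck n A (f \o g).
Proof.
move=> oA oD AD; elim: n f => [|n IH] f Cf Cg.
  split=> // a Aa; apply: continuous_comp.
    by apply: rV_continuous => j; have [+ _] := Cg j; exact.
  by have [+ _] := Cf; apply; exact: AD.
have D1 a i : A a -> is_derive a (delta_mx 0 i) (f \o g)
    (\sum_j 'D_(delta_mx 0 i) (Defs.coord g j) a * 'D_(delta_mx 0 j) f (g a)).
  move=> Aa; apply: (@is_derive_comp f g A D) => //; first exact: AD.
    exact: CkSW Cf.
  by move=> j; exact: CkSW (Cg j).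
split.
  move=> a Aa; apply: continuous_comp.
    by apply: rV_continuous => j; exact: Ck_cont (Cg j) a Aa.
  exact: Ck_cont Cf _ (AD _ Aa).
move=> i; split; first by move=> a Aa; have [] := D1 a i Aa.
apply: (@Ck_eq _ _ n A (fun a => \sum_j 'D_(delta_mx 0 i) (Defs.coord g j) a * 'D_(delta_mx 0 j) f (g a))) => //.
  by move=> a /set_mem Aa; have [_ ->] := D1 a i Aa.
apply: Ck_sum => // j; apply: Ck_mul => //; first by have [_ /(_ i)[]] := Cg j.
apply: (IH ('D_(delta_mx 0 j) f)); first by have [_ /(_ j)[]] := Cf.
by move=> k; exact: CkW.
Qed.

End SmoothComp.

Lemma dist_via {R : realType} (e b c k l : R) :
  `|b - k| <= e / 2 -> `|c - l| <= e / 2 -> l = k -> `|b - c| <= e.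
Proof.
by move=> bk cl lk; rewrite (splitr e) (le_trans (ler_distD k _ _)) // lerD // -lk distrC.
Qed.

(** * Operations on smooth functions and symmetry of mixed derivatives *)

Section SmoothOps.
Context {R : realType} {d : nat}.
Implicit Types (f g : 'rV[R]_d -> R) (a x y z : 'rV[R]_d) (i j : 'I_d) (p q : seq 'I_d).
Implicit Types (A : set 'rV[R]_d).
Local Notation ee i := (delta_mx 0 i : 'rV[R]_d).
Local Notation pd i f := ('D_(ee i) f).

Lemma smooth_on_add A f g : open A -> smooth_on A f -> smooth_on A g ->
  smooth_on A (fun x => f x + g x).
Proof.
by move=> oA /smooth_onP sf /smooth_onP sg; apply/smooth_onP => n; exact: Ck_add.
Qed.

Lemma smooth_on_mul A f g : open A -> smooth_on A f -> smooth_on A g ->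
  smooth_on A (fun x => f x * g x).
Proof.
by move=> oA /smooth_onP sf /smooth_onP sg; apply/smooth_onP => n; exact: Ck_mul.
Qed.

Lemma smooth_on_cst A (c : R) : smooth_on A (cst c).
Proof. by apply/smooth_onP => n; exact: Ck_cst. Qed.

Lemma smooth_on_sum A (I : Type) (r : seq I) (F : I -> 'rV[R]_d -> R) : open A ->
  (forall k, smooth_on A (F k)) -> smooth_on A (fun x => \sum_(k <- r) F k x).
Proof.
move=> oA sF; apply/smooth_onP => n; apply: Ck_sum => // k.
exact: (smooth_onP _ _).1.
Qed.

Lemma iter_partial_add A f g p : open A -> smooth_on A f -> smooth_on A g ->
  {in A, iter_partial p (fun x => f x + g x) =1
         (fun x => iter_partial p f x + iter_partial p g x)}.
Proof.
move=> oA; elim/last_ind: p f g => [//|p i IH] f g sf sg a Aa; rewrite !iter_partial_rcons.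
rewrite -(IH _ _ (smooth_on_pd i sf) (smooth_on_pd i sg)) //.
apply: (iter_partial_eq p oA _ Aa) => {Aa}a /set_mem Aa.
by apply: deriveD; exact: smooth_on_derivable Aa.
Qed.

Lemma iter_partial_sum A (I : Type) (r : seq I) (F : I -> 'rV[R]_d -> R) p : open A ->
  (forall k, smooth_on A (F k)) ->
  {in A, iter_partial p (fun x => \sum_(k <- r) F k x) =1
         (fun x => \sum_(k <- r) iter_partial p (F k) x)}.
Proof.
move=> oA sF; elim: r => [|k r IH] a Aa.
  rewrite big_nil; have E : (fun x => \sum_(k <- [::]) F k x) = cst 0.
    by apply/funext => x; rewrite big_nil.
  rewrite E; clear; elim/last_ind: p => [//|p i IH]; rewrite iter_partial_rcons.
  have -> // : pd i (cst 0 : 'rV[R]_d -> R) = cst 0.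
  by apply/funext => x; have [_ ->] := is_derive_cst (0 : R) x (ee i).
rewrite big_cons -IH // -(iter_partial_add _ oA) //; last exact: smooth_on_sum.
by congr (iter_partial p _ a); apply/funext => x; rewrite big_cons.
Qed.

(** Smoothness is certified by candidates for all iterated derivatives at once. Coordinates are
    treated this way, and primitives and limits through [smooth_ball_family]. *)
Lemma smooth_family A f (F : seq 'I_d -> 'rV[R]_d -> R) : open A ->
  {in A, f =1 F [::]} ->
  (forall p a, A a -> {for a, continuous (F p)}) ->
  (forall p i a, A a -> is_derive a (ee i) (F p) (F (i :: p) a)) ->
  smooth_on A f /\ forall p, {in A, iter_partial p f =1 F p}.
Proof.
move=> oA fF cF dF.
have E p : {in A, iter_partial p f =1 F p}.
  elim: p => [//|i p IH] a /set_mem Aa /=.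
  rewrite (near_eq_derive (g := F p)); last exact: open_near IH.
  by have [_ ->] := dF p i a Aa.
split=> // p a Aa; have nE : \forall y \near a, F p y = iter_partial p f y.
  by apply: open_near oA Aa _ => y yA; rewrite E.
split; last by move=> i; apply: near_eq_derivable nE _; have [] := dF p i a Aa.
suff : iter_partial p f y @[y --> a] --> iter_partial p f a by [].
rewrite -(nbhs_singleton nE).
by apply: cvg_trans (cF p a Aa); apply: near_eq_cvg nE.
Qed.

Lemma smooth_on_coord A i : open A -> smooth_on A (fun x : 'rV[R]_d => x 0 i) /\
  forall p, {in A, iter_partial p (fun x : 'rV[R]_d => x 0 i) =1
    (fun x => match p with [::] => x 0 i | [:: j] => (i == j)%:R | _ => 0 end)}.
Proof.
move=> oA; apply: smooth_family => //.
  move=> [|j [|k p]] a Aa; [exact: coord_continuous|exact: cst_continuous|exact: cst_continuous].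
move=> [|j [|k p]] l a Aa; last 2 first.
- exact: is_derive_cst.
- exact: is_derive_cst.
rewrite -[a]add0r -(scale0r (ee l)); apply/is_derive_line.
have -> : (fun t : R => (t *: ee l + a) 0 i) = (fun t : R => t *: (i == l)%:R) + cst (a 0 i).
  by apply/funext => t; rewrite scale_delta_coord.
by apply: is_derive_eq; rewrite addr0 scaler0 add0r [_%:A]mulr1.
Qed.

Lemma is_derive_translate f (c x v : 'rV[R]_d) (D : R) :
  is_derive (c + x) v f D -> is_derive x v (fun y => f (c + y)) D.
Proof.
rewrite -[c + x]add0r -(scale0r v) => /is_derive_line H.
rewrite -[x in is_derive x]add0r -(scale0r v); apply/is_derive_line.
have -> // : (fun t : R => f (c + (t *: v + x))) = (fun t => f (t *: v + (c + x))).
by apply/funext => t; rewrite addrCA.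
Qed.

(** Two applications of the mean value theorem, first in direction [i] to the increment in direction
    [j]. The left side is symmetric in [i] and [j]. *)
Lemma second_difference A f a i j (r h : R) : ball a r `<=` A -> i != j ->
  0 < h -> h < r -> Ck 2 A f ->
  exists2 y : 'rV[R]_d, (forall k, `|y 0 k - a 0 k| <= h) &
   f (h *: ee j + (h *: ee i + a)) - f (h *: ee i + a) - (f (h *: ee j + a) - f a)
     = h * (h * pd j (pd i f) y).
Proof.
move=> bA ij h0 hr [_ Df]; have r0 : 0 < r by exact: lt_trans hr.
have inb (t s : R) k : 0 <= t <= 1 -> 0 <= s <= 1 ->
    `|((s * h) *: ee j + ((t * h) *: ee i + a)) 0 k - a 0 k| <= h.
  move=> /andP[t0 t1] /andP[s0 s1]; rewrite !scale_delta_coord addrA addrK.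
  have [->|ki] := eqVneq k i; first by rewrite (negPf ij) mulr0 add0r mulr1 ger0_norm ?mulr_ge0 ?ger_pMl // ltW.
  rewrite mulr0 addr0; case: eqP => _; rewrite ?mulr0 ?normr0 ?(ltW h0) // mulr1.
  by rewrite ger0_norm ?mulr_ge0 ?ger_pMl // ltW.
have inA (t s : R) : 0 <= t <= 1 -> 0 <= s <= 1 ->
    A ((s * h) *: ee j + ((t * h) *: ee i + a)).
  by move=> t01 s01; apply/bA/ball_rVP => // k; apply: le_lt_trans hr; exact: inb.
have z01 : 0 <= (0 : R) <= 1 by rewrite lexx ler01.
have o01 : 0 <= (1 : R) <= 1 by rewrite lexx ler01.
have [Di Dii] := Df i.
have [t t01|t t01 Et] := @MVT_line R d (fun y => f (h *: ee j + y) - f y)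
   (fun t => pd i f (h *: ee j + (t *: ee i + a)) - pd i f (t *: ee i + a)) a (ee i) h.
  apply: is_deriveB.
    by apply: is_derive_translate; apply/derivableP/Di; have := inA t 1 t01 o01; rewrite mul1r.
  by apply/derivableP/Di; have := inA t 0 t01 z01; rewrite mul0r scale0r add0r.
have [_ Djj] := Dii; have [Dj _] := Djj j.
have [s s01|s s01 Es] := @MVT_line R d (pd i f)
   (fun s => pd j (pd i f) (s *: ee j + ((t * h) *: ee i + a))) ((t * h) *: ee i + a) (ee j) h.
  by apply/derivableP/Dj; exact: inA.
exists ((s * h) *: ee j + ((t * h) *: ee i + a)); first by move=> k; exact: inb.
by rewrite -Es -Et.
Qed.

(** The same second difference is expressed by either mixed derivative at some point within [h] of
    [a]; continuity of both at [a] makes their values there agree. *)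
Lemma pd_comm A f i j : open A -> Ck 2 A f ->
  {in A, pd i (pd j f) =1 pd j (pd i f)}.
Proof.
move=> oA Cf a /set_mem Aa; have [->//|ij] := eqVneq i j.
apply/eqP; rewrite -subr_eq0 -normr_le0; apply/ler_addgt0Pr => e e0; rewrite add0r.
have cij k l : {for a, continuous (pd k (pd l f))}.
  by have [_ /(_ l)[_ [_ /(_ k)[_ [+ _]]]]] := Cf; exact.
have e20 : 0 < e / 2 by rewrite divr_gt0.
have n1 : \forall y \near a, `|pd i (pd j f) a - pd i (pd j f) y| <= e / 2.
  by have /(@cvgrPdist_le R R^o 'rV[R]_d (nbhs a) _ (pd i (pd j f)) _)/(_ _ e20) := cij i j.
have n2 : \forall y \near a, `|pd j (pd i f) a - pd j (pd i f) y| <= e / 2.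
  by have /(@cvgrPdist_le R R^o 'rV[R]_d (nbhs a) _ (pd j (pd i f)) _)/(_ _ e20) := cij j i.
have nA := open_nbhs_nbhs (conj oA Aa).
have [r /= r0 br] := (nbhs_ballP _ _).1 (filterI nA (filterI n1 n2)).
pose h := r / 2; have h0 : 0 < h by rewrite divr_gt0.
have hr : h < r by rewrite ltr_pdivrMr // ltr_pMr // ltr1n.
have bA : ball a r `<=` A by move=> y /br[].
have [y yh Ey] := second_difference bA ij h0 hr Cf.
have ji : j != i by rewrite eq_sym.
have [y' yh' Ey'] := second_difference bA ji h0 hr Cf.
have EE : pd j (pd i f) y = pd i (pd j f) y'.
  apply: (mulfI (lt0r_neq0 h0)); apply: (mulfI (lt0r_neq0 h0)).
  have sw (b c e' k : R) : b - c - (e' - k) = b - e' - (c - k) by ring.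
  have Ep : h *: ee j + (h *: ee i + a) = h *: ee i + (h *: ee j + a) by exact: addrCA.
  apply: etrans (esym Ey) _; apply: etrans _ Ey'; rewrite Ep; exact: sw.
have by_ : ball a r y by apply/(ball_rVP _ _ r0) => k; exact: le_lt_trans (yh k) hr.
have [_ [_ H2]] := br _ by_.
have by' : ball a r y' by apply/(ball_rVP _ _ r0) => k; exact: le_lt_trans (yh' k) hr.
have [_ [H1 _]] := br _ by'.
exact: dist_via H1 H2 EE.
Qed.

Lemma iter_partial_perm A f p q : open A -> smooth_on A f -> perm_eq p q ->
  {in A, iter_partial p f =1 iter_partial q f}.
Proof.
move=> oA sf.
have swap i q1 q2 : {in A, iter_partial (q1 ++ i :: q2) f =1 iter_partial (i :: q1 ++ q2) f}.
  elim: q1 => [//|j q1 IH] a Aa.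
  have -> : iter_partial ((j :: q1) ++ i :: q2) f a = iter_partial [:: j] (iter_partial (i :: q1 ++ q2) f) a.
    exact: (iter_partial_eq [:: j] oA IH).
  apply: (@pd_comm A) => //.
  exact/(smooth_onP _ _).1/smooth_on_iter.
elim: p q => [|i p IH] q pq; first by move: pq; rewrite perm_sym => /perm_nilP ->.
have iq : i \in q by rewrite -(perm_mem pq) inE eqxx.
case/splitPr: iq pq => q1 q2; rewrite perm_sym -cat1s perm_catCA /= perm_cons perm_sym => /IH pq a Aa.
by rewrite swap //; exact: (iter_partial_eq [:: i] oA pq).
Qed.

End SmoothOps.

Lemma smooth_on_comp {R : realType} {m d : nat} (f : 'rV[R]_d -> R)
    (g : 'rV[R]_m -> 'rV[R]_d) A D : open A -> open D -> (forall a, A a -> D (g a)) ->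
  smooth_on D f -> (forall j, smooth_on A (Defs.coord g j)) -> smooth_on A (f \o g).
Proof.
move=> oA oD AD sf sg; apply/smooth_onP => n; apply: (Ck_comp oA oD AD).
  exact: (smooth_onP _ _).1.
by move=> j; exact: (smooth_onP _ _).1.
Qed.

(** * The Faa di Bruno formula and majorants *)

Section FaaDiBruno.
Context {R : realType} {m n : nat}.
Variables (f : 'rV[R]_n -> R) (g : 'rV[R]_m -> 'rV[R]_n) (A : set 'rV[R]_m) (D : set 'rV[R]_n).
Hypotheses (oA : open A) (oD : open D) (AD : forall a, A a -> D (g a)).
Hypotheses (sf : smooth_on D f) (sg : forall k, smooth_on A (Defs.coord g k)).
Implicit Types (l : seq ('I_n * seq 'I_m)) (i : 'I_m) (a : 'rV[R]_m).

(** A list [l] encodes a monomial of the Faa di Bruno formula: its entry [(j, q)] stands for the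
    factor d_q g_j, and [j] also marks one differentiation of [f] in direction [j]. *)
Definition inner_prod l a : R := \prod_(x <- l) iter_partial x.2 (Defs.coord g x.1) a.

Definition fdb_term l a : R := iter_partial (map fst l) f (g a) * inner_prod l a.

(** The Leibniz rule on lists: each result has exactly one factor differentiated once more, in
    direction [i]. *)
Fixpoint bump_words i l : seq (seq ('I_n * seq 'I_m)) :=
  if l is x :: l' then ((x.1, i :: x.2) :: l') :: map (cons x) (bump_words i l') else [::].

Lemma bump_words_fst i l l' : l' \in bump_words i l -> map fst l' = map fst l.
Proof.
elim: l l' => [//|x l IH] l' /=; rewrite inE => /orP[/eqP -> //|/mapP[l'' /IH E ->]].
by rewrite /= E.
Qed.

Lemma bump_words_flatten i l l' : l' \in bump_words i l ->
  perm_eq (flatten (map snd l')) (i :: flatten (map snd l)).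
Proof.
elim: l l' => [//|x l IH] l' /=; rewrite inE => /orP[/eqP -> //|/mapP[l'' /IH E ->]] /=.
rewrite -[i :: _]cat1s perm_sym perm_catCA /= perm_cat2l perm_sym; exact: E.
Qed.

Lemma bump_words_neq0 i l l' : l' \in bump_words i l ->
  all (fun x => x.2 != [::]) l -> all (fun x => x.2 != [::]) l'.
Proof.
elim: l l' => [//|x l IH] l' /=; rewrite inE => /orP[/eqP -> /= /andP[]//|/mapP[l'' /IH E ->]] /=.
by move=> /andP[-> /E].
Qed.

Lemma smooth_inner_prod l : smooth_on A (inner_prod l).
Proof.
elim: l => [|x l IH].
  apply: (smooth_on_eq oA _ (smooth_on_cst (1 : R))) => a _.
  by rewrite /inner_prod big_nil.
apply: (smooth_on_eq oA _ (smooth_on_mul oA (smooth_on_iter x.2 (sg x.1)) IH)) => a _.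
by rewrite /inner_prod big_cons.
Qed.

Lemma smooth_fdb_term l : smooth_on A (fdb_term l).
Proof.
apply: (smooth_on_mul oA _ (smooth_inner_prod l)).
exact: (smooth_on_comp oA oD AD (smooth_on_iter _ sf) sg).
Qed.

Lemma is_derive_inner_prod l i a : A a ->
  is_derive a (delta_mx 0 i) (inner_prod l) (\sum_(l' <- bump_words i l) inner_prod l' a).
Proof.
move=> Aa; elim: l => [|x l IH] /=.
  rewrite big_nil; have -> : inner_prod [::] = cst 1.
    by apply/funext => b; rewrite /inner_prod big_nil.
  exact: is_derive_cst.
have -> : inner_prod (x :: l) = iter_partial x.2 (Defs.coord g x.1) * inner_prod l.
  by apply/funext => b; rewrite /inner_prod big_cons.
have dx := smooth_on_is_derive i (smooth_on_iter x.2 (sg x.1)) Aa.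
apply: is_derive_eq; rewrite big_cons big_map addrC; congr (_ + _).
  by rewrite [RHS]/inner_prod big_cons /= mulrC.
by rewrite scaler_sumr; apply: eq_bigr => l' _; rewrite [RHS]/inner_prod big_cons.
Qed.

Lemma is_derive_outer (F : 'rV[R]_n -> R) i a : A a -> smooth_on D F ->
  is_derive a (delta_mx 0 i) (F \o g)
    (\sum_j 'D_(delta_mx 0 i) (Defs.coord g j) a * 'D_(delta_mx 0 j) F (g a)).
Proof.
move=> Aa sF; apply: (is_derive_comp _ oD Aa (AD Aa)); first exact: (smooth_onP _ _).1.
by move=> j; exact: (smooth_onP _ _).1.
Qed.

(** Differentiating the outer factor creates a new entry [(j, [:: i])] for each [j]; differentiating
    the inner product gives the bumped lists. *)
Lemma is_derive_fdb_term l i a : A a ->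
  is_derive a (delta_mx 0 i) (fdb_term l)
   (\sum_j fdb_term ((j, [:: i]) :: l) a + \sum_(l' <- bump_words i l) fdb_term l' a).
Proof.
move=> Aa.
have d1 := is_derive_outer i Aa (smooth_on_iter (map fst l) sf).
have d2 := is_derive_inner_prod l i Aa.
have -> : fdb_term l = (iter_partial (map fst l) f \o g) * inner_prod l by [].
apply: is_derive_eq; rewrite addrC; congr (_ + _).
  rewrite scaler_sumr; apply: eq_bigr => j _.
  rewrite /fdb_term {2}/inner_prod big_cons /= -/(inner_prod l a).
  by rewrite [LHS]mulrC [X in X * _ = _]mulrC -mulrA.
rewrite scaler_sumr big_seq_cond [RHS]big_seq_cond; apply: eq_bigr => l' /andP[/bump_words_fst E _].
by rewrite /fdb_term E.
Qed.

(** * Majorants in one variable *)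

Section Majorant.
Variables (a : 'rV[R]_m) (Aa : A a) (u : seq 'I_n -> R) (W : seq 'I_m -> R) (lam : R).
Hypotheses (lam_gt0 : 0 < lam) (W_gt0 : forall p, 0 < W p).
Hypothesis W_perm : forall p q, perm_eq p q -> W p = W q.
Hypothesis FdB : forall (j : seq 'I_n) (qs : seq (seq 'I_m)), j != [::] -> size qs = size j ->
  all (fun q => q != [::]) qs ->
  u j * \prod_(q <- qs) W q <= lam ^+ size j * W (flatten qs).
Variables (N : nat) (P Q : {poly R}).
Hypotheses (P_ge0 : forall k, 0 <= P`_k) (Q_ge0 : forall k, 0 <= Q`_k) (Q0 : Q`_0 = 0).
Hypothesis fP : forall j, j != [::] -> (size j <= N)%N ->
  (n%:R * lam) ^+ size j * `|iter_partial j f (g a)| <= u j * P^`(size j).[0].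
Hypothesis gQ : forall k q, q != [::] -> (size q <= N)%N ->
  `|iter_partial q (Defs.coord g k) a| <= W q * Q^`(size q).[0].

Lemma derivn0_ge0 (S : {poly R}) k : (forall k, 0 <= S`_k) -> 0 <= S^`(k).[0].
Proof. by move=> S0; rewrite horner_coef0 coef_derivn mulrn_wge0. Qed.

Definition maj_prod l : {poly R} := \prod_(x <- l) Q^`(size x.2).

(** The counterpart of [fdb_term l] for [P \Po Q], with every word replaced by its length. It obeys
    the same differentiation rule, see [deriv_maj_term]. *)
Definition maj_term l : {poly R} := (P^`(size l) \Po Q) * maj_prod l.

Lemma deriv_maj_prod i l : (maj_prod l)^`() = \sum_(l' <- bump_words i l) maj_prod l'.
Proof.
elim: l => [|x l IH] /=; first by rewrite /maj_prod !big_nil derivC.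
rewrite big_cons big_map {1}/maj_prod big_cons derivM; congr (_ + _).
  by rewrite /maj_prod big_cons -derivnS.
by rewrite -/(maj_prod l) IH mulr_sumr; apply: eq_bigr => l' _; rewrite {2}/maj_prod big_cons.
Qed.

Lemma deriv_maj_term i l j : (maj_term l)^`() =
  maj_term ((j, [:: i]) :: l) + \sum_(l' <- bump_words i l) maj_term l'.
Proof.
rewrite /maj_term derivM deriv_comp -derivnS; congr (_ + _).
  by rewrite /maj_prod big_cons /= mulrA.
rewrite (deriv_maj_prod i) mulr_sumr big_seq_cond [RHS]big_seq_cond.
apply: eq_bigr => l' /andP[/bump_words_fst E _].
by rewrite -(size_map fst l') E size_map.
Qed.

Lemma size_fst_le_flatten l : all (fun x => x.2 != [::]) l ->
  (size l <= size (flatten (map snd l)))%N.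
Proof.
elim: l => [//|x l IH] /= /andP[x2 /IH]; rewrite size_cat.
by case: x.2 x2 => //= b s _; lia.
Qed.

(** The powers of [lam] in [fP] and in FdB cancel. Since [Q] vanishes at 0, the outer factor of
    [maj_term l] takes the value P^(k)(0), which is what bounds the derivatives of [f]. *)
Lemma fdb_term_le l : l != [::] -> all (fun x => x.2 != [::]) l ->
  (size (flatten (map snd l)) <= N)%N ->
  n%:R ^+ size l * `|fdb_term l a| <= W (flatten (map snd l)) * (maj_term l).[0].
Proof.
move=> l0 al sl; have sl' := leq_trans (size_fst_le_flatten al) sl.
have j0 : map fst l != [::] by case: (l) l0.
have := fP j0; rewrite size_map => /(_ sl') fPl.
have := @FdB (map fst l) (map snd l) j0; rewrite !size_map all_map => /(_ erefl al).
rewrite big_map => FdBl.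
have Pl : `|inner_prod l a| <= \prod_(x <- l) W x.2 * (maj_prod l).[0].
  rewrite /inner_prod /maj_prod normr_prod horner_prod -big_split /=.
  elim: (l) al sl => [|x l' IH] /=; first by rewrite !big_nil.
  move=> /andP[x2 al']; rewrite size_cat => sl2; rewrite !big_cons.
  apply: ler_pM => //; first exact: prodr_ge0.
    exact: gQ x2 (leq_trans (leq_addr _ _) sl2).
  exact: IH al' (leq_trans (leq_addl _ _) sl2).
have M0 : 0 <= (maj_prod l).[0].
  rewrite horner_prod; apply: prodr_ge0 => x _; exact: derivn0_ge0.
have W0 : 0 <= \prod_(x <- l) W x.2 by apply: prodr_ge0 => x _; exact: ltW.
rewrite /maj_term hornerM horner_comp (_ : Q.[0] = 0); last by rewrite horner_coef0.
rewrite -(ler_pM2l (exprn_gt0 (size l) lam_gt0)) mulrA -exprMn (mulrC lam).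
rewrite /fdb_term normrM mulrA (le_trans (ler_pM _ _ fPl Pl)) //.
  by rewrite mulr_ge0 // exprn_ge0 // mulr_ge0 // ltW.
rewrite mulrACA [leRHS]mulrA ler_wpM2r // mulr_ge0 //.
exact: derivn0_ge0.
Qed.

(** Term and majorant are differentiated in parallel. One step of the chain rule creates [n] terms,
    one for each [j], all with the same majorant; the factor [n%:R ^+ size l] accounts for this
    multiplicity. *)
Lemma iter_fdb_term_le p l : l != [::] -> all (fun x => x.2 != [::]) l ->
  (size p + size (flatten (map snd l)) <= N)%N ->
  n%:R ^+ size l * `|iter_partial p (fdb_term l) a| <=
    W (p ++ flatten (map snd l)) * ((maj_term l)^`(size p)).[0].
Proof.
elim/last_ind: p l => [|p i IH] l l0 al; first exact: fdb_term_le.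
rewrite size_rcons addSnnS => sl.
have E : {in A, iter_partial (rcons p i) (fdb_term l) =1 (fun b =>
   \sum_j iter_partial p (fdb_term ((j, [:: i]) :: l)) b +
   \sum_(l' <- bump_words i l) iter_partial p (fdb_term l') b)}.
  move=> b bA; rewrite iter_partial_rcons.
  rewrite (@iter_partial_eq _ _ A _ (fun b =>
    \sum_j fdb_term ((j, [:: i]) :: l) b + \sum_(l' <- bump_words i l) fdb_term l' b) p) //; last first.
    by move=> c /set_mem Ac; have [_ ->] := is_derive_fdb_term l i Ac.
  rewrite (iter_partial_add p oA (smooth_on_sum _ oA (fun j => smooth_fdb_term _))
    (smooth_on_sum _ oA (fun l' => smooth_fdb_term l')) bA).
  rewrite (iter_partial_sum _ _ oA (fun j => smooth_fdb_term _) bA).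
  by rewrite (iter_partial_sum _ _ oA (fun l' => smooth_fdb_term l') bA).
rewrite E ?inE //.
(* An arbitrary index, needed only to write the list in [deriv_maj_term]: the majorant depends on
   lengths alone. *)
have [j0 _] : {j : 'I_n | true} by case: (l) l0 => // -[j ?]; exists j.
have n0 : 0 < n%:R :> R by rewrite ltr0n (leq_ltn_trans _ (ltn_ord j0)).
rewrite derivSn (deriv_maj_term i l j0) derivnD hornerD mulrDr cat_rcons.
apply: le_trans (ler_wpM2l _ (ler_normD _ _)) _; first exact: exprn_ge0.
rewrite mulrDr; apply: lerD.
  apply: le_trans (ler_wpM2l _ (ler_norm_sum _ _ _)) _; first exact: exprn_ge0.
  rewrite -(ler_pM2l n0) mulrA -exprS mulr_sumr.
  set Y := W _ * _; rewrite -[in leRHS](card_ord n) mulr_natl -sumr_const.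
  apply: ler_sum => j _.
  have -> : Y = W (p ++ flatten (map snd ((j, [:: i]) :: l))) *
      ((maj_term ((j, [:: i]) :: l))^`(size p)).[0].
    by rewrite /Y /maj_term /maj_prod !big_cons.
  exact: (IH ((j, [:: i]) :: l)).
apply: le_trans (ler_wpM2l _ (ler_norm_sum _ _ _)) _; first exact: exprn_ge0.
rewrite raddf_sum horner_sum !mulr_sumr big_seq_cond [leRHS]big_seq_cond.
apply: ler_sum => l' /andP[l'i _].
have sz : size l' = size l by have := congr1 size (bump_words_fst l'i); rewrite !size_map.
have pf := bump_words_flatten l'i.
rewrite -sz (W_perm (q := p ++ flatten (map snd l'))); last first.
  by rewrite perm_cat2l perm_sym.
apply: IH; first by rewrite -size_eq0 sz size_eq0.
  exact: bump_words_neq0 l'i al.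
by rewrite (perm_size pf).
Qed.

(** The first derivative is taken by hand, because FdB needs a nonempty outer word; the remaining
    word then acts on terms whose list has one entry. *)
Lemma iter_comp_le p : p != [::] -> (size p <= N)%N ->
  `|iter_partial p (f \o g) a| <= W p * ((P \Po Q)^`(size p)).[0].
Proof.
case/lastP: p => [//|p i] _ sp.
have E : {in A, iter_partial (rcons p i) (f \o g) =1 (fun b =>
   \sum_j iter_partial p (fdb_term [:: (j, [:: i])]) b)}.
  move=> b bA; rewrite iter_partial_rcons.
  rewrite (@iter_partial_eq _ _ A _ (fun b => \sum_j fdb_term [:: (j, [:: i])] b) p) //; last first.
    move=> c /set_mem Ac; have [_ ->] := is_derive_outer i Ac sf.
    apply: eq_bigr => j _; rewrite /fdb_term /inner_prod big_seq1 /=.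
    by rewrite mulrC.
  by rewrite (iter_partial_sum _ _ oA (fun j => smooth_fdb_term _) bA).
rewrite E ?inE //; apply: le_trans (ler_norm_sum _ _ _) _.
(* For [n = 0] the sum is empty, and it only remains to see that the majorant is nonnegative. *)
have [n0|n0] := posnP n.
  rewrite big1 => [|j]; last by have := ltn_ord j; rewrite [X in (_ < X)%N]n0.
  apply: mulr_ge0; [exact: ltW | apply: derivn0_ge0 => k].
  rewrite coef_comp_poly; apply: sumr_ge0 => l _; rewrite mulr_ge0 //.
  elim: (nat_of_ord l) k => [|l' IH] k; first by rewrite expr0 coef1 ler0n.
  by rewrite exprS coefM; apply: sumr_ge0 => k' _; rewrite mulr_ge0.
have n0' : 0 < n%:R :> R by rewrite ltr0n.
rewrite -(ler_pM2l n0') mulr_sumr; set Y := W _ * _.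
rewrite -[in leRHS](card_ord n) mulr_natl -sumr_const; apply: ler_sum => j _.
have := @iter_fdb_term_le p [:: (j, [:: i])] isT isT; rewrite /= addn1 expr1 cats1.
rewrite -(size_rcons p i) => /(_ sp); rewrite /Y size_rcons derivSn deriv_comp.
by rewrite /maj_term /maj_prod big_seq1.
Qed.

End Majorant.
End FaaDiBruno.

Lemma eq_lerW {R : realType} (x y : R) : x = y -> x <= y.
Proof. by move=> ->. Qed.

(** * Inverse squares under convolution *)

Section InverseSquares.
Context {R : realType}.

Lemma sum_inv_sqr (n : nat) : \sum_(k < n.+1) (k%:R ^+ 2)^-1 <= 2 :> R.
Proof.
(* This stronger bound is inductive by telescoping. The term [k = 0] is 0, as the inverse of 0 is
   0. *)
suff H : \sum_(k < n.+2) (k%:R ^+ 2)^-1 <= 2 - (n.+1)%:R^-1 :> R.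
  apply: le_trans (le_trans _ H) _; last by rewrite gerBl invr_ge0.
  by rewrite [leRHS]big_ord_recr lerDl invr_ge0 sqr_ge0.
elim: n => [|n IH].
  by rewrite big_ord_recr big_ord1 /= expr0n invr0 add0r expr1n invr1; lra.
rewrite big_ord_recr /=; apply: le_trans (lerD IH (lexx _)) _.
set x : R := n.+1%:R; have x0 : 0 < x by rewrite ltr0n.
have -> : n.+2%:R = x + 1 :> R by rewrite -natr1.
have xn0 := lt0r_neq0 x0; have x1 : 0 < x + 1 by lra.
have x1n0 := lt0r_neq0 x1.
rewrite -subr_ge0 (_ : _ - _ = (x * (x + 1) ^+ 2)^-1).
  by rewrite invr_ge0 mulr_ge0 ?sqr_ge0 // ltW.
by clearbody x; field; rewrite xn0 x1n0.
Qed.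

(** For a + b = n, 1/(a b)^2 is at most (2/n^2)(1/a^2 + 1/b^2), the difference being a square; both
    sums are at most 2, whence the 8. *)
Lemma conv_inv_sqr (n : nat) :
  \sum_(k < n.+1) (k%:R ^+ 2)^-1 * ((n - k)%:R ^+ 2)^-1 <= 8 / n%:R ^+ 2 :> R.
Proof.
have [->|n0] := posnP n; first by rewrite big_ord1 subnn expr0n invr0 !mulr0.
have nR : 0 < n%:R :> R by rewrite ltr0n.
apply: (@le_trans _ _ (\sum_(k < n.+1) 2 / n%:R ^+ 2 * ((k%:R ^+ 2)^-1 + ((n - k)%:R ^+ 2)^-1))).
  apply: ler_sum => k _.
  have [->|k0] := posnP k.
    by rewrite expr0n invr0 mul0r mulr_ge0 // ?divr_ge0 ?sqr_ge0 // add0r invr_ge0 sqr_ge0.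
  have [nk0|nk0] := posnP (n - k).
    by rewrite nk0 expr0n invr0 mulr0 mulr_ge0 // ?divr_ge0 ?sqr_ge0 // addr0 invr_ge0 sqr_ge0.
  have -> : n%:R = k%:R + (n - k)%:R :> R by rewrite -natrD subnKC // -ltnS.
  set a : R := k%:R; set b : R := (n - k)%:R.
  have a0 : 0 < a by rewrite ltr0n.
  have b0 : 0 < b by rewrite ltr0n.
  have ab0 : 0 < a + b by rewrite addr_gt0.
  rewrite -subr_ge0 (_ : _ - _ = ((a - b) / (a * b * (a + b))) ^+ 2); first exact: sqr_ge0.
  by field; rewrite !lt0r_neq0.
rewrite -mulr_sumr big_split /=.
have -> : \sum_(k < n.+1) ((n - k)%:R ^+ 2)^-1 = \sum_(k < n.+1) (k%:R ^+ 2)^-1 :> R.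
  rewrite (reindex_inj rev_ord_inj) /=; apply: eq_bigr => k _.
  by rewrite subSS subKn // -ltnS.
have := sum_inv_sqr n; set s := \sum_(k < n.+1) _ => s2.
rewrite (_ : 8 / _ = 2 / n%:R ^+ 2 * 4); last by rewrite mulrAC; congr (_ / _); ring.
by rewrite ler_wpM2l ?divr_ge0 ?sqr_ge0 //; lra.
Qed.

Variables (kap M rho : R) (N : nat).
Hypotheses (kap_ge0 : 0 <= kap) (M_ge0 : 0 <= M) (rho_ge0 : 0 <= rho).

(* The coefficient of degree 0 is [kap / 0 = 0]. *)
Definition invsq_poly : {poly R} := \poly_(k < N.+1) (kap / k%:R ^+ 2).

Definition geom_poly : {poly R} := \poly_(k < N.+1) (if k is 0%N then 0 else M * rho ^+ k).

Lemma coef_invsq_ge0 k : 0 <= invsq_poly`_k.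
Proof. by rewrite coef_poly; case: ifP => // _; rewrite divr_ge0 // sqr_ge0. Qed.

Lemma coef_invsq_le k : invsq_poly`_k <= kap / k%:R ^+ 2.
Proof. by rewrite coef_poly; case: ifP => // _; rewrite divr_ge0 // sqr_ge0. Qed.

Lemma coef_geom_ge0 k : 0 <= geom_poly`_k.
Proof.
rewrite coef_poly; case: ifP => //; case: k => // k _.
by rewrite mulr_ge0 // exprn_ge0.
Qed.

Lemma coef_invsqX_ge0 m n : 0 <= (invsq_poly ^+ m)`_n.
Proof.
elim: m n => [|m IH] n; first by rewrite expr0 coef1 ler0n.
by rewrite exprS coefM; apply: sumr_ge0 => k _; rewrite mulr_ge0 // coef_invsq_ge0.
Qed.

(** Each further factor is one convolution and costs [8 * kap], by [conv_inv_sqr]. *)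
Lemma coef_invsqX m n : (invsq_poly ^+ m.+1)`_n <= (8 * kap) ^+ m * (kap / n%:R ^+ 2).
Proof.
elim: m n => [|m IH] n; first by rewrite expr0 mul1r expr1 coef_invsq_le.
rewrite exprS coefM.
apply: (@le_trans _ _ (\sum_(k < n.+1) (8 * kap) ^+ m * kap ^+ 2 *
    ((k%:R ^+ 2)^-1 * ((n - k)%:R ^+ 2)^-1))).
  apply: ler_sum => k _; apply: le_trans (ler_pM _ _ (coef_invsq_le _) (IH _)) _.
  - exact: coef_invsq_ge0.
  - exact: coef_invsqX_ge0.
  - move: (_ ^-1) (_ ^-1) (_ ^+ m) => x y c.
    by apply: eq_lerW; ring.
rewrite -mulr_sumr; apply: le_trans (ler_wpM2l _ (conv_inv_sqr n)) _.
  by rewrite mulr_ge0 ?sqr_ge0 // exprn_ge0 // mulr_ge0.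
by apply: eq_lerW; rewrite (exprS _ m); move: (_ ^+ m) (_ ^-1) => c y; ring.
Qed.

Lemma geom_sum_half (q : R) k : 0 <= q -> 2 * q <= 1 -> \sum_(i < k) q ^+ i <= 2.
Proof.
move=> q0 q1; suff : \sum_(i < k) q ^+ i <= 2 - 2 * q ^+ k.
  by move=> /le_trans; apply; rewrite gerBl mulr_ge0 // exprn_ge0.
have {}q1 : q <= 1 / 2 by lra.
elim: k => [|k IH]; first by rewrite big_ord0 expr0; lra.
rewrite big_ord_recr /= exprS; have := exprn_ge0 k q0.
by move: IH; set s := \sum_(i < k) _; set y := q ^+ k => IH y0; nra.
Qed.

(** By [coef_invsqX] the powers of the inner polynomial contribute a geometric series of ratio
    [8 * kap * rho]. The condition makes this ratio at most 1/2 and the sum at most 2. *)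
Lemma coef_geom_invsq n : 16 * kap * rho <= 1 ->
  (geom_poly \Po invsq_poly)`_n <= 2 * M * rho * (kap / n%:R ^+ 2).
Proof.
move=> small; set c := kap / n%:R ^+ 2.
have c0 : 0 <= c by rewrite divr_ge0 // sqr_ge0.
rewrite coef_comp_poly.
have C k : geom_poly`_k * (invsq_poly ^+ k)`_n <=
    if k is k'.+1 then M * rho * c * (8 * kap * rho) ^+ k' else 0.
  rewrite coef_poly; case: k => [|k]; first by rewrite mul0r.
  have R0 : 0 <= M * rho * c * (8 * kap * rho) ^+ k.
    by rewrite !mulr_ge0 // exprn_ge0 // !mulr_ge0.
  case: ifP => _; last by rewrite mul0r.
  apply: le_trans (ler_wpM2l _ (coef_invsqX k n)) _.
    by rewrite mulr_ge0 // exprn_ge0.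
  rewrite -/c; apply: eq_lerW.
  by rewrite [in RHS]exprMn (exprS _ k); move: (_ ^+ k) (_ ^+ k) => y y'; ring.
apply: (@le_trans _ _ (\sum_(k < size geom_poly)
    if (k : nat) is k'.+1 then M * rho * c * (8 * kap * rho) ^+ k' else 0)).
  by apply: ler_sum => k _; exact: C.
case: (size geom_poly) => [|S]; first by rewrite big_ord0 !mulr_ge0.
rewrite big_ord_recl add0r -mulr_sumr.
have := @geom_sum_half (8 * kap * rho) S.
rewrite !mulr_ge0 // => /(_ isT) H.
have {}H : \sum_(i < S) (8 * kap * rho) ^+ i <= 2 by apply: H; lra.
apply: le_trans (ler_wpM2l _ H) _; first by rewrite !mulr_ge0.
by apply: eq_lerW; ring.
Qed.

End InverseSquares.

(** * Derivative bounds for a composition *)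

Section CompBound.
Context {R : realType} {m n : nat}.
Variables (f : 'rV[R]_n -> R) (g : 'rV[R]_m -> 'rV[R]_n) (A : set 'rV[R]_m) (D : set 'rV[R]_n).
Hypotheses (oA : open A) (oD : open D) (AD : forall a, A a -> D (g a)).
Hypotheses (sf : smooth_on D f) (sg : forall k, smooth_on A (Defs.coord g k)).

(** The bound assumed for [g] comes back multiplied by [2 * M * (n%:R * lam * rho)], which depends
    on [f] and not on [g]; the Picard induction rests on this. *)
Lemma comp_bound (a : 'rV[R]_m) (Aa : A a) (u : seq 'I_n -> R) (W : seq 'I_m -> R)
    (lam kap M rho : R) :
  0 < lam -> (forall p, 0 < W p) ->
  (forall p q, perm_eq p q -> W p = W q) ->
  (forall (j : seq 'I_n) (qs : seq (seq 'I_m)), j != [::] -> size qs = size j ->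
    all (fun q => q != [::]) qs ->
    u j * \prod_(q <- qs) W q <= lam ^+ size j * W (flatten qs)) ->
  0 <= kap -> 0 <= M -> 0 <= rho -> 16 * kap * (n%:R * lam * rho) <= 1 ->
  (forall j, j != [::] ->
    `|iter_partial j f (g a)| <= u j * ((size j)`!%:R * (M * rho ^+ size j))) ->
  (forall k q, q != [::] ->
    `|iter_partial q (Defs.coord g k) a| <= W q * ((size q)`!%:R * (kap / (size q)%:R ^+ 2))) ->
  forall p, p != [::] ->
    `|iter_partial p (f \o g) a| <=
      W p * ((size p)`!%:R * (2 * M * (n%:R * lam * rho) * (kap / (size p)%:R ^+ 2))).
Proof.
move=> lam0 W0 Wp FdB kap0 M0 rho0 small hf hg p p0.
have nl0 : 0 <= n%:R * lam :> R by rewrite mulr_ge0 // ltW.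
have r0 : 0 <= n%:R * lam * rho by rewrite mulr_ge0.
have dE (S : {poly R}) k : S^`(k).[0] = k`!%:R * S`_k.
  by rewrite horner_coef0 coef_derivn addn0 ffactnn mulr_natl.
(* Only derivatives up to the order of [p] enter, so the power series may be truncated there. The
   factor [(n%:R * lam) ^+ size j] is absorbed into the ratio of [P]. *)
pose N := size p.
pose P := geom_poly M (n%:R * lam * rho) N; pose Q := invsq_poly kap N.
have fP j : j != [::] -> (size j <= N)%N ->
    (n%:R * lam) ^+ size j * `|iter_partial j f (g a)| <= u j * P^`(size j).[0].
  move=> j0 jN; apply: le_trans (ler_wpM2l _ (hf j j0)) _; first exact: exprn_ge0.
  rewrite dE /P /geom_poly coef_poly ltnS jN.
  case: (size j) (size_eq0 j) => [|k] sj; first by rewrite -sj eqxx in j0.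
  by apply: eq_lerW; rewrite (exprMn k.+1 (n%:R * lam) rho); move: (_ ^+ k.+1) (_ ^+ k.+1) (_`!%:R) => y y' z; ring.
have gQ k q : q != [::] -> (size q <= N)%N ->
    `|iter_partial q (Defs.coord g k) a| <= W q * Q^`(size q).[0].
  by move=> q0 qN; rewrite dE /Q /invsq_poly coef_poly ltnS qN; exact: hg.
apply: le_trans (iter_comp_le oA oD AD sf sg Aa lam0 W0 Wp FdB
  (coef_geom_ge0 N M0 r0) (coef_invsq_ge0 N kap0) _ fP gQ p0 (leqnn _)) _.
  by rewrite coef_poly /= expr0n invr0 mulr0.
rewrite dE; apply: ler_wpM2l; first exact: ltW.
by apply: ler_wpM2l => //; exact: coef_geom_invsq.
Qed.

End CompBound.

(** * Primitives with respect to one coordinate *)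

(** The integral starts at the end [a], where nothing is known of [h]; boundedness on the open
    interval gives integrability up to a point [u] between [x] and [b]. *)
Lemma integral_derivative {R : realType} (h : R -> R) (a b B x : R) :
  (forall y, a < y < b -> {for y, continuous h}) ->
  (forall y, a < y < b -> `|h y| <= B) -> a < x < b ->
  is_derive x 1 (fun x => \int[@lebesgue_measure R]_(t in `]a, x]) h t)%R (h x).
Proof.
move=> hc hB /andP[ax xb]; pose u := (x + b) / 2.
have xu : x < u by rewrite /u; lra.
have ub : u < b by rewrite /u; lra.
have sub y : y \in `]a, u] -> a < y < b.
  by rewrite in_itv /= => /andP[-> yu]; exact: le_lt_trans ub.
have := @continuous_FTC1 R h (BRight a) x u xu.
case.
- apply: measurable_bounded_integrable => //.
  + by rewrite /= lebesgue_measure_itv /=; case: ifP => _; rewrite -?EFinB ltry.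
  + have mo : measurable_fun `]a, b[ h.
      apply: subspace_continuous_measurable_fun => //.
      apply: continuous_in_subspaceT => y /set_mem /=; rewrite in_itv /=; exact: hc.
    by apply: measurable_funS mo => // y /= /sub; rewrite in_itv.
  + exists B; split; first exact: num_real.
    by move=> M BM y /= /sub /hB /le_trans; apply; exact: ltW.
- exact: ax.
- by apply: hc; rewrite ax.
- by move=> D1 D2; apply: (DeriveDef D1); rewrite -derive1E; exact: D2.
Qed.

Section BallFamily.
Context {R : realType} {d : nat}.
Implicit Types (f g : 'rV[R]_d -> R) (a x y z : 'rV[R]_d) (i j : 'I_d) (p q : seq 'I_d).
Local Notation ee i := (delta_mx 0 i : 'rV[R]_d).
Local Notation pd i f := ('D_(ee i) f).

Definition smooth_bounded (A : set 'rV[R]_d) f : Prop :=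
  smooth_on A f /\
  forall p, exists B : R, forall z, A z -> `|iter_partial p f z| <= B.

Lemma bounded_pd_continuous z0 (e : R) f (B : 'I_d -> R) a :
  (forall y i, ball z0 e y -> derivable f y (ee i)) ->
  (forall y i, ball z0 e y -> `|pd i f y| <= B i) ->
  ball z0 e a -> {for a, continuous f}.
Proof.
move=> df dB ba; have e0 : 0 < e by case: ba.
have B0 i : 0 <= B i by exact: le_trans (normr_ge0 _) (dB a i ba).
pose C := 1 + \sum_i B i; have C0 : 0 < C by rewrite ltr_pwDl // sumr_ge0.
suff : f y @[y --> a] --> f a by [].
apply/(@cvgrPdist_le R R^o 'rV[R]_d (nbhs a) _ f (f a)) => eps eps0.
have nb : \forall y \near a, ball z0 e y.
  exact: (open_nbhs_nbhs (conj (ball_open z0 e) ba)).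
have nb2 : \forall y \near a, `|a - y| <= eps / C.
  by apply: (@cvgrPdist_le R _ _ (nbhs a) _ id a).1; [exact: cvg_id|exact: divr_gt0].
apply: filterS (filterI nb nb2) => y [by_ ye].
apply: le_trans (lip_ball df dB by_ ba) _.
apply: (@le_trans _ _ (\sum_i B i * (eps / C))).
  apply: ler_sum => i _; apply: ler_wpM2l => //; apply: le_trans ye.
  by have := norm_rV_coord (a - y) i; rewrite !mxE.
rewrite -mulr_suml mulrCA ger_pMr // ler_pdivrMr // mul1r.
by rewrite lerDr.
Qed.

(** Bounds replace the continuity asked for in [smooth_family]: a candidate is Lipschitz on the box
    because the candidates of the next order are bounded. *)
Lemma smooth_ball_family z0 (e : R) f (F : seq 'I_d -> 'rV[R]_d -> R) : 0 < e ->
  (forall z, ball z0 e z -> f z = F [::] z) ->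
  (forall p, exists B : R, forall z, ball z0 e z -> `|F p z| <= B) ->
  (forall p i a, ball z0 e a -> is_derive a (ee i) (F p) (F (i :: p) a)) ->
  smooth_on (ball z0 e) f /\ forall p z, ball z0 e z -> iter_partial p f z = F p z.
Proof.
move=> e0 fF bF dF.
have cF p a : ball z0 e a -> {for a, continuous (F p)}.
  move=> ba; have [B HB] := choice (fun i => bF (i :: p)).
  apply: (bounded_pd_continuous (B := B) _ _ ba).
    by move=> y i by_; have [] := dF p i y by_.
  by move=> y i by_; have [_ ->] := dF p i y by_; exact: HB.
have [sf Ef] := smooth_family (ball_open z0 e) (fun z zb => fF z (set_mem zb)) cF dF.
by split=> // p z bz; apply: Ef; exact/mem_set.
Qed.

End BallFamily.

Lemma convex_lt {R : realType} (a b c t : R) :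
  a < c -> b < c -> 0 <= t <= 1 -> a + t * (b - a) < c.
Proof.
move=> ac bc /andP[t0 t1]; have [ab|/ltW ab] := leP a b.
  by apply: le_lt_trans bc; nra.
by apply: le_lt_trans ac; nra.
Qed.

Section SetCoord.
Context {R : realType} {d : nat}.
Variable tau : 'I_d.
Implicit Types (x y z : 'rV[R]_d).
Local Notation ee i := (delta_mx 0 i : 'rV[R]_d).

Definition set_coord z (u : R) : 'rV[R]_d := \row_j (if j == tau then u else z 0 j).

Lemma set_coordE z u : set_coord z u = (u - z 0 tau) *: ee tau + z.
Proof.
apply/rowP => j; rewrite scale_delta_coord mxE; case: eqP => [->|_]; first by rewrite mulr1 subrK.
by rewrite mulr0 add0r.
Qed.

Lemma set_coord_id z : set_coord z (z 0 tau) = z.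
Proof. by rewrite set_coordE subrr scale0r add0r. Qed.

Lemma set_coord_tau z u : set_coord z u 0 tau = u.
Proof. by rewrite mxE eqxx. Qed.

Lemma set_coord_other z u j : j != tau -> set_coord z u 0 j = z 0 j.
Proof. by move=> jt; rewrite mxE (negPf jt). Qed.

Lemma set_coord_set z u t : set_coord (set_coord z u) t = set_coord z t.
Proof. by apply/rowP => j; rewrite !mxE; case: eqP. Qed.

Lemma set_coord_shift (h : R) z u : set_coord (h *: ee tau + z) u = set_coord z u.
Proof.
apply/rowP => j; rewrite [LHS]mxE [RHS]mxE; case: eqP => // /eqP jt.
by rewrite scale_delta_coord (negPf jt) mulr0 add0r.
Qed.

Lemma set_coord_shift_other (h : R) i z u : i != tau ->
  set_coord (h *: ee i + z) u = h *: ee i + set_coord z u.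
Proof.
move=> it; apply/rowP => j; rewrite scale_delta_coord.
have [->|jt] := eqVneq j tau; last by rewrite !set_coord_other // scale_delta_coord.
by rewrite !set_coord_tau eq_sym (negPf it) mulr0 add0r.
Qed.

Lemma ball_set_coord z0 (e : R) z u : ball z0 e z -> `|u - z0 0 tau| < e ->
  ball z0 e (set_coord z u).
Proof.
move=> bz ue; have e0 : 0 < e by case: bz.
apply/(ball_rVP _ _ e0) => j; rewrite mxE; case: eqP => [->//|_].
exact: (ball_rVP _ _ e0).1 bz j.
Qed.

End SetCoord.

Section Primitive.
Context {R : realType} {d : nat}.
Variables (tau : 'I_d) (z0 : 'rV[R]_d) (e t' : R).
Hypothesis t'e : `|t' - z0 0 tau| < e.
Implicit Types (f g k : 'rV[R]_d -> R) (x y z : 'rV[R]_d) (i j : 'I_d) (p q : seq 'I_d).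
Local Notation ee i := (delta_mx 0 i : 'rV[R]_d).
Local Notation pd i f := ('D_(ee i) f).
Local Notation Q := (ball z0 e).

Let e0 : 0 < e. Proof. exact: le_lt_trans (normr_ge0 _) t'e. Qed.

(** The mean value theorem in time, starting from [t'], which is less than [2 * e] away. Every use
    of smallness of the box goes through this estimate. *)
Lemma bounded_tau_derivative k (K : 'rV[R]_d -> R) (C : R) z : Q z ->
  (forall u, `|u - z0 0 tau| < e ->
     is_derive (set_coord tau z u) (ee tau) K (k (set_coord tau z u))) ->
  (forall u, `|u - z0 0 tau| < e -> `|k (set_coord tau z u)| <= C) ->
  K (set_coord tau z t') = 0 -> `|K z| <= 2 * e * C.
Proof.
move=> Qz dK kC K0.
have C0 : 0 <= C by exact: le_trans (normr_ge0 _) (kC t' t'e).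
have zte : `|z 0 tau - z0 0 tau| < e by exact: (ball_rVP _ _ e0).1 Qz tau.
have P (t : R) : (t * (z 0 tau - t')) *: ee tau + set_coord tau z t' =
    set_coord tau z (t' + t * (z 0 tau - t')).
  rewrite -(set_coord_set tau z t' (t' + _)) [in RHS]set_coordE set_coord_tau.
  by rewrite (addrC t') addrK.
have U (t : R) : 0 <= t <= 1 -> `|t' + t * (z 0 tau - t') - z0 0 tau| < e.
  move=> t01; move: t'e zte; rewrite !ltr_norml => /andP[a1 a2] /andP[b1 b2].
  have c1 := @convex_lt R t' (z 0 tau) (z0 0 tau + e) t.
  have c2 := @convex_lt R (- t') (- z 0 tau) (e - z0 0 tau) t.
  have {}c1 := c1 _ _ t01; have {}c2 := c2 _ _ t01.
  have {}c1 : t' + t * (z 0 tau - t') < z0 0 tau + e by apply: c1; lra.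
  have {}c2 : - t' + t * (- z 0 tau - - t') < e - z0 0 tau by apply: c2; lra.
  by apply/andP; split; lra.
have [t t01|t t01] := @MVT_line R d K (fun s => k (s *: ee tau + set_coord tau z t'))
  (set_coord tau z t') (ee tau) (z 0 tau - t').
  by rewrite P; exact/dK/U.
have -> : (z 0 tau - t') *: ee tau + set_coord tau z t' = z.
  by rewrite -[X in X *: _]mul1r P mul1r addrC subrK set_coord_id.
rewrite K0 subr0 => ->; rewrite normrM P; apply: ler_pM => //; last exact/kC/U.
rewrite (le_trans (ler_distD (z0 0 tau) _ _)) //.
by rewrite (_ : 2 * e = e + e) ?lerD //; [rewrite ltW|rewrite distrC ltW|ring].
Qed.

(** The oriented integral of [g] from time [t'] to the time of [z], written as a difference of two
    integrals from the edge of the box because integrals over sets carry no orientation. *)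
Definition prim g z : R :=
  \int[@lebesgue_measure R]_(t in `]z0 0 tau - e, z 0 tau]) g (set_coord tau z t) -
  \int[@lebesgue_measure R]_(t in `]z0 0 tau - e, t']) g (set_coord tau z t).

Lemma prim_set_coord g z : prim g (set_coord tau z t') = 0.
Proof. by rewrite /prim set_coord_tau subrr. Qed.

Lemma is_derive_prim_tau g (B : R) z :
  (forall y, Q y -> derivable g y (ee tau)) -> (forall y, Q y -> `|g y| <= B) ->
  Q z -> is_derive z (ee tau) (prim g) (g z).
Proof.
move=> dg gB Qz.
pose h t := g (set_coord tau z t).
pose c := \int[@lebesgue_measure R]_(t in `]z0 0 tau - e, t']) h t.
have Qt t : z0 0 tau - e < t < z0 0 tau + e -> Q (set_coord tau z t).
  move=> /andP[t1 t2]; apply: ball_set_coord => //; rewrite ltr_norml; apply/andP; split; lra.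
have hE : h = (fun t => g (t *: ee tau + set_coord tau z 0)).
  by apply/funext => t; rewrite /h -(set_coord_set tau z 0 t) set_coordE set_coord_tau subr0.
have dh t : z0 0 tau - e < t < z0 0 tau + e -> {for t, continuous h}.
  move=> Qt'; have := derivableP (dg _ (Qt t Qt')).
  rewrite -(set_coord_set tau z 0 t) set_coordE set_coord_tau subr0 => /is_derive_line[D1 _].
  by apply: differentiable_continuous; rewrite hE; exact: (derivable1_diffP _ _).1 D1.
pose F (x : R) := \int[@lebesgue_measure R]_(t in `]z0 0 tau - e, x]) h t.
have Fz : is_derive (z 0 tau) 1 F (h (z 0 tau)).
  apply: (integral_derivative dh (fun t Qt' => gB _ (Qt t Qt'))).
  move/(ball_rVP _ _ e0): Qz => /(_ tau); rewrite ltr_norml => /andP[z1 z2].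
  by apply/andP; split; lra.
rewrite -[z in is_derive z]add0r -(scale0r (ee tau)); apply/is_derive_line.
have -> : (fun t : R => prim g (t *: ee tau + z)) = (fun t : R => F (t *: 1 + z 0 tau)) - cst (F t').
  apply/funext => t; rewrite /prim scale_delta_coord eqxx.
  have E : (fun u => g (set_coord tau (t *: ee tau + z) u)) = h.
    by apply/funext => u; rewrite set_coord_shift.
  by rewrite E.
have dF : is_derive (0 : R) 1 (fun t : R => F (t *: 1 + z 0 tau)) (h (z 0 tau)).
  by have := (@is_derive_slice R R F (z 0 tau) 1 0 (h (z 0 tau))).1; rewrite scale0r add0r; exact.
by apply: is_derive_eq; rewrite subr0 /h set_coord_id.
Qed.

Lemma prim_le g (B : R) z :
  (forall y, Q y -> derivable g y (ee tau)) -> (forall y, Q y -> `|g y| <= B) ->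
  Q z -> `|prim g z| <= 2 * e * B.
Proof.
move=> dg gB Qz; apply: (@bounded_tau_derivative g) => // [u ue|u ue|].
- exact: is_derive_prim_tau dg gB (ball_set_coord Qz ue).
- exact: gB (ball_set_coord Qz ue).
- exact: prim_set_coord.
Qed.

(** The mean value theorem for [g], then the Lipschitz bound for its first derivative; the constant
    is twice the sharp one. *)
Lemma taylor2 g (B h : R) i y :
  (forall y, Q y -> derivable g y (ee i)) ->
  (forall y, Q y -> derivable (pd i g) y (ee i)) ->
  (forall y, Q y -> `|pd i (pd i g) y| <= B) ->
  Q y -> Q (h *: ee i + y) ->
  `|g (h *: ee i + y) - g y - h * pd i g y| <= B * h ^+ 2.
Proof.
move=> d1 d2 gB Qy Qhy.
have Qt (t : R) : 0 <= t <= 1 -> Q ((t * h) *: ee i + y).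
  move=> t01; have := ball_segment (i := i) Qy Qhy t01.
  rewrite scale_delta_coord eqxx mulr1 addrK; apply.
  by move=> j ji; rewrite scale_delta_coord (negPf ji) mulr0 add0r.
have [t t01|t t01 ->] := @MVT_line R d g (fun t => pd i g (t *: ee i + y)) y (ee i) h.
  exact/derivableP/d1/Qt.
have B0 : 0 <= B by exact: le_trans (normr_ge0 _) (gB y Qy).
rewrite -mulrBr normrM.
apply: (@le_trans _ _ (`|h| * (B * `|t * h|))).
  apply: ler_wpM2l => //.
  have := @lip_coord R d z0 e (pd i g) i B y ((t * h) *: ee i + y) d2 gB Qy (Qt t t01).
  rewrite scale_delta_coord eqxx mulr1 addrK; apply.
  by move=> j ji; rewrite scale_delta_coord (negPf ji) mulr0 add0r.
rewrite mulrCA ler_wpM2l // normrM (ger0_norm (proj1 (andP t01))).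
rewrite mulrCA -expr2 real_normK ?num_real //.
by rewrite ler_piMl ?sqr_ge0 // (proj2 (andP t01)).
Qed.

End Primitive.

(** A quadratic bound on the remainder survives integration and pointwise limits, so this criterion
    serves to exchange differentiation with both. *)
Lemma is_derive_quadratic {R : realType} {V : normedModType R} (f : V -> R)
    (z v : V) (D C : R) :
  (\forall h \near (0 : R), `|f (h *: v + z) - f z - h * D| <= C * h ^+ 2) ->
  is_derive z v f D.
Proof.
move=> fC.
have cv : h^-1 *: (f (h *: v + z) - f z) @[h --> (0 : R)^'] --> D.
  apply/(@cvgrPdist_le R R^o R (dnbhs (0:R))) => eps eps0.
  have C1 : 0 < `|C| + 1 by rewrite ltr_wpDl.
  have n1 : \forall h \near (0 : R), `|h| <= eps / (`|C| + 1).
    by apply: nbhs0_le; exact: divr_gt0.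
  have n2 : \forall h \near (0 : R)^', `|f (h *: v + z) - f z - h * D| <= C * h ^+ 2 /\
     `|h| <= eps / (`|C| + 1).
    by apply: cvg_within; exact: filterI.
  have n3 : \forall h \near (0 : R)^', h != 0 by exact: nbhs_dnbhs_neq.
  apply: filterS (filterI n2 n3) => h [[h1 h2] h0].
  have -> : D - h^-1 *: (f (h *: v + z) - f z) = - (h^-1 * (f (h *: v + z) - f z - h * D)).
    by rewrite [_ *: _]/(_ * _) mulrBr mulKf // opprB.
  rewrite normrN normrM normfV ler_pdivrMl ?normr_gt0 //.
  apply: le_trans h1 _; apply: (@le_trans _ _ (`|h| * ((`|C| + 1) * `|h|))).
    rewrite [leRHS]mulrCA -expr2 real_normK ?num_real // ler_wpM2r ?sqr_ge0 //.
    by rewrite (le_trans (ler_norm _)) // lerDl.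
  apply: ler_wpM2l => //; rewrite mulrC -ler_pdivlMr //.
by apply: DeriveDef; [apply/cvg_ex; exists D | apply/cvg_lim].
Qed.

Section PrimitiveSmooth.
Context {R : realType} {d : nat}.
Variables (tau : 'I_d) (z0 : 'rV[R]_d) (e t' : R).
Hypothesis t'e : `|t' - z0 0 tau| < e.
Implicit Types (f g k : 'rV[R]_d -> R) (x y z : 'rV[R]_d) (i j : 'I_d) (p q : seq 'I_d).
Local Notation ee i := (delta_mx 0 i : 'rV[R]_d).
Local Notation pd i f := ('D_(ee i) f).
Local Notation Q := (ball z0 e).
Local Notation prim := (prim tau z0 e t').

Let e0 : 0 < e. Proof. exact: le_lt_trans (normr_ge0 _) t'e. Qed.

Lemma smooth_bounded_iter A g p : smooth_bounded A g -> smooth_bounded A (iter_partial p g).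
Proof.
move=> [sg bg]; split; first exact: smooth_on_iter.
by move=> q; rewrite -iter_partial_cat.
Qed.

(** Differentiation under the integral. The remainder [K] of the primitive vanishes at time [t'],
    and its time derivative is the Taylor remainder of [g], quadratic in [h] by [taylor2]. *)
Lemma is_derive_prim_other g i z : i != tau -> smooth_bounded Q g -> Q z ->
  is_derive z (ee i) (prim g) (prim (pd i g) z).
Proof.
move=> it [sg bg] Qz.
have [B0 gB0] := bg [::]; have [B1 gB1] := bg [:: i]; have [B gB] := bg [:: i; i].
have dg j y : Q y -> derivable g y (ee j) by exact: smooth_on_derivable.
have sg1 := smooth_on_pd i sg.
have dg1 j y : Q y -> derivable (pd i g) y (ee j) by exact: smooth_on_derivable.
apply: (is_derive_quadratic (C := 2 * e * B)).
have Qh : \forall h \near (0 : R), Q (h *: ee i + z).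
  have Qo : nbhs (0 *: ee i + z) Q.
    by rewrite scale0r add0r; exact: (open_nbhs_nbhs (conj (ball_open z0 e) Qz)).
  have c : {for (0 : R), continuous (fun h : R => h *: ee i + z)}.
    exact: continuousD (@scalel_continuous _ _ _ _) (@cst_continuous _ _ _ _).
  exact: c Qo.
apply: filterS Qh => h Qhz.
pose K y := prim g (h *: ee i + y) - prim g y - h * prim (pd i g) y.
rewrite -mulrA; change (`|K z| <= 2 * e * (B * h ^+ 2)).
apply: (bounded_tau_derivative t'e (K := K)
  (k := fun y => g (h *: ee i + y) - g y - h * pd i g y) Qz).
- move=> u ue; have Qu := ball_set_coord Qz ue.
  have Qu' : Q (h *: ee i + set_coord tau z u).
    by rewrite -set_coord_shift_other //; exact: ball_set_coord Qhz ue.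
  have D1 := is_derive_prim_tau t'e (dg tau) gB0 Qu.
  have D2 := is_derive_translate (is_derive_prim_tau t'e (dg tau) gB0 Qu').
  have D3 := is_derive_prim_tau t'e (dg1 tau) gB1 Qu.
  exact: is_deriveB (is_deriveB D2 D1) (is_deriveZ h D3).
- move=> u ue; have Qu := ball_set_coord Qz ue.
  have Qu' : Q (h *: ee i + set_coord tau z u).
    by rewrite -set_coord_shift_other //; exact: ball_set_coord Qhz ue.
  exact: taylor2 (dg i) (dg1 i) gB Qu Qu'.
- by rewrite /K -set_coord_shift_other // !prim_set_coord mulr0 !subr0.
Qed.

(* A derivative of [prim g]: [true] tags words in which [tau] has occurred, and
   the innermost [tau] has been cancelled against the primitive. *)
Fixpoint prim_word p : bool * seq 'I_d :=
  if p is i :: p' then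
    let: (b, w) := prim_word p' in
    if b then (true, i :: w) else if i == tau then (true, w) else (false, i :: w)
  else (false, [::]).

Definition prim_family g p : 'rV[R]_d -> R :=
  let: (b, w) := prim_word p in
  if b then iter_partial w g else prim (iter_partial w g).

Lemma prim_word_notin p : tau \notin p -> prim_word p = (false, p).
Proof.
elim: p => [//|i p IH]; rewrite inE negb_or eq_sym => /andP[it /IH /= ->].
by rewrite (negPf it).
Qed.

(** Only words without [tau] gain the factor [2 * e]; a word containing [tau] cancels the
    primitive. *)
Lemma smooth_bounded_prim g : smooth_bounded Q g ->
  smooth_bounded Q (prim g) /\
  (forall z, Q z -> pd tau (prim g) z = g z) /\
  (forall p (B : R), tau \notin p -> (forall z, Q z -> `|iter_partial p g z| <= B) ->
     forall z, Q z -> `|iter_partial p (prim g) z| <= 2 * e * B).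
Proof.
move=> sbg.
have primB w : exists B : R, forall z, Q z -> `|prim (iter_partial w g) z| <= B.
  have [[sg bg]] := (sbg, smooth_bounded_iter w sbg); move=> [sw /(_ [::])[B gB]].
  exists (2 * e * B) => z Qz; apply: (prim_le t'e _ gB Qz) => y.
  exact: smooth_on_derivable sw.
have [sp Ep] : smooth_on Q (prim g) /\ forall p z, Q z -> iter_partial p (prim g) z = prim_family g p z.
  apply: smooth_ball_family => //.
    move=> p; rewrite /prim_family; case: (prim_word p) => -[] w //.
    by have [_] := sbg; exact.
  move=> p i a Qa; rewrite /prim_family /=; case: (prim_word p) => -[] w.
    have [sw _] := smooth_bounded_iter w sbg; exact: smooth_on_is_derive sw Qa.
  have sw := smooth_bounded_iter w sbg; case: eqVneq => [->|it].
    have [sw' /(_ [::])[B wB]] := sw; apply: (is_derive_prim_tau t'e _ wB Qa) => y.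
    exact: smooth_on_derivable sw'.
  exact: is_derive_prim_other.
split; [split=> // p|split].
- have : exists B : R, forall z, Q z -> `|prim_family g p z| <= B.
    rewrite /prim_family; case: (prim_word p) => -[] w' //.
    by have [_] := sbg; exact.
  by move=> [B HB]; exists B => z Qz; rewrite Ep ?HB.
- by move=> z Qz; have := Ep [:: tau] z Qz; rewrite /prim_family /= eqxx.
- move=> p B tp gB z Qz; rewrite Ep // /prim_family prim_word_notin //.
  apply: (prim_le t'e _ gB Qz) => y; have [sw _] := smooth_bounded_iter p sbg.
  exact: smooth_on_derivable sw.
Qed.

End PrimitiveSmooth.

(** * Limits of smooth functions *)

Lemma cvgn_norm_le {R : realType} (u : nat -> R) (l B : R) :
  u j @[j --> \oo] --> l -> (forall j, `|u j| <= B) -> `|l| <= B.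
Proof.
move=> ul uB.
have ul' : `|u j| @[j --> \oo] --> `|l| by exact: cvg_norm.
rewrite -(cvg_lim _ ul') //; apply: limr_le; first by apply/cvg_ex; exists `|l|.
exact: nearW.
Qed.

Section SmoothLimit.
Context {R : realType} {d : nat}.
Variables (z0 : 'rV[R]_d) (e : R) (fj : nat -> 'rV[R]_d -> R) (f : 'rV[R]_d -> R)
  (B : seq 'I_d -> R).
Implicit Types (x y z : 'rV[R]_d) (i j : 'I_d) (p q : seq 'I_d).
Local Notation ee i := (delta_mx 0 i : 'rV[R]_d).
Local Notation pd i f := ('D_(ee i) f).
Local Notation Q := (ball z0 e).
Hypotheses (e0 : 0 < e) (sfj : forall n, smooth_on Q (fj n)).
Hypothesis fjB : forall p n z, Q z -> `|iter_partial p (fj n) z| <= B p.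
Hypothesis fjf : forall z, Q z -> fj n z @[n --> \oo] --> f z.

Let near_line i z : Q z -> \forall h \near (0 : R), Q (h *: ee i + z).
Proof.
move=> Qz.
have Qo : nbhs (0 *: ee i + z) Q.
  by rewrite scale0r add0r; exact: (open_nbhs_nbhs (conj (ball_open z0 e) Qz)).
have c : {for (0 : R), continuous (fun h : R => h *: ee i + z)}.
  exact: continuousD (@scalel_continuous _ _ _ _) (@cst_continuous _ _ _ _).
exact: c Qo.
Qed.

Let quad p i n z (h : R) : Q z -> Q (h *: ee i + z) ->
  `|iter_partial p (fj n) (h *: ee i + z) - iter_partial p (fj n) z
    - h * iter_partial (i :: p) (fj n) z| <= B (i :: i :: p) * h ^+ 2.
Proof.
move=> Qz Qhz; apply: (taylor2 (z0 := z0) (e := e)) => //.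
- move=> y; exact: smooth_on_derivable (smooth_on_iter p (sfj n)).
- move=> y; exact: smooth_on_derivable (smooth_on_iter (i :: p) (sfj n)).
- by move=> y; exact: (fjB (i :: i :: p)).
Qed.

Let F p z : R := lim (iter_partial p (fj n) z @[n --> \oo]).

(** Difference quotients of the preceding derivative with a fixed step [h] converge by induction,
    and they differ from the derivative by a multiple of [h] uniformly in [n]; so the derivatives
    form a Cauchy sequence. *)
Let cvgF p z : Q z -> iter_partial p (fj n) z @[n --> \oo] --> F p z.
Proof.
elim: p z => [|i p IH] z Qz; first by rewrite /F /= (cvg_lim _ (fjf Qz)) //; exact: fjf.
suff : cvgn (fun n => iter_partial (i :: p) (fj n) z) by [].
apply/cauchy_cvgP; apply: cauchy_exP => eps eps0.
pose C := `|B (i :: i :: p)| + 1; have C0 : 0 < C by rewrite ltr_wpDl.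
have n1 : \forall h \near (0 : R)^', Q (h *: ee i + z) /\ `|h| <= eps / 4 / C.
  have n3 : \forall h \near (0 : R), `|h| <= eps / 4 / C.
    by apply: nbhs0_le; rewrite !divr_gt0.
  by apply: cvg_within; exact: filterI (near_line i Qz) n3.
have n2 : \forall h \near (0 : R)^', h != 0 by exact: nbhs_dnbhs_neq.
have [h [[Qhz hC] h0]] := @filter_ex _ _ (Proper_dnbhs_numFieldType (0 : R)) _ (filterI n1 n2).
exists (h^-1 * (F p (h *: ee i + z) - F p z)).
have cq : h^-1 * (iter_partial p (fj n) (h *: ee i + z) - iter_partial p (fj n) z)
    @[n --> \oo] --> h^-1 * (F p (h *: ee i + z) - F p z).
  by apply: cvgM; [exact: cvg_cst|apply: cvgB; exact: IH].
have e2 : 0 < eps / 2 by rewrite divr_gt0.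
move/cvgrPdist_lt: cq => /(_ _ e2); apply: filterS => n nH.
rewrite /ball /= (splitr eps) (le_lt_trans (ler_distD (h^-1 * (iter_partial p (fj n) (h *: ee i + z) - iter_partial p (fj n) z)) _ _)) //.
apply: ltr_leD => //.
rewrite -[X in _ - X](mulKf h0) -mulrBr normrM normfV ler_pdivrMl ?normr_gt0 //.
apply: le_trans (quad p n Qz Qhz) _.
apply: (@le_trans _ _ (C * (`|h| * `|h|))).
  rewrite -expr2 real_normK ?num_real // ler_wpM2r ?sqr_ge0 //.
  by rewrite (le_trans (ler_norm _)) // lerDl.
rewrite mulrCA ler_wpM2l // mulrC -ler_pdivlMr // (le_trans hC) // ler_wpM2r ?invr_ge0 ?(ltW C0) //.
by lra.
Qed.

(** The quadratic remainder bounds are uniform in [n] and pass to the limit, where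
    [is_derive_quadratic] identifies the limits [F p] as successive derivatives. *)
Lemma smooth_limit : smooth_bounded Q f /\
  forall p z, Q z -> iter_partial p (fj n) z @[n --> \oo] --> iter_partial p f z.
Proof.
have FB p z : Q z -> `|F p z| <= B p.
  move=> Qz; apply: (@cvgn_norm_le _ (fun n => iter_partial p (fj n) z)).
    exact: cvgF.
  by move=> n; exact: fjB.
have [sf Ef] : smooth_on Q f /\ forall p z, Q z -> iter_partial p f z = F p z.
  apply: smooth_ball_family => //.
  - by move=> z Qz; rewrite /F /= (cvg_lim _ (fjf Qz)).
  - by move=> p; exists (B p); exact: FB.
  move=> p i a Qa; apply: (is_derive_quadratic (C := B (i :: i :: p))).
  apply: filterS (near_line i Qa) => h Qha.
  apply: (@cvgn_norm_le _ (fun n => iter_partial p (fj n) (h *: ee i + a) -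
     iter_partial p (fj n) a - h * iter_partial (i :: p) (fj n) a)).
    apply: cvgB; first by apply: cvgB; exact: cvgF.
    by apply: cvgM; [exact: cvg_cst|exact: cvgF].
  by move=> n; exact: quad.
split; first by split=> // p; exists (B p) => z Qz; rewrite Ef //; exact: FB.
by move=> p z Qz; rewrite Ef //; exact: cvgF.
Qed.

End SmoothLimit.

(** * Picard iteration *)

Lemma cvgn_geometric {R : realType} (u : nat -> R) (C : R) :
  (forall n, `|u n.+1 - u n| <= C / 2 ^+ n) -> cvgn u.
Proof.
move=> uC; have C0 : 0 <= C.
  by have := le_trans (normr_ge0 _) (uC 0%N); rewrite expr0 divr1.
have E : u = (fun n => u 0%N + series (telescope u) n).
  by apply/funext => n; exact: eq_sum_telescope.
rewrite E; apply: is_cvgD; first exact: is_cvg_cst.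
apply: normed_cvg; apply: (@series_le_cvg _ _ (geometric C 2^-1)) => [n|n|n|].
- exact: normr_ge0.
- by rewrite /= mulr_ge0 // exprn_ge0.
- by rewrite /= exprVn; exact: uC.
- by apply: is_cvg_geometric_series; rewrite ger0_norm // invf_lt1 // ltr1n.
Qed.

Lemma cvg_rV {R : realType} {d : nat} (u : nat -> 'rV[R]_d) (l : 'rV[R]_d) :
  (forall i, u n 0 i @[n --> \oo] --> l 0 i) -> u n @[n --> \oo] --> l.
Proof.
move=> ul; apply/(@cvgrPdist_le R 'rV[R]_d nat \oo) => eps eps0.
have H : \forall n \near \oo, forall i, `|l 0 i - u n 0 i| <= eps.
  apply: (@filter_forall _ _ (fun i n => `|l 0 i - u n 0 i| <= eps) \oo _) => i.
  by move: (ul i) => /(@cvgrPdist_le R R^o nat \oo) /(_ _ eps0).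
by apply: filterS H => n H; apply: norm_rV_le => [|i]; [exact: ltW|rewrite !mxE].
Qed.

Lemma iter_partial_cst {R : realType} {d : nat} (c : R) (p : seq 'I_d) (z : 'rV[R]_d) :
  p != [::] -> iter_partial p (cst c) z = 0.
Proof.
case/lastP: p => [//|p i] _; rewrite iter_partial_rcons.
have -> : 'D_(delta_mx 0 i) (cst c : 'rV[R]_d -> R) = cst 0.
  by apply/funext => x; have [_ ->] := is_derive_cst c x (delta_mx 0 i : 'rV[R]_d).
elim/last_ind: p z => [//|p j IH] z; rewrite iter_partial_rcons.
have -> : 'D_(delta_mx 0 j) (cst 0 : 'rV[R]_d -> R) = cst 0.
  by apply/funext => x; have [_ ->] := is_derive_cst (0 : R) x (delta_mx 0 j : 'rV[R]_d).
exact: IH.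
Qed.

Section Picard.
Context {R : realType} {d : nat}.
Variables (tau : 'I_d) (V : 'rV[R]_d -> 'rV[R]_d) (z1 : 'rV[R]_d) (r0 e t' : R).
Variables (W0 W : seq 'I_d -> R) (lam kap M rho M0 : R).
Implicit Types (x y z : 'rV[R]_d) (i j : 'I_d) (p q : seq 'I_d) (phi : 'rV[R]_d -> 'rV[R]_d).
Local Notation ee i := (delta_mx 0 i : 'rV[R]_d).
Local Notation pd i f := ('D_(ee i) f).
Local Notation Q := (ball z1 e).
Local Notation D0 := (ball z1 r0).
Local Notation fct n := (n`!%:R * (kap / n%:R ^+ 2)).
Local Notation C := (2 * M * (d%:R * lam * rho)).

Hypothesis t'e : `|t' - z1 0 tau| < e.
Hypotheses (lam_gt0 : 0 < lam) (kap_gt0 : 0 < kap) (M_ge0 : 0 <= M) (rho_ge0 : 0 <= rho) (r0_gt0 : 0 < r0).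
Hypotheses (M0_ge0 : 0 <= M0) (W_gt0 : forall p, 0 < W p).
Hypothesis W_perm : forall p q, perm_eq p q -> W p = W q.
Hypothesis FdB : forall (j : seq 'I_d) (qs : seq (seq 'I_d)), j != [::] -> size qs = size j ->
    all (fun q => q != [::]) qs ->
    W0 j * \prod_(q <- qs) W q <= lam ^+ size j * W (flatten qs).
Hypothesis sV : forall i, smooth_on D0 (Defs.coord V i).
Hypothesis VM0 : forall i z, D0 z -> `|Defs.coord V i z| <= M0.
Hypothesis VM : forall i p z, p != [::] -> D0 z ->
  `|iter_partial p (Defs.coord V i) z| <= W0 p * ((size p)`!%:R * (M * rho ^+ size p)).
(** Here [small_kap] is the condition of [comp_bound]. By [space_W] and [small_e] the initial value
    and the primitive each use at most half of the bound. [time_W] treats the word [[:: tau]], and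
    [shift_W] longer words with a time derivative. [small_e0] keeps the iterates in the box of
    radius [r0 / 2], and [small_eL] makes the iteration contract. *)
Hypothesis small_kap : 16 * kap * (d%:R * lam * rho) <= 1.
Hypothesis space_W : forall i, i != tau -> 2 <= W [:: i] * kap.
Hypothesis time_W : M0 <= W [:: tau] * kap.
Hypothesis shift_W : forall p, p != [::] -> C * (W p * fct (size p)) <= W (rcons p tau) * fct (size p).+1.
Hypothesis small_e : 2 * e * C <= 1 / 2.
Hypothesis small_e0 : e + 2 * e * M0 <= r0 / 2.
Hypothesis small_eL : 2 * e * (\sum_i W0 [:: i] * (M * rho)) <= 1 / 2.

Let e_gt0 : 0 < e. Proof. exact: le_lt_trans (normr_ge0 _) t'e. Qed.

Let oQ : open Q. Proof. exact: ball_open. Qed.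

Let fct1 : fct 1%N = kap. Proof. by rewrite [1`!]/= mul1r expr1n divr1. Qed.

Let fct_ge0 n : 0 <= fct n.
Proof. by rewrite mulr_ge0 // divr_ge0 ?sqr_ge0 // ltW. Qed.

(** The closed bound [r0 / 2] passes to the limit and still leaves the values inside the open domain
    [D0] of the field. *)
Definition picard_inv phi : Prop :=
  [/\ forall z i, Q z -> `|phi z 0 i - z1 0 i| <= r0 / 2,
      forall i, smooth_on Q (Defs.coord phi i) &
      forall i p z, p != [::] -> Q z -> `|iter_partial p (Defs.coord phi i) z| <= W p * fct (size p)].

(** A fixed point gives at [z] the value, at the time of [z], of the solution that at time [t'] has
    the spatial position of [z]; hence the initial value [set_coord tau z t']. *)
Definition picard_step phi z : 'rV[R]_d :=
  \row_i (set_coord tau z t' 0 i + prim tau z1 e t' (Defs.coord V i \o phi) z).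

Let base i z : R := set_coord tau z t' 0 i.

Let smooth_base i : smooth_on Q (base i) /\
  forall p z, p != [::] -> Q z -> `|iter_partial p (base i) z| <= ((p == [:: i]) && (i != tau))%:R.
Proof.
have [->|it] := eqVneq i tau.
  have -> : base tau = cst t' by apply/funext => z; rewrite /base set_coord_tau.
  split; first exact: smooth_on_cst.
  by move=> p z p0 Qz; rewrite iter_partial_cst // normr0 ler0n.
have -> : base i = (fun z => z 0 i) by apply/funext => z; rewrite /base set_coord_other.
have [s1 s2] := @smooth_on_coord R d _ i oQ; split=> // p z p0 Qz.
rewrite s2 ?inE // andbT; case: p p0 => [//|j [|k p]] _; last by rewrite normr0 ler0n.
by rewrite normr_nat eqseq_cons eqxx andbT eq_sym.
Qed.

Let base_ball i z : Q z -> `|base i z - z1 0 i| <= e.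
Proof.
by move=> Qz; apply/ltW; have /(ball_rVP _ _ e_gt0) := ball_set_coord Qz t'e; exact.
Qed.

Lemma picard_inv_D0 phi z : picard_inv phi -> Q z -> D0 (phi z).
Proof.
move=> [a _ _] Qz; apply/ball_rVP => // i; apply: le_lt_trans (a z i Qz) _.
by rewrite ltr_pdivrMr // ltr_pMr // ltr1n.
Qed.

Lemma picard_rhs phi i : picard_inv phi ->
  smooth_bounded Q (Defs.coord V i \o phi) /\
  forall p z, p != [::] -> Q z ->
    `|iter_partial p (Defs.coord V i \o phi) z| <= W p * ((size p)`!%:R * (C * (kap / (size p)%:R ^+ 2))).
Proof.
move=> inv; have [_ sphi bphi] := inv.
have QD z : Q z -> D0 (phi z) by exact: picard_inv_D0.
have oD : open D0 by exact: ball_open.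
have sg : smooth_on Q (Defs.coord V i \o phi) by exact: smooth_on_comp oQ oD QD (sV i) sphi.
have bd p z : p != [::] -> Q z ->
    `|iter_partial p (Defs.coord V i \o phi) z| <= W p * ((size p)`!%:R * (C * (kap / (size p)%:R ^+ 2))).
  move=> p0 Qz; apply: (comp_bound oQ oD QD (sV i) sphi Qz lam_gt0 W_gt0 W_perm FdB
    (ltW kap_gt0) M_ge0 rho_ge0 small_kap _ _ p0).
    by move=> j j0; apply: VM => //; exact: QD.
  by move=> k q q0; exact: bphi.
split=> //; split=> // p; have [->|p0] := eqVneq p [::].
  by exists M0 => z Qz; apply: VM0; exact: QD.
by exists (W p * ((size p)`!%:R * (C * (kap / (size p)%:R ^+ 2)))) => z; exact: bd.
Qed.

Lemma picard_step_tau phi i z : picard_inv phi -> Q z ->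
  is_derive z (ee tau) (Defs.coord (picard_step phi) i) (V (phi z) 0 i).
Proof.
move=> inv Qz; have [[sg bg] _] := picard_rhs i inv.
have [B gB] := bg [::].
have -> : Defs.coord (picard_step phi) i =
    base i + prim tau z1 e t' (Defs.coord V i \o phi).
  by apply/funext => y; rewrite /Defs.coord mxE.
have D2 : is_derive z (ee tau) (prim tau z1 e t' (Defs.coord V i \o phi)) (V (phi z) 0 i).
  by apply: (is_derive_prim_tau t'e _ gB Qz) => y; exact: smooth_on_derivable.
have [sb bb] := smooth_base i.
have D1 : is_derive z (ee tau) (base i) 0.
  have := smooth_on_is_derive tau sb Qz; have -> // : pd tau (base i) z = 0.
  apply/eqP; rewrite -normr_le0 (le_trans (bb [:: tau] z isT Qz)) //.
  by rewrite eqseq_cons andbT eq_sym andbN.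
by apply: is_derive_eq; rewrite add0r.
Qed.

Lemma picard_inv_base : picard_inv (fun z => set_coord tau z t').
Proof.
split.
- move=> z i Qz; apply: le_trans (base_ball i Qz) _; apply: le_trans _ small_e0.
  by rewrite lerDl !mulr_ge0 // ltW.
- by move=> i; have [] := smooth_base i.
- move=> i p z p0 Qz; have [_ bb] := smooth_base i; apply: le_trans (bb p z p0 Qz) _.
  have Wb : 0 <= W p * fct (size p) by rewrite mulr_ge0 // ltW.
  case: eqP Wb => [->|_] //=; case: eqVneq => [_|it] //= _.
  by rewrite fct1; have := space_W it; lra.
Qed.

Lemma picard_inv_step phi : picard_inv phi -> picard_inv (picard_step phi).
Proof.
move=> inv.
have E i : Defs.coord (picard_step phi) i =
    (fun z => base i z + prim tau z1 e t' (Defs.coord V i \o phi) z).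
  by apply/funext => z; rewrite /Defs.coord mxE.
have sp i := smooth_bounded_prim t'e (picard_rhs i inv).1.
have sstep i : smooth_on Q (Defs.coord (picard_step phi) i).
  rewrite E; apply: smooth_on_add => //; first by have [] := smooth_base i.
  by have [[]] := sp i.
split=> //.
- move=> z i Qz; rewrite mxE; apply: le_trans small_e0.
  rewrite addrAC (le_trans (ler_normD _ _)) // lerD //; first exact: base_ball.
  have [_ [_ pb]] := sp i; apply: (pb [::] M0) => // y Qy.
  by apply: VM0; exact: picard_inv_D0.
(* If [tau] occurs in [p], one occurrence is moved innermost, where it turns the step into
   [V \o phi]; the shorter remaining word is then bounded by [time_W] if empty and by [shift_W]
   otherwise. *)
- move=> i p z p0 Qz; have [taup|taup] := boolP (tau \in p).
    have pe : perm_eq p (rcons (rem tau p) tau) by rewrite perm_sym perm_rcons perm_sym perm_to_rem.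
    rewrite (iter_partial_perm oQ (sstep i) pe) ?inE // iter_partial_rcons.
    rewrite (@iter_partial_eq _ _ Q _ (Defs.coord V i \o phi)) ?inE //; last first.
      by move=> y /set_mem Qy; have [_ ->] := picard_step_tau i inv Qy.
    rewrite (W_perm pe) (perm_size pe) size_rcons.
    have [r0'|r0'] := eqVneq (rem tau p) [::].
      by rewrite r0' fct1 /= (le_trans (VM0 i (picard_inv_D0 inv Qz))).
    have [_ /(_ _ _ r0' Qz) H] := picard_rhs i inv.
    apply: le_trans H (le_trans _ (shift_W r0')).
    by apply: eq_lerW; move: (_ ^-1) (_ `!%:R) => a b; ring.
  (* Without [tau], the primitive supplies the factor [2 * e], and the initial value contributes at
     most 1, and that only for [p = [:: i]]. *)
  rewrite E (iter_partial_add p oQ (smooth_base i).1 (sp i).1.1) ?inE //.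
  have [_ bb] := smooth_base i.
  have [_ /(_ _ _ p0) H] := picard_rhs i inv.
  have [_ [_ /(_ p _ taup H z Qz) {}H]] := sp i.
  apply: le_trans (ler_normD _ _) _; apply: le_trans (lerD (bb p z p0 Qz) H) _.
  have Wf : 0 <= W p * fct (size p) by rewrite mulr_ge0 // ltW.
  rewrite (_ : 2 * e * _ = (2 * e * C) * (W p * fct (size p))); last first.
    by move: (_ ^-1) (_ `!%:R) => a b; ring.
  have H2 : 2 * e * C * (W p * fct (size p)) <= 1 / 2 * (W p * fct (size p)) by rewrite ler_wpM2r.
  have H1 : ((p == [:: i]) && (i != tau))%:R <= 1 / 2 * (W p * fct (size p)).
    case: eqP => [pi|_] /=; last by rewrite mulr_ge0.
    case: eqVneq => [_|it] /=; first by rewrite mulr_ge0.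
    by rewrite pi fct1; have := space_W it; lra.
  by apply: le_trans (lerD H1 H2) _; rewrite -mulrDl; apply: eq_lerW; rewrite -[RHS]mul1r; congr (_ * _); lra.
Qed.

Definition picard n : 'rV[R]_d -> 'rV[R]_d := iter n picard_step (fun z => set_coord tau z t').

Lemma picard_invP n : picard_inv (picard n).
Proof. by elim: n => [|n IH]; [exact: picard_inv_base|exact: picard_inv_step]. Qed.

Lemma picard_t' n z : picard n (set_coord tau z t') = set_coord tau z t'.
Proof.
case: n => [|n]; first by rewrite /= set_coord_set.
by apply/rowP => i; rewrite mxE prim_set_coord addr0 set_coord_set.
Qed.

(** All iterates agree at time [t'], so the Lipschitz bound of [V] and the short time interval halve
    the difference at each step. *)
Lemma picard_diff n i z : Q z -> `|picard n.+1 z 0 i - picard n z 0 i| <= r0 / 2 ^+ n.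
Proof.
elim: n i z => [|n IH] i z Qz.
  have [/(_ z i Qz) H1 _ _] := picard_invP 1; have [/(_ z i Qz) H0 _ _] := picard_invP 0.
  rewrite expr0 divr1 (le_trans (ler_distD (z1 0 i) _ _)) //.
  by rewrite [leRHS]splitr lerD // distrC.
have L y : Q y -> `|V (picard n.+1 y) 0 i - V (picard n y) 0 i| <=
    (\sum_i W0 [:: i] * (M * rho)) * (r0 / 2 ^+ n).
  move=> Qy; rewrite mulr_suml.
  apply: le_trans (@lip_ball _ _ z1 r0 (Defs.coord V i) (fun k => W0 [:: k] * (M * rho)) _ _ _ _
    (picard_inv_D0 (picard_invP n) Qy) (picard_inv_D0 (picard_invP n.+1) Qy)) _.
  - by move=> x j; exact: smooth_on_derivable.
  - move=> x j Dx; have := @VM i [:: j] x isT Dx.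
    by rewrite /= mul1r expr1.
  - apply: ler_sum => k _; apply: ler_wpM2l; last exact: IH.
    have := @VM i [:: k] (picard n y) isT (picard_inv_D0 (picard_invP n) Qy).
    by rewrite /= mul1r expr1; exact: le_trans.
have := bounded_tau_derivative t'e
  (K := fun y => Defs.coord (picard n.+2) i y - Defs.coord (picard n.+1) i y)
  (k := fun y => V (picard n.+1 y) 0 i - V (picard n y) 0 i)
  (C := (\sum_i W0 [:: i] * (M * rho)) * (r0 / 2 ^+ n)) Qz.
move=> H; apply: le_trans (H _ _ _) _.
- move=> u ue; have Qu := ball_set_coord Qz ue.
  exact: is_deriveB (picard_step_tau i (picard_invP n.+1) Qu) (picard_step_tau i (picard_invP n) Qu).
- by move=> u ue; apply: L; exact: ball_set_coord.
- by rewrite /Defs.coord !picard_t' subrr.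
- rewrite mulrA; apply: le_trans (ler_wpM2r _ small_eL) _; first by rewrite divr_ge0 ?exprn_ge0 // ltW.
  by apply: eq_lerW; rewrite exprSr invfM mul1r mulrC -mulrA.
Qed.

Lemma picard_solution : exists Psi : 'rV[R]_d -> 'rV[R]_d,
  [/\ forall z, Q z -> D0 (Psi z),
      forall i, smooth_on Q (Defs.coord Psi i),
      forall i p z, p != [::] -> Q z -> `|iter_partial p (Defs.coord Psi i) z| <= W p * fct (size p),
      forall i z, Q z -> pd tau (Defs.coord Psi i) z = V (Psi z) 0 i &
      forall z, Q z -> Psi (set_coord tau z t') = set_coord tau z t'].
Proof.
pose Psi z : 'rV[R]_d := \row_i lim (picard n z 0 i @[n --> \oo]).
have cPsi z i : Q z -> Defs.coord (picard n) i z @[n --> \oo] --> Defs.coord Psi i z.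
  move=> Qz; rewrite [Defs.coord Psi i z]mxE.
  by apply: (@cvgn_geometric _ _ r0) => n; exact: picard_diff.
pose B p := if p is [::] then \sum_i (`|z1 0 i| + r0 / 2) else W p * fct (size p).
have lim i : smooth_bounded Q (Defs.coord Psi i) /\ forall p z, Q z ->
    iter_partial p (Defs.coord (picard n) i) z @[n --> \oo] --> iter_partial p (Defs.coord Psi i) z.
  apply: (smooth_limit (B := B)) => //.
  - by move=> n; have [_ + _] := picard_invP n; exact.
  - move=> [|j p] n z Qz; last by have [_ _] := picard_invP n; exact.
    have [/(_ z i Qz) H _ _] := picard_invP n.
    rewrite /B (bigD1 i) //= -[leLHS]addr0 lerD //.
      rewrite -[Defs.coord _ _ _](subrK (z1 0 i)) addrC (le_trans (ler_normD _ _)) // lerD //.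
    by apply: sumr_ge0 => k _; rewrite addr_ge0 // divr_ge0 // ltW.
  - by move=> z; exact: cPsi.
have PsiB z i : Q z -> `|Psi z 0 i - z1 0 i| <= r0 / 2.
  move=> Qz; apply: (@cvgn_norm_le _ (fun n => Defs.coord (picard n) i z - z1 0 i)).
    by apply: cvgB; [exact: cPsi|exact: cvg_cst].
  by move=> n; have [/(_ z i Qz)] := picard_invP n.
have PsiD z : Q z -> D0 (Psi z).
  move=> Qz; apply/ball_rVP => // i; apply: le_lt_trans (PsiB z i Qz) _.
  by rewrite ltr_pdivrMr // ltr_pMr // ltr1n.
exists Psi; split=> //.
- by move=> i; have [[]] := lim i.
- move=> i p z p0 Qz; have [_ /(_ p z Qz) L] := lim i.
  by apply: (cvgn_norm_le L) => n; have [_ _] := picard_invP n; exact.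
(* The time derivative of iterate [n.+1] is [V] at iterate [n]; the two sides of the differential
   equation are limits of this one sequence. *)
- move=> i z Qz; have [_ /(_ [:: tau] z Qz) L] := lim i.
  have L2 : Defs.coord V i (picard n z) @[n --> \oo] --> Defs.coord V i (Psi z).
    have L1 : picard n z @[n --> \oo] --> Psi z by apply: cvg_rV => k; exact: cPsi.
    exact: (cvg_comp _ _ L1 (smooth_on_cont (sV i) (PsiD z Qz))).
  have L3 : iter_partial [:: tau] (Defs.coord (picard n.+1) i) z @[n --> \oo] --> pd tau (Defs.coord Psi i) z.
    by rewrite (cvg_shiftS (fun n => iter_partial [:: tau] (Defs.coord (picard n) i) z)).
  apply: (@cvg_unique _ _ _ _ _ _ L3); first exact: Rhausdorff.
  apply: cvg_trans L2; apply: near_eq_cvg; apply: nearW => n /=.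
  by have [_ ->] := picard_step_tau i (picard_invP n) Qz.
- move=> z Qz; apply/rowP => i.
  have Qt := ball_set_coord Qz t'e.
  apply: (@cvg_unique _ _ _ _ _ _ (cPsi _ i Qt)); first exact: Rhausdorff.
  have E : (fun n => Defs.coord (picard n) i (set_coord tau z t')) = cst (set_coord tau z t' 0 i).
    by apply/funext => n; rewrite /Defs.coord picard_t'.
  by rewrite E; exact: cvg_cst.
Qed.

End Picard.

(** * Local flows and the choice of constants *)

Section LocalFlow.
Context {R : realType} {d : nat}.
Implicit Types (x y z : 'rV[R]_d) (i j : 'I_d) (p q : seq 'I_d) (f : 'rV[R]_d -> R).
Implicit Types (A D : set 'rV[R]_d).
Local Notation ee i := (delta_mx 0 i : 'rV[R]_d).
Local Notation pd i f := ('D_(ee i) f).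

Definition word_weight (W0 : seq 'I_d -> R) (lam : R) : Prop :=
  [/\ 0 < lam, forall p, 0 < W0 p, forall p q, perm_eq p q -> W0 p = W0 q &
    forall (j : seq 'I_d) (qs : seq (seq 'I_d)), j != [::] -> size qs = size j ->
      all (fun q => q != [::]) qs ->
      W0 j * \prod_(q <- qs) W0 q <= lam ^+ size j * W0 (flatten qs)].

Definition wbound (W0 : seq 'I_d -> R) A f : Prop :=
  smooth_on A f /\ exists M rho : R, [/\ 0 <= M, 0 <= rho &
    forall p z, p != [::] -> A z ->
      `|iter_partial p f z| <= W0 p * ((size p)`!%:R * (M * rho ^+ size p))].

Lemma wbound_unif W0 A (f : 'I_d -> 'rV[R]_d -> R) : (forall p, 0 < W0 p) ->
  (forall i, wbound W0 A (f i)) ->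
  exists M rho : R, [/\ 0 <= M, 0 <= rho &
    forall i p z, p != [::] -> A z ->
      `|iter_partial p (f i) z| <= W0 p * ((size p)`!%:R * (M * rho ^+ size p))].
Proof.
move=> W0p fb.
have /choice[Mr HMr] : forall i, exists Mr : R * R, [/\ 0 <= Mr.1, 0 <= Mr.2 &
    forall p z, p != [::] -> A z ->
      `|iter_partial p (f i) z| <= W0 p * ((size p)`!%:R * (Mr.1 * Mr.2 ^+ size p))].
  by move=> i; have [_ [M [rho H]]] := fb i; exists (M, rho).
have s1 : 0 <= \sum_i (Mr i).1 by apply: sumr_ge0 => i _; have [] := HMr i.
have s2 : 0 <= \sum_i (Mr i).2 by apply: sumr_ge0 => i _; have [] := HMr i.
exists (\sum_i (Mr i).1), (\sum_i (Mr i).2); split=> // i p z p0 Az.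
have [M0 r0 /(_ p z p0 Az) H] := HMr i; apply: le_trans H _.
apply: ler_wpM2l; first exact: ltW.
apply: ler_wpM2l => //; apply: ler_pM => //; first exact: exprn_ge0.
  by rewrite (bigD1 i) //= lerDl; apply: sumr_ge0 => k _; have [] := HMr k.
apply: lerXn2r; rewrite ?nnegrE //.
by rewrite (bigD1 i) //= lerDl; apply: sumr_ge0 => k _; have [] := HMr k.
Qed.

(** Rescaling factors multiply along concatenation, so they appear equally on both sides of FdB when
    only the inner weight is rescaled. *)
Lemma prod_scaled_weight (W0 : seq 'I_d -> R) (tau : 'I_d) (s T : R) (qs : seq (seq 'I_d)) :
  \prod_(q <- qs) (W0 q * s ^+ size q * T ^+ count_mem tau q) =
  (\prod_(q <- qs) W0 q) * s ^+ size (flatten qs) * T ^+ count_mem tau (flatten qs).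
Proof.
elim: qs => [|q qs IH]; first by rewrite !big_nil !expr0 !mulr1.
rewrite !big_cons IH /= size_cat count_cat !exprD.
by move: (s ^+ _) (s ^+ _) (T ^+ _) (T ^+ _) (\prod_(_ <- _) _) => a b c k u; ring.
Qed.

Lemma fact_sqr_le (n : nat) : (0 < n)%N ->
  n`!%:R / n%:R ^+ 2 <= 4 * (n.+1`!%:R / n.+1%:R ^+ 2) :> R.
Proof.
move=> n0; have x0 : 0 < n%:R :> R by rewrite ltr0n.
have y0 : 0 < n.+1%:R :> R by rewrite ltr0n.
rewrite ler_pdivrMr ?exprn_gt0 // mulrA mulrAC ler_pdivlMr ?exprn_gt0 //.
rewrite -!natrX -!natrM ler_nat factS.
have := fact_gt0 n; nia.
Qed.

(** The arithmetic of [shift_W]: [w], [w'] are the weights of [p] and [rcons p tau], [a] and [c] the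
    powers of [s] and [T] at [p], [g], [g'] the factorials and [u], [u'] the inverse squares. *)
Lemma shift_arith (C a c kap w w' s T c0 g u g' u' : R) :
  0 <= C -> 0 <= a -> 0 <= c -> 0 <= kap -> 0 <= w -> 0 <= w' -> 0 <= T ->
  0 <= g -> 0 <= u -> 0 <= g' -> 0 <= u' ->
  g * u <= 4 * (g' * u') -> w <= c0 * w' -> 4 * C * c0 <= T -> 1 <= s ->
  C * (w * a * c * (g * (kap * u))) <= w' * (a * s) * (c * T) * (g' * (kap * u')).
Proof.
move=> C0 a0 cc0 k0 w0 w'0 T0 g0 u0 g'0 u'0 gu ww' CT s1.
rewrite (_ : C * _ = (C * a * c * kap) * (w * (g * u))); last by ring.
rewrite (_ : w' * _ * _ * _ = (a * c * kap) * (s * T * (w' * (g' * u')))); last by ring.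
apply: (@le_trans _ _ ((C * a * c * kap) * ((c0 * w') * (4 * (g' * u'))))).
  apply: ler_wpM2l; first by rewrite !mulr_ge0.
  by apply: ler_pM => //; exact: mulr_ge0.
rewrite (_ : C * a * c * kap * _ = (a * c * kap) * (4 * C * c0 * (w' * (g' * u')))); last by ring.
apply: ler_wpM2l; first by rewrite !mulr_ge0.
apply: ler_wpM2r; first by rewrite !mulr_ge0.
by apply: le_trans CT _; rewrite ler_peMl.
Qed.

(** The radius [e] precedes [t']: the same box carries a flow for every initial time near that of
    its centre. *)
Lemma local_flow (tau : 'I_d) (W0 : seq 'I_d -> R) (lam r0 : R) (V : 'rV[R]_d -> 'rV[R]_d) z1 :
  word_weight W0 lam -> 0 < r0 ->
  (forall i, wbound W0 (ball z1 r0) (Defs.coord V i)) ->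
  exists2 e : R, 0 < e & forall t' : R, `|t' - z1 0 tau| < e ->
    exists Psi : 'rV[R]_d -> 'rV[R]_d,
    [/\ forall z, ball z1 e z -> ball z1 r0 (Psi z),
      forall i, wbound W0 (ball z1 e) (Defs.coord Psi i),
      forall i z, ball z1 e z -> pd tau (Defs.coord Psi i) z = V (Psi z) 0 i &
      forall z, ball z1 e z -> Psi (set_coord tau z t') = set_coord tau z t'].
Proof.
move=> [lam0 W0p W0perm FdB0] r0p Vb.
have sV i : smooth_on (ball z1 r0) (Defs.coord V i) by have [] := Vb i.
have [M [rho [M0' rho0 VM]]] := wbound_unif W0p Vb.
pose L := \sum_i W0 [:: i] * (M * rho).
have L0 : 0 <= L by apply: sumr_ge0 => i _; rewrite !mulr_ge0 // ltW.
(* [wbound] says nothing about the values of [V] themselves; they are bounded by the value at the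
   centre and the Lipschitz constant [L]. *)
pose M0 := \sum_i `|V z1 0 i| + L * r0.
have M0p : 0 <= M0 by rewrite addr_ge0 ?sumr_ge0 ?mulr_ge0 // ltW.
have VM0 i z : ball z1 r0 z -> `|Defs.coord V i z| <= M0.
  move=> Dz; have Dz1 : ball z1 r0 z1 by exact: ballxx.
  have := @lip_ball _ _ z1 r0 (Defs.coord V i) (fun k => W0 [:: k] * (M * rho)) z1 z.
  have dV y j : ball z1 r0 y -> derivable (Defs.coord V i) y (ee j).
    by move=> Dy; exact: smooth_on_derivable (sV i) Dy.
  move=> /(_ dV) H.
  have {}H := H _ Dz1 Dz.
  rewrite -[Defs.coord V i z](subrK (Defs.coord V i z1)) addrC.
  apply: le_trans (ler_normD _ _) _; apply: lerD.
    by rewrite (bigD1 i) //= lerDl sumr_ge0.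
  apply: le_trans (H _) _.
    move=> y j Dy; have := @VM i [:: j] y isT Dy.
    by rewrite /= mul1r expr1.
  rewrite mulr_suml; apply: ler_sum => k _; apply: ler_wpM2l.
    by rewrite !mulr_ge0 // ltW.
  by apply/ltW; move/(ball_rVP _ _ r0p): Dz => /(_ k).
pose b := d%:R * lam * rho; have b0 : 0 <= b by rewrite !mulr_ge0 // ltW.
pose kap : R := (16 * (b + 1))^-1.
have kap0 : 0 < kap by rewrite invr_gt0; lra.
have kapb : 16 * kap * b <= 1.
  have b1 : 0 < 16 * (b + 1) by lra.
  rewrite mulrAC /kap -[leLHS]/(_ / _) ler_pdivrMr // mul1r; lra.
pose C := 2 * M * b; have C0 : 0 <= C.
  by apply: mulr_ge0 => //; exact: mulr_ge0.
(* Each summand ensures [space_W] for one index; the 1 gives [1 <= s], used in [shift_arith]. *)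
pose s := 1 + \sum_i 2 / (W0 [:: i] * kap).
have s1 : 1 <= s by rewrite lerDl sumr_ge0 // => i _; rewrite divr_ge0 // mulr_ge0 // ltW.
pose c0 := lam ^+ 2 / (W0 [:: tau; tau] * W0 [:: tau]).
have c0p : 0 <= c0 by rewrite divr_ge0 ?sqr_ge0 // mulr_ge0 // ltW.
(* FdB with outer word [[:: tau; tau]] and inner words [p] and [[:: tau]] compares the weights of
   [p] and [rcons p tau]. *)
have W0s p : p != [::] -> W0 p <= c0 * W0 (rcons p tau).
  move=> p0; have := @FdB0 [:: tau; tau] [:: p; [:: tau]] isT erefl.
  rewrite /= p0 /= => /(_ isT); rewrite !big_cons big_nil mulr1 cats1 => H.
  rewrite /c0 mulrAC ler_pdivlMr ?mulr_gt0 //; apply: le_trans H.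
  by apply: eq_lerW; rewrite mulrCA.
(* The second summand ensures [time_W] and the third [shift_W], its 4 coming from [fact_sqr_le]; the
   1 allows [T ^+ count_mem tau p] to be bounded by [T ^+ size p] at the end. *)
pose T := 1 + M0 / (W0 [:: tau] * s * kap) + 4 * C * c0.
have s0 : 0 < s by lra.
have CC : 0 <= 4 * C * c0 by apply: mulr_ge0 => //; exact: mulr_ge0.
have q0 : 0 <= M0 / (W0 [:: tau] * s * kap) by rewrite divr_ge0 // !mulr_ge0 // ltW.
have T1 : 1 + M0 / (W0 [:: tau] * s * kap) <= T by rewrite lerDl.
have T2 : 4 * C * c0 <= T by rewrite lerDr addr_ge0.
have T0 : 1 <= T by lra.
have T0' : 0 < T by lra.
pose W p := W0 p * s ^+ size p * T ^+ count_mem tau p.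
have Wp p : 0 < W p by rewrite !mulr_gt0 // exprn_gt0.
have Wperm p q : perm_eq p q -> W p = W q.
  by move=> pq; rewrite /W (W0perm p q pq) (perm_size pq) (permP pq).
have FdB (j : seq 'I_d) (qs : seq (seq 'I_d)) : j != [::] -> size qs = size j ->
    all (fun q => q != [::]) qs ->
    W0 j * \prod_(q <- qs) W q <= lam ^+ size j * W (flatten qs).
  move=> j0 sz aq; rewrite prod_scaled_weight /W !mulrA.
  by rewrite !ler_wpM2r ?exprn_ge0 ?FdB0 // ltW.
have spaceW i : i != tau -> 2 <= W [:: i] * kap.
  move=> it; rewrite /W /= (negPf it) expr1 expr0 mulr1 mulrAC.
  rewrite -ler_pdivrMl ?mulr_gt0 // mulrC /s (bigD1 i) //= addrCA lerDl.
  rewrite addr_ge0 // sumr_ge0 // => k _; rewrite divr_ge0 // mulr_ge0 // ltW //.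
have timeW : M0 <= W [:: tau] * kap.
  rewrite /W /= eqxx expr1 expr1 mulrAC -ler_pdivrMl ?mulr_gt0 // mulrC.
  lra.
have shiftW p : p != [::] -> C * (W p * ((size p)`!%:R * (kap / (size p)%:R ^+ 2))) <=
    W (rcons p tau) * ((size p).+1`!%:R * (kap / (size p).+1%:R ^+ 2)).
  move=> p0; have sp : (0 < size p)%N by rewrite lt0n size_eq0.
  have H1 := fact_sqr_le sp; have H2 := W0s p p0.
  rewrite /W size_rcons -cats1 count_cat /= eqxx cats1 addn0 addn1 (exprSr s) (exprSr T).
  apply: (shift_arith (c0 := c0)) => //; try by [exact: ltW|rewrite invr_ge0 sqr_ge0|rewrite exprn_ge0 // ltW].

(* The first bound yields [small_e0], the second both [small_e] and [small_eL]. *)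
pose e := Num.min (r0 / (2 * (1 + 2 * M0))) (4 * (C + L + 1))^-1.
have e0 : 0 < e.
  by rewrite lt_min; apply/andP; split; [apply: divr_gt0 => //; lra | rewrite invr_gt0; lra].
have e1 : e <= r0 / (2 * (1 + 2 * M0)) by rewrite ge_min lexx.
have e2 : e <= (4 * (C + L + 1))^-1 by rewrite ge_min lexx orbT.
have e1' : e * (2 * (1 + 2 * M0)) <= r0 by rewrite -ler_pdivlMr //; lra.
have e2' : e * (4 * (C + L + 1)) <= 1 by rewrite -ler_pdivlMr ?mul1r //; lra.
have eC : 0 <= e * C by rewrite mulr_ge0 // ltW.
have eL : 0 <= e * L by rewrite mulr_ge0 // ltW.
exists e; first exact: e0.
move=> t' t'e.
have h1 : 2 * e * C <= 1 / 2 by nra.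
have h2 : e + 2 * e * M0 <= r0 / 2 by nra.
have h3 : 2 * e * L <= 1 / 2 by nra.
have [Psi [P1 P2 P3 P4 P5]] := picard_solution t'e lam0 kap0 M0' rho0 r0p M0p Wp Wperm FdB sV VM0 VM
   kapb spaceW timeW shiftW h1 h2 h3.
(* Back in the original weight, the rescaling becomes part of the geometric ratio and the inverse
   squares are bounded by 1. *)
exists Psi; split=> // i; split=> //; exists kap, (s * T); split.
- exact: ltW.
- by rewrite mulr_ge0 // ltW.
- move=> p z p0 Qz; apply: le_trans (P3 i p z p0 Qz) _.
  have sp : (0 < size p)%N by rewrite lt0n size_eq0.
  rewrite /W -!mulrA; apply: ler_wpM2l; first exact: ltW.
  rewrite exprMn.
  have Tc : T ^+ count_mem tau p <= T ^+ size p by rewrite ler_weXn2l // count_size.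
  have n2 : ((size p)%:R ^+ 2)^-1 <= 1 :> R.
    by rewrite invf_le1 ?exprn_gt0 ?ltr0n // exprn_ege1 // ler1n.
  have f0 : 0 <= (size p)`!%:R :> R by [].
  have a0 : 0 < s ^+ size p by exact: exprn_gt0.
  move: Tc n2 f0 a0; set a := s ^+ _; set c := T ^+ _; set c' := T ^+ _; set u := _ ^-1; set g := _`!%:R.
  move=> Tc n2 f0 a0.
  have u0 : 0 <= u by rewrite invr_ge0 sqr_ge0.
  have cc0 : 0 < c by exact: exprn_gt0.
  have -> : a * (c * (g * (kap * u))) = (a * g * kap) * (c * u) by ring.
  have -> : g * (kap * (a * c')) = (a * g * kap) * (c' * 1) by ring.
  apply: ler_wpM2l; first by rewrite !mulr_ge0 // ltW.
  by apply: ler_pM => //; exact: ltW.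
Qed.

End LocalFlow.

(** * Composition and integral curves *)

Section WboundComp.
Context {R : realType} {d : nat}.
Implicit Types (x y z : 'rV[R]_d) (i j : 'I_d) (p q : seq 'I_d) (f : 'rV[R]_d -> R).
Implicit Types (A D : set 'rV[R]_d).

Lemma sqr_le_exp4 (n : nat) : (n ^ 2 <= 4 ^ n)%N.
Proof.
have H : (n <= 2 ^ n)%N by rewrite ltnW // ltn_expl.
by rewrite (_ : 4 = 2 ^ 2)%N // -expnM mulnC expnM leq_sqr.
Qed.

(** [comp_bound] wants an inner bound with a small [kap] and inverse squares; the inner weight is
    rescaled by powers of [s] until the given bound of [g] takes that form. *)
Lemma wbound_comp W0 lam A D f (g : 'rV[R]_d -> 'rV[R]_d) :
  word_weight W0 lam -> open A -> open D -> (forall a, A a -> D (g a)) ->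
  wbound W0 D f -> (forall k, wbound W0 A (Defs.coord g k)) -> wbound W0 A (f \o g).
Proof.
move=> [lam0 W0p W0perm FdB0] oA oD AD [sf [M [rho [M0 rho0 fM]]]] gb.
have sg k : smooth_on A (Defs.coord g k) by have [] := gb k.
have [K [s0 [K0 s00 gK]]] := wbound_unif W0p gb.
split; first exact: smooth_on_comp oA oD AD sf sg.
pose b := d%:R * lam * rho; have b0 : 0 <= b by rewrite !mulr_ge0 // ltW.
pose kap : R := (16 * (b + 1))^-1.
have kap0 : 0 < kap by rewrite invr_gt0; lra.
have kapb : 16 * kap * b <= 1.
  have b1 : 0 < 16 * (b + 1) by lra.
  rewrite mulrAC /kap -[leLHS]/(_ / _) ler_pdivrMr // mul1r; lra.
have Kk : 0 <= K / kap by rewrite divr_ge0 // ltW.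
(* In [s ^+ n] the factor [4 ^+ n] dominates n^2, the second factor dominates [s0 ^+ n], and the
   third dominates [K / kap], as n is at least 1. *)
pose s := 4 * (s0 + 1) * (K / kap + 1).
have s_gt0 : 0 < s by rewrite !mulr_gt0 //; lra.
pose W p := W0 p * s ^+ size p.
have Wp p : 0 < W p by rewrite mulr_gt0 // exprn_gt0.
have Wperm p q : perm_eq p q -> W p = W q.
  by move=> pq; rewrite /W (W0perm p q pq) (perm_size pq).
have prodW (qs : seq (seq 'I_d)) : \prod_(q <- qs) W q = (\prod_(q <- qs) W0 q) * s ^+ size (flatten qs).
  elim: qs => [|q qs IH]; first by rewrite !big_nil expr0 mulr1.
  by rewrite !big_cons IH /= size_cat exprD /W mulrACA.
have FdB (j : seq 'I_d) (qs : seq (seq 'I_d)) : j != [::] -> size qs = size j ->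
    all (fun q => q != [::]) qs ->
    W0 j * \prod_(q <- qs) W q <= lam ^+ size j * W (flatten qs).
  move=> j0 sz aq; rewrite prodW /W !mulrA.
  by rewrite ler_wpM2r ?exprn_ge0 ?FdB0 // ltW.
have gW a k q : A a -> q != [::] ->
    `|iter_partial q (Defs.coord g k) a| <= W q * ((size q)`!%:R * (kap / (size q)%:R ^+ 2)).
  move=> Aa q0; apply: le_trans (gK k q a q0 Aa) _.
  have sp : (0 < size q)%N by rewrite lt0n size_eq0.
  rewrite /W -mulrA; apply: ler_wpM2l; first exact: ltW.
  rewrite [leRHS]mulrCA; apply: ler_wpM2l => //.
  rewrite mulrA ler_pdivlMr ?exprn_gt0 ?ltr0n // /s !exprMn.
  set n := size q; rewrite -natrX.
  have e1 : (n ^ 2)%:R <= 4 ^+ n :> R by rewrite -natrX ler_nat sqr_le_exp4.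
  have e2 : s0 ^+ n <= (s0 + 1) ^+ n by apply: lerXn2r; rewrite ?nnegrE; lra.
  have e3 : K <= kap * (K / kap + 1) ^+ n.
    rewrite -ler_pdivrMl // mulrC (@le_trans _ _ (K / kap + 1)) ?lerDl //.
    by rewrite -[leLHS]expr1 ler_weXn2l //; lra.
  have e0 : 0 <= s0 ^+ n by exact: exprn_ge0.
  apply: le_trans (ler_pM _ _ (ler_pM K0 e0 e3 e2) e1) _ => //; first exact: mulr_ge0.
  by apply: eq_lerW; move: (_ ^+ n) (_ ^+ n) (_ ^+ n) => u v w; ring.
exists (2 * M * b * kap), s; split.
- by rewrite !mulr_ge0 // ltW.
- exact: ltW.
move=> p a p0 Aa.
have H := comp_bound oA oD AD sf sg Aa lam0 Wp Wperm FdB (ltW kap0) M0 rho0 kapb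
  (fun w w0 => fM w (g a) w0 (AD a Aa)) (fun k w w0 => gW a k w Aa w0) p0.
apply: le_trans H _.
have sp : (0 < size p)%N by rewrite lt0n size_eq0.
have n2 : ((size p)%:R ^+ 2)^-1 <= 1 :> R.
  by rewrite invf_le1 ?exprn_gt0 ?ltr0n // exprn_ege1 // ler1n.
rewrite /W -mulrA; apply: ler_wpM2l; first exact: ltW.
rewrite [leLHS]mulrCA; apply: ler_wpM2l => //.
rewrite mulrC ler_wpM2r ?exprn_ge0 ?(ltW s_gt0) //.
rewrite mulrA ler_piMr // !mulr_ge0 // ltW //.
Qed.

Lemma wbound_coord W0 A i : (forall p, 0 < W0 p) -> open A -> wbound W0 A (fun z => z 0 i).
Proof.
move=> W0p oA; have [s1 s2] := @smooth_on_coord R d _ i oA; split=> //.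
exists (W0 [:: i])^-1, 1; split=> //; first by rewrite invr_ge0 ltW.
move=> p z p0 Az; rewrite s2 ?inE // expr1n mulr1.
have R0 : 0 <= W0 p * ((size p)`!%:R / W0 [:: i]) by rewrite mulr_ge0 ?divr_ge0 // ltW.
case: p p0 R0 => [//|j [|k p]] _ R0; last by rewrite normr0.
have [ij|ij] := eqVneq i j; last by rewrite normr0.
by rewrite normr1 -ij /= mul1r divff // lt0r_neq0.
Qed.

Lemma wbound_cst W0 A (k : R) : wbound W0 A (cst k).
Proof.
split; first exact: smooth_on_cst.
exists 0, 0; split=> // p z p0 _; rewrite iter_partial_cst // normr0.
by rewrite mul0r !mulr0.
Qed.

Lemma wbound_set_coord W0 A (tau : 'I_d) (t' : R) i : (forall p, 0 < W0 p) -> open A ->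
  wbound W0 A (fun z => set_coord tau z t' 0 i).
Proof.
move=> W0p oA; have [->|it] := eqVneq i tau.
  have -> : (fun z => set_coord tau z t' 0 tau) = cst t' by apply/funext => z; rewrite set_coord_tau.
  exact: wbound_cst.
have -> : (fun z => set_coord tau z t' 0 i) = (fun z => z 0 i).
  by apply/funext => z; rewrite set_coord_other.
exact: wbound_coord.
Qed.

End WboundComp.

(** An interval is connected. The step goes from any point near [t] to any other, so both [P] and
    its negation define open sets. *)
Lemma interval_chain {R : realType} (P : R -> Prop) (a b t0 : R) :
  a < t0 < b -> P t0 ->
  (forall t, a < t < b -> exists2 e : R, 0 < e & forall t' u, a < t' < b -> a < u < b ->
     `|t' - t| < e -> `|u - t| < e -> P t' -> P u) ->
  forall t, a < t < b -> P t.
Proof.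
move=> t0ab Pt0 step t tab.
have op (S : R -> Prop) : (forall x, S x -> exists2 e : R, 0 < e & forall y, a < y < b -> `|y - x| < e -> S y) ->
    (forall x, S x -> a < x < b) -> open [set x | S x].
  move=> Sx Sab; rewrite openE => x /= /[dup] /Sab /andP[ax xb] /Sx [e e0 H].
  have n1 : nbhs x [set y | a < y < b].
    have : open [set` `]a, b[] by exact: interval_open.
    rewrite openE => /(_ x) /=; rewrite in_itv /= ax xb => /(_ isT).
    by apply: filterS => y; rewrite /= in_itv.
  have n2 : nbhs x [set y | `|y - x| < e].
    have := @cvgrPdist_lt R R^o R (nbhs x) _ id x; move=> [/(_ cvg_id _ e0)] + _.
    by apply: filterS => y; rewrite /= distrC.
  by apply: filterS (filterI n1 n2) => y [y1 y2]; exact: H.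
pose B := [set x | a < x < b /\ P x]; pose N := [set x | a < x < b /\ ~ P x].
have oB : open B.
  apply: op => [x [xab Px]|x []//].
  have [e e0 H] := step x xab; exists e => // y yab yx; split=> //.
  by apply: (H x y) => //; rewrite subrr normr0.
have oN : open N.
  apply: op => [x [xab Px]|x []//].
  have [e e0 H] := step x xab; exists e => // y yab yx; split=> // Py.
  by apply: Px; apply: (H y x) => //; rewrite subrr normr0.
have BE : B = [set` `]a, b[].
  have := (connected_intervalP [set` `]a, b[]).2 (@interval_is_interval _ _).
  apply.
  - by exists t0.
  - exists B => //; apply/seteqP; split => x /=; rewrite in_itv /=.
      by move=> [xab Px]; split.
    by move=> [].
  - exists (~` N); first exact: open_closedC.
    apply/seteqP; split => x /=; rewrite in_itv /=.
      by move=> [xab Px]; split=> // -[].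
    by move=> [xab nN]; split=> //; apply: contrapT => nP; apply: nN.
have : B t by rewrite BE /= in_itv.
by case.
Qed.

(** * Uniqueness of integral curves *)

Section Uniqueness.
Context {R : realType} {d : nat}.
Implicit Types (x y z : 'rV[R]_d) (i j : 'I_d) (c : R -> 'rV[R]_d).

Definition integral_curve (D : set 'rV[R]_d) (V : 'rV[R]_d -> 'rV[R]_d) (a b : R) c : Prop :=
  forall t, a < t < b -> D (c t) /\
    forall i, is_derive t 1 (fun u => c u 0 i) (V (c t) 0 i).

Definition loc_lipschitz (D : set 'rV[R]_d) (V : 'rV[R]_d -> 'rV[R]_d) : Prop :=
  forall z, D z -> exists r L : R, [/\ 0 < r, 0 <= L &
    forall x y i, ball z r x -> ball z r y -> `|V y 0 i - V x 0 i| <= L * `|y - x|].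

Lemma integral_curve_continuous D V a b c t : integral_curve D V a b c -> a < t < b ->
  {for t, continuous c}.
Proof.
move=> ic tab; suff : c u @[u --> t] --> c t by [].
apply/(@cvgrPdist_le R 'rV[R]_d R (nbhs t)) => eps eps0.
have H : \forall u \near t, forall i, `|c t 0 i - c u 0 i| <= eps.
  apply: (@filter_forall _ _ (fun i u => `|c t 0 i - c u 0 i| <= eps) (nbhs t) _) => i.
  have [_ /(_ i)[di _]] := ic t tab.
  have := differentiable_continuous ((derivable1_diffP _ _).1 di).
  by move=> /(@cvgrPdist_le R R^o R (nbhs t)) /(_ _ eps0).
by apply: filterS H => u H; apply: norm_rV_le => [|i]; [exact: ltW|rewrite !mxE].
Qed.

Lemma MVT_points (f df : R -> R) (x y : R) :
  (forall s : R, 0 <= s <= 1 -> is_derive (s * (y - x) + x) 1 f (df (s * (y - x) + x))) ->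
  exists2 s : R, 0 <= s <= 1 & f y - f x = (y - x) * df (s * (y - x) + x).
Proof.
move=> D.
have [s s01|s s01 E] := @MVT_between R (fun u => f (u *: 1 + x)) (fun u => df (u + x)) (y - x).
  apply: (@is_derive_slice R R f x 1 (s * (y - x)) _).1.
  by rewrite [_ *: _]mulr1; exact: D.
exists s => //; move: E.
by rewrite ![_ *: _]mulr1 subrK add0r.
Qed.

Lemma integral_curve_unique D V a b c1 c2 t0 : loc_lipschitz D V ->
  integral_curve D V a b c1 -> integral_curve D V a b c2 ->
  a < t0 < b -> c1 t0 = c2 t0 -> forall t, a < t < b -> c1 t = c2 t.
Proof.
move=> lip ic1 ic2 t0ab E0; apply: (interval_chain t0ab E0) => t tab.
have k1 := integral_curve_continuous ic1 tab.
have k2 := integral_curve_continuous ic2 tab.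
have near_dist (P : R -> Prop) : (\forall u \near t, P u) ->
    exists2 e : R, 0 < e & forall u, `|u - t| < e -> P u.
  move=> /nbhs_ballP[e /= e0 H]; exists e => // u ut; apply: H.
  by rewrite /ball /= distrC.
(* If the curves differ at [t] they differ nearby by continuity, and the step to be shown is
   vacuous. *)
have [Et|Et] := eqVneq (c1 t) (c2 t); last first.
  have n : \forall u \near t, c1 u != c2 u.
    have cd : (fun u => c1 u - c2 u) u @[u --> t] --> c1 t - c2 t by exact: cvgB.
    have := @cvgr_neq0 _ _ _ _ _ _ _ cd; rewrite subr_eq0 => /(_ _ Et).
    by apply: filterS => u; rewrite subr_eq0.
  have [e e0 H] := near_dist _ n.
  by exists e => // t' u _ _ /H /eqP Nt' _ /Nt'.
have [D1 _] := ic1 t tab; have [r [L [r0 L0 HL]]] := lip _ D1.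
have n1 : \forall u \near t, ball (c1 t) r (c1 u) by exact: k1 (nbhsx_ballx _ _ r0).
have n2 : \forall u \near t, ball (c1 t) r (c2 u).
  by rewrite Et; exact: k2 (nbhsx_ballx _ _ r0).
have [e1 e10 H1] := near_dist _ n1; have [e2 e20 H2] := near_dist _ n2.
pose e := Num.min (Num.min e1 e2) (4 * (L + 1))^-1.
have e0 : 0 < e by rewrite !lt_min e10 e20 invr_gt0; lra.
have ee1 : e <= e1 by rewrite !ge_min lexx.
have ee2 : e <= e2 by rewrite !ge_min lexx orbT.
have eeL : 2 * e * L <= 1 / 2.
  have : e <= (4 * (L + 1))^-1 by rewrite !ge_min lexx orbT.
  rewrite -[leRHS]mul1r ler_pdivlMr; last lra.
  by have : 0 <= e * L by [rewrite mulr_ge0 // ltW]; lra.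
exists e => // t' u t'ab uab t't ut Et'.
have seg (v s : R) : `|v - t| < e -> 0 <= s <= 1 ->
    `|s * (v - t') + t' - t| < e.
  move=> vt s01; move: vt t't; rewrite !ltr_norml => /andP[v1 v2] /andP[w1 w2].
  have := @convex_lt R t' v (t + e) s; have := @convex_lt R (- t') (- v) (e - t) s.
  move=> A1 A2; have {}A1 : - t' + s * (- v - - t') < e - t by apply: A1 => //; lra.
  have {}A2 : t' + s * (v - t') < t + e by apply: A2 => //; lra.
  by apply/andP; split; lra.
have segab (v s : R) : a < v < b -> 0 <= s <= 1 -> a < s * (v - t') + t' < b.
  move=> /andP[v1 v2] s01; have /andP[w1 w2] := t'ab.
  have := @convex_lt R t' v b s; have := @convex_lt R (- t') (- v) (- a) s.
  move=> A1 A2; have {}A1 : - t' + s * (- v - - t') < - a by apply: A1 => //; lra.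
  have {}A2 : t' + s * (v - t') < b by apply: A2 => //; lra.
  by apply/andP; split; lra.
(* The curves agree at [t'], so the mean value theorem and the Lipschitz bound halve any bound on
   their distance, as [2 * e * L] is at most 1/2. *)
have bound n : forall v, a < v < b -> `|v - t| < e -> `|c1 v - c2 v| <= 2 * r / 2 ^+ n.
  elim: n => [|n IH] v vab vt.
    rewrite expr0 divr1; apply: norm_rV_le => [|i]; first by lra.
    have /(ball_rVP _ _ r0)/(_ i) B1 := H1 v (lt_le_trans vt ee1).
    have /(ball_rVP _ _ r0)/(_ i) B2 := H2 v (lt_le_trans vt ee2).
    rewrite !mxE (le_trans (ler_distD (c1 t 0 i) _ _)) // (distrC (c1 t 0 i)); lra.
  have r2 k : 0 <= 2 * r / 2 ^+ k by rewrite divr_ge0 ?exprn_ge0 //; lra.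
  apply: norm_rV_le => [|i] //.
  have [s s01|s s01 E] := @MVT_points (fun w => c1 w 0 i - c2 w 0 i)
     (fun w => V (c1 w) 0 i - V (c2 w) 0 i) t' v.
    have sab := segab v s vab s01.
    by apply: is_deriveB; [have [_ /(_ i)] := ic1 _ sab|have [_ /(_ i)] := ic2 _ sab].
  move: E; rewrite Et' subrr subr0 !mxE => ->; rewrite normrM.
  have sab := segab v s vab s01; have st := seg v s vt s01.
  set w := s * (v - t') + t' in sab st *.
  have B1 := H1 w (lt_le_trans st ee1); have B2 := H2 w (lt_le_trans st ee2).
  have Hw := HL _ _ i B2 B1.
  have vt' : `|v - t'| <= 2 * e.
    rewrite (le_trans (ler_distD t _ _)) //.
    by rewrite (_ : 2 * e = e + e) ?lerD //; [rewrite ltW|rewrite distrC ltW|ring].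
  apply: (@le_trans _ _ ((2 * e) * (L * (2 * r / 2 ^+ n)))).
    apply: (ler_pM (normr_ge0 _) (normr_ge0 _) vt').
    apply: (le_trans Hw).
    apply: ler_wpM2l => //; exact: IH sab st.
  rewrite (mulrA (2 * e)); apply: le_trans (ler_wpM2r (r2 n) eeL) _.
  by apply: eq_lerW; rewrite exprSr invfM; move: (_ ^-1) => k; lra.
apply/eqP; rewrite -subr_eq0 -normr_le0.
have lim0 : (fun n => 2 * r / 2 ^+ n) n @[n --> \oo] --> (0 : R).
  have E : (fun n => 2 * r / 2 ^+ n) = geometric (2 * r) 2^-1.
    by apply/funext => n; rewrite /= exprVn.
  by rewrite E; apply: cvg_geometric; rewrite ger0_norm // invf_lt1 // ltr1n.
rewrite -(cvg_lim _ lim0) //; apply: limr_ge; first by apply/cvg_ex; exists 0.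
by apply: nearW => n; exact: bound.
Qed.

End Uniqueness.

(** * Continuation along integral curves *)

Section Global.
Context {R : realType} {d : nat}.
Implicit Types (x y z : 'rV[R]_d) (i j : 'I_d) (c : R -> 'rV[R]_d).
Local Notation ee i := (delta_mx 0 i : 'rV[R]_d).

Lemma wbound_eq W0 (A : set 'rV[R]_d) f g : open A -> (forall z, A z -> f z = g z) ->
  wbound W0 A f -> wbound W0 A g.
Proof.
move=> oA fg [sf [M [rho [M0 rho0 H]]]].
have fg' : {in A, f =1 g} by move=> z /set_mem; exact: fg.
split; first exact: smooth_on_eq fg' sf.
exists M, rho; split=> // p z p0 Az.
by rewrite -(iter_partial_eq p oA fg') ?inE //; exact: H.
Qed.

Lemma near_interval (a b t : R) : a < t < b -> \forall u \near t, a < u < b.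
Proof.
move=> /andP[a1 b1]; have : open [set` `]a, b[] by exact: interval_open.
rewrite openE => /(_ t) /=; rewrite in_itv /= a1 b1 => /(_ isT).
by apply: filterS => u; rewrite /= in_itv.
Qed.

(** Uniqueness makes the curves agree on the overlap, which contains [t']; hence the union of the
    two intervals is again an interval. *)
Lemma integral_curve_glue D V (a1 b1 a2 b2 : R) c1 c2 t' : loc_lipschitz D V ->
  integral_curve D V a1 b1 c1 -> integral_curve D V a2 b2 c2 ->
  a1 < t' < b1 -> a2 < t' < b2 -> c1 t' = c2 t' ->
  exists c, [/\ integral_curve D V (Num.min a1 a2) (Num.max b1 b2) c,
    forall u, a1 < u < b1 -> c u = c1 u & forall u, a2 < u < b2 -> c u = c2 u].
Proof.
move=> lip ic1 ic2 t1 t2 E.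
pose c u := if a1 < u < b1 then c1 u else c2 u.
have cE1 u : a1 < u < b1 -> c u = c1 u by rewrite /c => ->.
have sub1 : integral_curve D V (Num.max a1 a2) (Num.min b1 b2) c1.
  by move=> u; rewrite gt_max lt_min => /andP[/andP[u1 _] /andP[u3 _]]; apply: ic1; rewrite u1.
have sub2 : integral_curve D V (Num.max a1 a2) (Num.min b1 b2) c2.
  by move=> u; rewrite gt_max lt_min => /andP[/andP[_ u1] /andP[_ u3]]; apply: ic2; rewrite u1.
have t12 : Num.max a1 a2 < t' < Num.min b1 b2.
  by rewrite gt_max lt_min; move: t1 t2 => /andP[-> ->] /andP[-> ->].
have cE2 u : a2 < u < b2 -> c u = c2 u.
  rewrite /c; case: ifP => // /andP[u1 u2] /andP[u3 u4].
  apply: (integral_curve_unique lip sub1 sub2 t12 E).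
  by rewrite gt_max lt_min u1 u2 u3 u4.
exists c; split=> // u; rewrite gt_min lt_max => uab.
have P (a b : R) c' : integral_curve D V a b c' -> (forall v, a < v < b -> c v = c' v) ->
    a < u < b -> D (c u) /\ forall i, is_derive u 1 (fun v => c v 0 i) (V (c u) 0 i).
  move=> ic cc' uab'; have [Du du] := ic u uab'; rewrite cc' //; split=> // i.
  apply: near_eq_is_derive (du i).
  by apply: filterS (near_interval uab') => v /cc' ->.
have [u1|u1] := boolP (a1 < u < b1); first exact: P ic1 cE1 u1.
apply: P ic2 cE2 _; move: t1 t2 uab u1 => /andP[p1 p2] /andP[p3 p4].
rewrite negb_and -!leNgt => /andP[/orP[q1|q1] /orP[q2|q2]] /orP[u1|u1]; apply/andP; split; lra.
Qed.

Variables (tau : 'I_d) (D : set 'rV[R]_d) (V : 'rV[R]_d -> 'rV[R]_d).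
Variables (W0 : seq 'I_d -> R) (lam t0 : R) (Phi : 'rV[R]_d -> 'rV[R]_d).
Hypothesis W0w : word_weight W0 lam.
Hypothesis Vtau : forall z, V z 0 tau = 1.
Hypothesis Vb : forall z, D z -> exists r : R, [/\ 0 < r, ball z r `<=` D &
  forall i, wbound W0 (ball z r) (Defs.coord V i)].

(** The flow domain for an autonomous field whose component [tau] is 1; [flow_domain_reached] proves
    the agreement. *)
Definition reached z : Prop := exists (a b : R) c,
  [/\ a < t0 < b, a < z 0 tau < b, integral_curve D V a b c & c t0 = set_coord tau z t0].

Hypothesis Phi0 : forall z, reached z -> z 0 tau = t0 -> Phi z = z.
Hypothesis PhiV : forall z, reached z -> D (Phi z) /\
  forall i, is_derive z (ee tau) (Defs.coord Phi i) (V (Phi z) 0 i).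

Let W0p p : 0 < W0 p. Proof. by have [_ + _ _] := W0w; exact. Qed.

Lemma wbound_loc_lipschitz : loc_lipschitz D V.
Proof.
move=> z /Vb[r [r0 _ wV]]; have [M [rho [M0 rho0 H]]] := wbound_unif W0p wV.
have B0 k : 0 <= W0 [:: k] * (M * rho) by rewrite !mulr_ge0 // ltW.
exists r, (\sum_k W0 [:: k] * (M * rho)); split=> //; first by rewrite sumr_ge0.
move=> x y i bx by_; have [sV _] := wV i.
apply: le_trans (@lip_ball _ _ z r (Defs.coord V i) (fun k => W0 [:: k] * (M * rho)) x y _ _ bx by_) _.
- by move=> w j Dw; exact: smooth_on_derivable sV Dw.
- by move=> w j Dw; have := @H i [:: j] w isT Dw; rewrite /= mul1r expr1.
- rewrite mulr_suml; apply: ler_sum => k _; apply: ler_wpM2l => //.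
  by have := norm_rV_coord (y - x) k; rewrite !mxE.
Qed.

Lemma integral_curve_tau (a b : R) c : integral_curve D V a b c -> a < t0 < b ->
  c t0 0 tau = t0 -> forall t, a < t < b -> c t 0 tau = t.
Proof.
move=> ic t0ab E t tab.
have [s s01|s s01] := @MVT_points R (fun u => c u 0 tau) (fun=> 1) t0 t.
  have sab : a < s * (t - t0) + t0 < b.
    move: t0ab tab => /andP[a1 a2] /andP[b1 b2].
    have A1 : - t0 + s * (- t - - t0) < - a by apply: convex_lt => //; lra.
    have A2 : t0 + s * (t - t0) < b by exact: convex_lt.
    by apply/andP; split; lra.
  by have [_ /(_ tau)] := ic _ sab; rewrite Vtau.
by rewrite mulr1 E; lra.
Qed.

Lemma set_coord_line z u : set_coord tau z u = u *: ee tau + set_coord tau z 0.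
Proof. by rewrite -(set_coord_set tau z 0 u) set_coordE set_coord_tau subr0. Qed.

Lemma is_derive_set_coord (f : 'rV[R]_d -> R) z u (Df : R) :
  is_derive (set_coord tau z u) (ee tau) f Df <->
  is_derive u 1 (fun t => f (set_coord tau z t)) Df.
Proof.
have -> : (fun t => f (set_coord tau z t)) = (fun t => f (t *: ee tau + set_coord tau z 0)).
  by apply/funext => t; rewrite set_coord_line.
by rewrite set_coord_line; exact: is_derive_line.
Qed.

(** Along the time line through [z], [Phi] is itself an integral curve with the same value at [t0],
    so uniqueness applies. *)
Lemma reachedE z (a b : R) c : a < t0 < b -> integral_curve D V a b c ->
  c t0 = set_coord tau z t0 ->
  forall u, a < u < b -> reached (set_coord tau z u) /\ Phi (set_coord tau z u) = c u.
Proof.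
move=> t0ab ic E.
have re u : a < u < b -> reached (set_coord tau z u).
  by move=> uab; exists a, b, c; split; rewrite ?set_coord_tau ?set_coord_set.
move=> u uab; split; first exact: re.
apply: (integral_curve_unique (c1 := fun u => Phi (set_coord tau z u))
  wbound_loc_lipschitz _ ic t0ab _ uab); last first.
  by rewrite Phi0 ?E // ?set_coord_tau //; exact: re.
move=> v vab; have [DP dP] := PhiV (re v vab); split=> // i.
exact/is_derive_set_coord.
Qed.

Lemma Phi_tau z : reached z -> Phi z 0 tau = z 0 tau.
Proof.
move=> [a [b [c [t0ab zab ic E]]]].
have [_] := reachedE t0ab ic E zab; rewrite set_coord_id => ->.
by apply: (integral_curve_tau ic t0ab _ zab); rewrite E set_coord_tau.
Qed.

Lemma local_curve (w y : 'rV[R]_d) (e r0 t' : R) Psi : ball w r0 `<=` D ->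
  (forall z, ball w e z -> ball w r0 (Psi z)) ->
  (forall i, wbound W0 (ball w e) (Defs.coord Psi i)) ->
  (forall i z, ball w e z -> 'D_(ee tau) (Defs.coord Psi i) z = V (Psi z) 0 i) ->
  ball w e y ->
  integral_curve D V (w 0 tau - e) (w 0 tau + e) (fun u => Psi (set_coord tau y u)).
Proof.
move=> rD P1 P2 P3 wy u /andP[u1 u2].
have bu : ball w e (set_coord tau y u).
  by apply: ball_set_coord => //; rewrite ltr_norml; apply/andP; split; lra.
split; first exact/rD/P1.
move=> i; apply/(is_derive_set_coord (Defs.coord Psi i)); rewrite -P3 //.
by have [sP _] := P2 i; exact: smooth_on_is_derive sP bu.
Qed.

(** The property carried along an integral curve. It includes that nearby points are reached, so it
    also yields openness of the flow domain. *)
Definition good z : Prop := exists r : R, [/\ 0 < r,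
  forall x, ball z r x -> reached x & forall i, wbound W0 (ball z r) (Defs.coord Phi i)].

Lemma good_start z : D (set_coord tau z t0) -> good (set_coord tau z t0).
Proof.
move=> Dz; set w := set_coord tau z t0 in Dz *.
have wt : w 0 tau = t0 by rewrite set_coord_tau.
have [r0 [r00 rD wV]] := Vb Dz.
have [e e0 /(_ t0)] := local_flow tau W0w r00 wV.
rewrite wt subrr normr0 => /(_ e0) [Psi [P1 P2 P3 P4]].
have cur x : ball w e x -> reached x /\ Phi x = Psi x.
  move=> wx; have ic := local_curve t0 rD P1 P2 P3 wx; rewrite wt in ic.
  have xt : t0 - e < x 0 tau < t0 + e.
    by move/(ball_rVP _ _ e0): wx => /(_ tau); rewrite wt ltr_distl.
  have t0e : t0 - e < t0 < t0 + e by apply/andP; split; lra.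
  have := reachedE t0e ic (P4 x wx) xt; rewrite set_coord_id; exact.
exists e; split=> //; first by move=> x /cur[].
move=> i; apply: wbound_eq (P2 i); first exact: ball_open.
by move=> x /cur[_ E]; rewrite /Defs.coord E.
Qed.

(** Near time [t], [Phi] is the composition of [Phi] at a time [t'] already known to be good with
    the local flow of initial time [t']; [wbound_comp] then transfers the bounds to time [u]. *)
Lemma good_propagate z (a b : R) c : a < t0 < b -> integral_curve D V a b c ->
  c t0 = set_coord tau z t0 ->
  forall t, a < t < b -> good (set_coord tau z t).
Proof.
move=> t0ab ic E; apply: (interval_chain t0ab).
  by apply: good_start; rewrite -E; have [] := ic t0 t0ab.
move=> t tab; have [Dt _] := ic t tab.
have wt : c t 0 tau = t by apply: (integral_curve_tau ic t0ab _ tab); rewrite E set_coord_tau.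
have [r0 [r00 rD wV]] := Vb Dt.
have [e e0 loc] := local_flow tau W0w r00 wV.
have e2 : 0 < e / 2 by rewrite divr_gt0.
have : \forall u \near t, ball (c t) (e / 2) (c u).
  exact: (integral_curve_continuous ic tab) (nbhsx_ballx _ _ e2).
move=> /nbhs_ballP[e1 /= e10 He1].
pose eta := Num.min e e1; have eta0 : 0 < eta by rewrite lt_min e0.
have etae : eta <= e by rewrite ge_min lexx.
have etae1 : eta <= e1 by rewrite ge_min lexx orbT.
exists eta; first exact: eta0.
move=> t' u t'ab uab t't ut [r [r_gt0 rR rW]].
have ct' : ball (c t) (e / 2) (c t').
  by apply: He1; rewrite /ball /= distrC (lt_le_trans t't).
have /loc[Psi [P1 P2 P3 P4]] : `|t' - c t 0 tau| < e by rewrite wt (lt_le_trans t't).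
pose zt' := set_coord tau z t'.
have Pzt' : Phi zt' = c t' by have [] := reachedE t0ab ic E t'ab.
(* Goodness at [t'] makes [Phi] continuous there; with [c t'] within [e / 2] of [c t], nearby values
   land in the box of the local flow. *)
have nP : \forall x \near zt', ball (c t) e (Phi x).
  have cP : {for zt', continuous Phi}.
    apply: rV_continuous => j; have [sP _] := rW j.
    by apply: smooth_on_cont sP _; exact: ballxx.
  apply: (cP (ball (c t) e)); rewrite Pzt' -[e]/(e) (splitr e).
  have := nbhsx_ballx (c t') _ e2; apply: filterS => x; exact: ball_triangle.
have [r1 /= r10 Hr1] := (nbhs_ballP _ _).1 nP.
pose r2 := Num.min (Num.min r r1) (eta - `|u - t|).
have r20 : 0 < r2 by rewrite !lt_min r_gt0 r10 subr_gt0.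
have r2r : r2 <= r by rewrite !ge_min lexx.
have r2r1 : r2 <= r1 by rewrite !ge_min lexx orbT.
have r2e : r2 <= eta - `|u - t| by rewrite !ge_min lexx !orbT.
set zu := set_coord tau z u.
have xt' x : ball zu r2 x -> ball zt' r2 (set_coord tau x t').
  move=> /(ball_rVP _ _ r20) bx; apply/(ball_rVP _ _ r20) => j.
  have [->|jt] := eqVneq j tau; first by rewrite !set_coord_tau subrr normr0.
  by have := bx j; rewrite !set_coord_other.
have xtau x : ball zu r2 x -> `|x 0 tau - t| < e.
  move=> /(ball_rVP _ _ r20) /(_ tau); rewrite set_coord_tau => bx.
  rewrite (le_lt_trans (ler_distD u _ _)) //.
  by have := lt_le_trans bx r2e; have := lt_le_trans ut etae; lra.
(* Flow from [t0] to [t'], then restore the time of [x]: [Psi] reads its argument as a position at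
   time [t'] together with the time to be reached. *)
pose G x := set_coord tau (Phi (set_coord tau x t')) (x 0 tau).
have PG x : ball zu r2 x -> ball (c t) e (Phi (set_coord tau x t')).
  by move=> /xt' bx; apply: Hr1; exact: le_ball bx.
have GB x : ball zu r2 x -> ball (c t) e (G x).
  by move=> bx; apply: ball_set_coord; [exact: PG|rewrite wt; exact: xtau].
(* The curve reaching time [t'] is glued to the local curve through the same point. The result
   extends from [t0] to the time of [x], and by [reachedE] it computes [Phi x]. *)
have key x : ball zu r2 x -> reached x /\ Phi x = Psi (G x).
  move=> bx; set y := Phi (set_coord tau x t').
  have rx : reached (set_coord tau x t') by apply: rR; exact: le_ball (xt' x bx).
  have yt : y 0 tau = t' by rewrite Phi_tau // set_coord_tau.
  have [a' [b' [c' [t0ab' t'ab' ic' E']]]] := rx.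
  rewrite set_coord_tau in t'ab'; rewrite set_coord_set in E'.
  have [_ Ey] := reachedE t0ab' ic' E' t'ab'.
  have ic2 := local_curve t' rD P1 P2 P3 (PG x bx).
  rewrite wt in ic2.
  have t't2 : t - e < t' < t + e.
    by have := lt_le_trans t't etae; rewrite ltr_distl.
  have glue0 : c' t' = Psi (set_coord tau (Phi (set_coord tau x t')) t').
    by rewrite -/y P4; [rewrite -[in RHS]yt set_coord_id /y Ey|exact: PG].
  have [c2 [ic3 c2E1 c2E2]] := integral_curve_glue wbound_loc_lipschitz ic' ic2 t'ab' t't2 glue0.
  have t0m : Num.min a' (t - e) < t0 < Num.max b' (t + e).
    by move: t0ab' => /andP[q1 q2]; rewrite gt_min lt_max q1 q2.
  have xm : t - e < x 0 tau < t + e.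
    by move: (xtau x bx); rewrite ltr_distl.
  have xm' : Num.min a' (t - e) < x 0 tau < Num.max b' (t + e).
    by move: xm => /andP[q1 q2]; rewrite gt_min lt_max q1 q2 !orbT.
  have E3 : c2 t0 = set_coord tau x t0 by rewrite c2E1.
  have := reachedE t0m ic3 E3 xm'; rewrite set_coord_id c2E2 //.
exists r2; split=> //; first by move=> x /key[].
move=> i; apply: (@wbound_eq _ _ (Defs.coord Psi i \o G)).
- exact: ball_open.
- by move=> x /key[_ Ex]; rewrite /= /Defs.coord -Ex.
apply: (wbound_comp W0w (D := ball (c t) e) _ _ GB (P2 i)); try exact: ball_open.
move=> k; have [->|kt] := eqVneq k tau.
  have -> : Defs.coord G tau = (fun x => x 0 tau).
    by apply/funext => x; rewrite /Defs.coord set_coord_tau.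
  by apply: wbound_coord => //; exact: ball_open.
have -> : Defs.coord G k = Defs.coord Phi k \o (fun x => set_coord tau x t').
  by apply/funext => x; rewrite /Defs.coord set_coord_other.
apply: (wbound_comp W0w (D := ball zt' r) _ _ _ (rW k)); try exact: ball_open.
  by move=> x /xt' bx; exact: le_ball bx.
by move=> j; apply: wbound_set_coord => //; exact: ball_open.
Qed.

Lemma reached_good z : reached z -> good z.
Proof.
move=> [a [b [c [t0ab zab ic E]]]].
by have := good_propagate t0ab ic E zab; rewrite set_coord_id.
Qed.

End Global.

(** * From multiindices to words *)

Section Multiindex.
Context {d : nat}.
Implicit Types (p q : seq 'I_d) (k : 'rV[nat]_d).

Definition multiplicities p : 'rV[nat]_d := \row_i count_mem i p.

Lemma multiplicities_cat p q : multiplicities (p ++ q) = multiplicities p + multiplicities q.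
Proof. by apply/rowP => i; rewrite !mxE count_cat. Qed.

Lemma multiplicities_nil : multiplicities [::] = 0.
Proof. by apply/rowP => i; rewrite !mxE. Qed.

Lemma multiplicities_flatten (qs : seq (seq 'I_d)) : multiplicities (flatten qs) = \sum_(q <- qs) multiplicities q.
Proof.
elim: qs => [|q qs IH]; first by rewrite big_nil multiplicities_nil.
by rewrite /= multiplicities_cat IH big_cons.
Qed.

Lemma perm_multiplicities p q : perm_eq p q = (multiplicities p == multiplicities q).
Proof.
apply/idP/eqP => [pq|/rowP pq].
  by apply/rowP => i; rewrite !mxE (permP pq).
by apply/allP => i _ /=; have := pq i; rewrite !mxE => ->.
Qed.

Lemma mdeg_multiplicities p : mdeg (multiplicities p) = size p.
Proof.
rewrite /mdeg; under eq_bigr do rewrite mxE.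
elim: p => [|j p IH]; first by rewrite big1.
rewrite /= big_split /= IH (bigD1 j) //= eqxx big1 ?addn0 //.
by move=> i ij; rewrite eq_sym (negPf ij).
Qed.

Lemma multiplicities_eq0 p : (multiplicities p == 0) = (p == [::]).
Proof.
apply/eqP/eqP => [E|->]; last exact: multiplicities_nil.
apply/nilP; rewrite /nilp -mdeg_multiplicities E /mdeg big1 // => i _; by rewrite mxE.
Qed.

(** The word in the definition of [mpartial], so that [mpartial k f] and
    [iter_partial (sorted_word k) f] are convertible. *)
Definition sorted_word k : seq 'I_d := flatten [seq nseq (k ord0 i) i | i <- enum 'I_d].

Lemma multiplicities_sorted_word k : multiplicities (sorted_word k) = k.
Proof.
apply/rowP => i; rewrite mxE /sorted_word count_flatten -map_comp sumnE big_map.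
rewrite big_enum /= (bigD1 i) //= count_nseq /= eqxx mul1n big1 ?addn0 //.
by move=> j ji; rewrite count_nseq /= (negPf ji).
Qed.

Lemma size_sorted_word k : size (sorted_word k) = mdeg k.
Proof. by rewrite -mdeg_multiplicities multiplicities_sorted_word. Qed.

Lemma leq_fact_mul m n : (m`! * n`! <= (m + n)`!)%N.
Proof.
by rewrite -(bin_fact (leq_addr n m)) addKn leq_pmull // bin_gt0 leq_addr.
Qed.

(** A binomial coefficient is at most the sum 2^(m+n) of its row. *)
Lemma fact_add_le m n : ((m + n)`! <= 2 ^ (m + n) * (m`! * n`!))%N.
Proof.
rewrite -(bin_fact (leq_addr n m)) addKn leq_pmul2r ?muln_gt0 ?fact_gt0 //.
have -> : (2 ^ (m + n))%N = (\sum_(i < (m + n).+1) 'C(m + n, i))%N.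
  by rewrite -[2%N]/(1 + 1)%N expnDn; apply: eq_bigr => i _; rewrite !exp1n !muln1.
have lt_m : (m < (m + n).+1)%N by rewrite ltnS leq_addr.
by rewrite (bigD1 (Ordinal lt_m)) //= leq_addr.
Qed.

Lemma prod_fact_le (r : seq 'I_d) k :
  (\prod_(i <- r) (k ord0 i)`! <= (\sum_(i <- r) k ord0 i)`!)%N.
Proof.
elim: r => [|i r IH]; first by rewrite !big_nil.
rewrite !big_cons; apply: leq_trans (leq_fact_mul _ _).
by rewrite leq_mul2l IH orbT.
Qed.

Lemma fact_sum_le (r : seq 'I_d) k :
  ((\sum_(i <- r) k ord0 i)`! <= 2 ^ (size r * \sum_(i <- r) k ord0 i) * \prod_(i <- r) (k ord0 i)`!)%N.
Proof.
elim: r => [|i r IH]; first by rewrite !big_nil.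
rewrite !big_cons /=; set u := k ord0 i; set v := (\sum_(_ <- _) _)%N in IH *; set w := (\prod_(_ <- _) _)%N in IH *.
apply: leq_trans (fact_add_le u v) _.
rewrite mulSn [in X in (_ <= X)%N]expnD -[X in (_ <= X)%N]mulnA leq_mul2l; apply/orP; right.
rewrite [X in (_ <= X)%N]mulnCA leq_mul2l; apply/orP; right.
apply: leq_trans IH _; rewrite leq_mul2r; apply/orP; right.
by rewrite leq_exp2l // leq_mul2l leq_addl orbT.
Qed.

Lemma mfact_le k : (mfact k <= (mdeg k)`!)%N.
Proof. exact: prod_fact_le. Qed.

Lemma fact_mdeg_le k : ((mdeg k)`! <= 2 ^ (d * mdeg k) * mfact k)%N.
Proof.
have := fact_sum_le (enum 'I_d) k.
by rewrite -cardE card_ord !big_enum.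
Qed.

Lemma mfact_gt0 k : (0 < mfact k)%N.
Proof. by rewrite /mfact prodn_gt0 // => i; exact: fact_gt0. Qed.

(** Finitely many multiindices lie in a box; over the box the sum factors into [d] geometric sums,
    each at most 2. *)
Lemma sum_half_mdeg {R : realType} (r : seq 'rV[nat]_d) : uniq r ->
  \sum_(k <- r) (2^-1 : R) ^+ mdeg k <= 2 ^+ d.
Proof.
move=> ur.
pose N := \max_(k <- r) \max_(i < d) k ord0 i.
have kN k i : k \in r -> (k ord0 i < N.+1)%N.
  move=> kr; rewrite ltnS /N (big_rem k) //= leq_max; apply/orP; left.
  exact: leq_bigmax.
pose phi k : {ffun 'I_d -> 'I_N.+1} := [ffun i => inord (k ord0 i)].
pose F (h : {ffun 'I_d -> 'I_N.+1}) : R := \prod_i (2^-1) ^+ h i.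
have phiF k : k \in r -> (2^-1 : R) ^+ mdeg k = F (phi k).
  move=> kr; rewrite /F /mdeg -prodrXr; apply: eq_bigr => i _.
  by rewrite ffunE inordK // kN.
have F0 h : 0 <= F h by apply: prodr_ge0 => i _; rewrite exprn_ge0.
rewrite big_seq (eq_bigr (fun k => F (phi k))); last by move=> k; exact: phiF.
rewrite -big_seq -(big_map phi predT F).
have um : uniq (map phi r).
  rewrite map_inj_in_uniq // => k l kr lr /ffunP kl; apply/rowP => i.
  have := kl i; rewrite !ffunE => /(congr1 val); rewrite /= !inordK ?kN //.
apply: (@le_trans _ _ (\sum_h F h)).
  rewrite big_uniq //= [leRHS](bigID (mem (map phi r))) /= lerDl.
  by apply: sumr_ge0.
rewrite /F -(bigA_distr_bigA (fun (i : 'I_d) (j : 'I_N.+1) => (2^-1 : R) ^+ j)).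
rewrite -[in leRHS](card_ord d) -prodr_const; apply: ler_prod => i _.
apply/andP; split; first by apply: sumr_ge0 => j _; rewrite exprn_ge0.
by apply: geom_sum_half; rewrite ?invr_ge0 // mulfV.
Qed.

End Multiindex.

Lemma taylor_term_le {R : realType} (x W u g M a b c h : R) :
  0 < W -> 0 < u -> 0 <= M -> 0 <= b -> 0 <= c ->
  x <= W * (g * (M * b)) -> g <= a * u -> a * b * c <= h ->
  u^-1 * x / W * c <= M * h.
Proof.
move=> W0 u0 M0 b0 c0 xW ga abc.
have -> : u^-1 * x / W * c = x * c / (W * u) by rewrite invfM; ring.
rewrite ler_pdivrMr ?mulr_gt0 //.
apply: (@le_trans _ _ (W * (a * u * (M * b)) * c)).
  apply: ler_wpM2r => //; apply: le_trans xW _; apply: ler_wpM2l; first exact: ltW.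
  by apply: ler_wpM2r; rewrite ?mulr_ge0.
have -> : W * (a * u * (M * b)) * c = (M * (W * u)) * (a * b * c) by ring.
have -> : M * h * (W * u) = (M * (W * u)) * h by ring.
by apply: ler_wpM2l => //; rewrite !mulr_ge0 // ltW.
Qed.

(** * Class E^w in terms of bounds on words *)

Section ClassE.
Context {R : realType} {d : nat}.
Variable w : 'rV[nat]_d -> R.
Hypothesis w_gt0 : forall k, 0 < w k.
Implicit Types (p q : seq 'I_d) (k : 'rV[nat]_d) (f : 'rV[R]_d -> R) (A : set 'rV[R]_d).

Lemma word_weight_multiplicities : strictly_FdB w -> exists lam, word_weight (fun p => w (multiplicities p)) lam.
Proof.
move=> [lam lam1 FdB]; exists lam; split=> //.
- exact: lt_le_trans lam1.
- by move=> p q; rewrite perm_multiplicities => /eqP ->.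
- move=> j qs j0 sz aq.
  have := FdB (multiplicities j) (fun i => multiplicities (nth [::] qs i)).
  rewrite multiplicities_eq0 => /(_ j0) H.
  have {}H : w (multiplicities j) * \prod_(i < mdeg (multiplicities j)) w (multiplicities (nth [::] qs i)) <=
      lam ^+ mdeg (multiplicities j) * w (\sum_(i < mdeg (multiplicities j)) multiplicities (nth [::] qs i)).
    apply: H => i; rewrite multiplicities_eq0; apply: (allP aq); apply: mem_nth.
    by rewrite sz -(mdeg_multiplicities j).
  rewrite mdeg_multiplicities in H; rewrite multiplicities_flatten.
  have E1 : \prod_(q <- qs) w (multiplicities q) = \prod_(i < size j) w (multiplicities (nth [::] qs i)).
    by rewrite (big_nth [::]) sz big_mkord.
  have E2 : \sum_(q <- qs) multiplicities q = \sum_(i < size j) multiplicities (nth [::] qs i).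
    by rewrite (big_nth [::]) sz big_mkord.
  by rewrite E1 E2.
Qed.

(** Each term is at most the whole sum, and k! is at most |k|!; the geometric ratio is [r^-1]. *)
Lemma norm1E_bound f A r S : open A -> smooth_on A f -> 0 < r ->
  (forall b, A b -> (norm1E w f b r <= S%:E)%E) -> wbound (fun p => w (multiplicities p)) A f.
Proof.
move=> oA sf r0 fS; split=> //; exists `|S|, r^-1; split=> //.
  by rewrite invr_ge0 ltW.
move=> p z p0 Az; set k := multiplicities p.
have pk : perm_eq p (sorted_word k) by rewrite perm_multiplicities multiplicities_sorted_word.
rewrite (iter_partial_perm oA sf pk) ?inE //.
have k0 : k != 0 by rewrite multiplicities_eq0.
have H : `|taylor_coef k f z| / w k * r ^+ mdeg k <= S.
  rewrite -lee_fin; apply: le_trans (fS z Az); rewrite /norm1E; apply: esum_ge.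
  exists [set k]; last by rewrite fsbig_set1.
  by split; [exact: finite_set1|move=> x ->].
have k1 : 0 < (mfact k)%:R :> R by rewrite ltr0n mfact_gt0.
have rk : 0 < r ^+ mdeg k by exact: exprn_gt0.
rewrite /taylor_coef normrM normfV (gtr0_norm k1) in H.
have {}H : `|mpartial k f z| <= S * (r ^+ mdeg k)^-1 * w k * (mfact k)%:R.
  rewrite [X in X / w k]mulrC in H.
  by rewrite -ler_pdivrMr // -ler_pdivrMr // ler_pdivlMr.
rewrite -[iter_partial _ f]/(mpartial k f); apply: (le_trans H); rewrite -mdeg_multiplicities -/k exprVn.
rewrite (_ : S * _ * _ * _ = w k * ((mfact k)%:R * (S * (r ^+ mdeg k)^-1))); last first.
  by move: (_ ^-1) => u; ring.
apply: ler_wpM2l; first exact: ltW.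
apply: (@le_trans _ _ ((mfact k)%:R * (`|S| * (r ^+ mdeg k)^-1))).
  by rewrite ler_wpM2l // ler_wpM2r ?ler_norm // invr_ge0 ltW.
by apply: ler_wpM2r; [rewrite mulr_ge0 // invr_ge0 ltW | rewrite ler_nat mfact_le].
Qed.

(** Replacing |k|! by k! costs the factor [2 ^+ d] per degree. For small [r] the terms are then at
    most M / 2^|k|, and [sum_half_mdeg] sums them. *)
Lemma wbound_norm1E f A : wbound (fun p => w (multiplicities p)) A f ->
  exists M rho : R, [/\ 0 <= M, 0 <= rho & forall r b, 0 < r -> 2 * (2 ^+ d * rho * r) <= 1 -> A b ->
    (norm1E w f b r <= (M * 2 ^+ d)%:E)%E].
Proof.
move=> [sf [M [rho [M0 rho0 H]]]]; exists M, rho; split=> // r b r0 small Ab.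
have term k : k != 0 -> `|taylor_coef k f b| / w k * r ^+ mdeg k <= M * (2^-1) ^+ mdeg k.
  move=> k0; have wk0 : sorted_word k != [::] by rewrite -multiplicities_eq0 multiplicities_sorted_word.
  have := H (sorted_word k) b wk0 Ab; rewrite multiplicities_sorted_word size_sorted_word -/(mpartial k f) => {}H.
  have k1 : 0 < (mfact k)%:R :> R by rewrite ltr0n mfact_gt0.
  have e1 : (mdeg k)`!%:R <= (2 ^+ d) ^+ mdeg k * (mfact k)%:R :> R.
    by rewrite -exprM -natrX -natrM ler_nat fact_mdeg_le.
  have e2 : (2 ^+ d * rho * r) ^+ mdeg k <= 2^-1 ^+ mdeg k.
    apply: lerXn2r; rewrite ?nnegrE ?mulr_ge0 ?exprn_ge0 ?(ltW r0) //.
    by rewrite -[leRHS]mul1r ler_pdivlMr // mulrC.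
  rewrite !exprMn in e2; rewrite /taylor_coef normrM normfV (gtr0_norm k1).
  apply: (taylor_term_le (w_gt0 k) k1 M0 _ _ H e1 e2); first exact: exprn_ge0.
  by rewrite exprn_ge0 // ltW.
rewrite /norm1E; apply: ge_ereal_sup => /= _ [X [finX XI]] <-.
rewrite fsumEFin // lee_fin fsbig_finite //=.
apply: le_trans (_ : \sum_(k <- finmap.enum_fset (fset_set X)) M * (2^-1) ^+ mdeg k <= _).
  rewrite big_seq [leRHS]big_seq; apply: ler_sum => k.
  by rewrite in_fset_set // inE => /XI; exact: term.
rewrite -mulr_sumr ler_wpM2l //; apply: sum_half_mdeg; exact: finmap.fset_uniq.
Qed.

End ClassE.

Lemma is_derive_rV {R : realType} {n : nat} (c : R -> 'rV[R]_n) (t : R) (l : 'rV[R]_n) :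
  is_derive t 1 c l <-> forall i, is_derive t 1 (fun u => c u 0 i) (l 0 i).
Proof.
split=> [[Dc Ec] i|H].
  have Di := (derivable_mxP _ _ _).1 Dc 0 i.
  by apply: (DeriveDef Di); rewrite -Ec derive_mx // mxE.
have Dc : derivable c t 1.
  by apply/derivable_mxP => i j; rewrite (ord1 i); have [] := H j.
apply: (DeriveDef Dc); rewrite derive_mx //; apply/rowP => j; rewrite mxE.
by have [_ ->] := H j.
Qed.

(** * Time as a coordinate: the autonomous system *)

Section Augmented.
Context {R : realType} {s : nat}.
Implicit Types (x : 'rV[R]_s) (z : 'rV[R]_(1 + s)) (t : R).

Definition time_index : 'I_(1 + s) := lshift s 0.

Lemma tpoint_time t x : tpoint t x 0 time_index = t.
Proof. by rewrite row_mxEl mxE. Qed.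

Lemma tpoint_space t x j : tpoint t x 0 (rshift 1 j) = x 0 j.
Proof. by rewrite row_mxEr. Qed.

Lemma tpointK z : tpoint (z 0 time_index) (rsubmx z) = z.
Proof.
apply/rowP => i; case: (split_ordP i) => j ->; last by rewrite tpoint_space mxE.
by rewrite (ord1 j) tpoint_time.
Qed.

Lemma set_coord_tpoint t u x : set_coord time_index (tpoint t x) u = tpoint u x.
Proof.
apply/rowP => i; case: (split_ordP i) => j ->.
  by rewrite (ord1 j) set_coord_tau tpoint_time.
by rewrite set_coord_other ?tpoint_space // -(inj_eq val_inj) /=.
Qed.

Lemma is_derive_tpoint (c : R -> 'rV[R]_s) (t : R) (l : 'rV[R]_s) :
  is_derive t 1 c l <->
  forall i, is_derive t 1 (fun u => tpoint u (c u) 0 i) (tpoint 1 l 0 i).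
Proof.
rewrite is_derive_rV; split=> H i; last first.
  have := H (rshift 1 i); rewrite tpoint_space.
  by have -> : (fun u => tpoint u (c u) 0 (rshift 1 i)) = (fun u => c u 0 i)
    by apply/funext => u; rewrite tpoint_space.
case: (split_ordP i) => j ->.
  rewrite (ord1 j) tpoint_time.
  have -> : (fun u => tpoint u (c u) 0 time_index) = id by apply/funext => u; rewrite tpoint_time.
  exact: is_derive_id.
rewrite tpoint_space.
by have -> : (fun u => tpoint u (c u) 0 (rshift 1 j)) = (fun u => c u 0 j)
  by apply/funext => u; rewrite tpoint_space.
Qed.

Definition augment (v : 'rV[R]_(1 + s) -> 'rV[R]_s) z : 'rV[R]_(1 + s) := tpoint 1 (v z).

(** A solution [c] corresponds to its graph. Conversely, the time coordinate of an integral curve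
    has derivative 1 and so equals the parameter; projecting to space gives a solution. *)
Lemma flow_domain_reached D v t0 z :
  flow_domain D v t0 z <-> reached time_index D (augment v) t0 z.
Proof.
split=> [[t [x [-> [a [b [c [[t0ab ct0 sol] tab]]]]]]]|[a [b [c [t0ab zab ic ct0]]]]].
  exists a, b, (fun u => tpoint u (c u)); split=> //.
  - by rewrite tpoint_time.
  - move=> u uab; have [Du du] := sol u uab; split=> //.
    exact: (is_derive_tpoint c u _).1.
  - by rewrite set_coord_tpoint ct0.
have ctau : forall u, a < u < b -> c u 0 time_index = u.
  apply: (integral_curve_tau _ ic t0ab); last by rewrite ct0 set_coord_tau.
  by move=> y; rewrite tpoint_time.
exists (z 0 time_index), (rsubmx z); split; first by rewrite tpointK.
exists a, b, (fun u => rsubmx (c u)); split=> //; split=> //.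
  by rewrite ct0; apply/rowP => j; rewrite !mxE -(inj_eq val_inj).
move=> u uab; have [Du du] := ic u uab.
have Eu : tpoint u (rsubmx (c u)) = c u by have := tpointK (c u); rewrite ctau.
rewrite Eu; split=> //; apply/is_derive_rV => j.
have := du (rshift 1 j); rewrite tpoint_space.
by have -> : (fun u => c u 0 (rshift 1 j)) = (fun u => rsubmx (c u) 0 j)
  by apply/funext => w; rewrite mxE.
Qed.

End Augmented.

Theorem theorem14 (R : realType) (s : nat)
    (mt : nat -> R) (m : 'rV[nat]_s -> R)
    (mt_gt0 : forall n, 0 < mt n) (m_gt0 : forall k, 0 < m k)
    (D : set 'rV[R]_(1 + s)) (v : 'rV[R]_(1 + s) -> 'rV[R]_s)
    (v_classE : classE (prod_weight mt m) D v)
    (FdB : strictly_FdB (prod_weight mt m))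
    (t0 : R) (phi : 'rV[R]_(1 + s) -> 'rV[R]_s)
    (phi_flow : is_flow D v t0 phi) :
  classE (prod_weight mt m) (flow_domain D v t0) phi.
Proof.
pose w := prod_weight mt m.
have w0 k : 0 < w k by exact: mulr_gt0.
have [lam W0w] := word_weight_multiplicities w0 FdB.
have [oD sv bv] := v_classE.
pose V := augment v; pose tau := @time_index s.
(* The flow with its time attached follows integral curves of the autonomous field [V]. *)
pose Phi (z : 'rV[R]_(1 + s)) := tpoint (z 0 tau) (phi z).
have Vtau (z : 'rV[R]_(1 + s)) : V z 0 tau = 1 by rewrite tpoint_time.
have Vb (z : 'rV[R]_(1 + s)) : D z -> exists r : R, [/\ 0 < r, ball z r `<=` D &
    forall i, wbound (fun p => w (multiplicities p)) (ball z r) (Defs.coord V i)].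
  move=> Dz; have [U [r [nU UD r0 supU]]] := bv z Dz.
  have [rho /= rho0 rU] := (nbhs_ballP _ _).1 nU.
  exists rho; split=> //; first exact: subset_trans UD.
  move=> i; case: (split_ordP i) => j ->.
    rewrite (ord1 j); have -> : Defs.coord V (lshift s 0) = cst 1.
      by apply/funext => y; rewrite /Defs.coord tpoint_time.
    exact: wbound_cst.
  have -> : Defs.coord V (rshift 1 j) = Defs.coord v j.
    by apply/funext => y; rewrite /Defs.coord tpoint_space.
  have sb : smooth_on (ball z rho) (Defs.coord v j).
    by apply: smooth_on_sub (sv j); exact: subset_trans UD.
  move: supU; set S := ereal_sup _ => Slt.
  have S0 (b : 'rV[R]_(1 + s)) : ball z rho b -> (norm1E w (Defs.coord v j) b r <= S)%E.
    move=> /rU Ub; apply: (@le_trans _ _ (normE w v b r)).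
      by rewrite /normE; exact: (@le_bigmax _ _ _ _ (fun j => norm1E w (Defs.coord v j) b r) j).
    by apply: ereal_sup_ubound; exists b.
  (* The supremum is an extended real; being nonnegative and below [+oo] makes it a real bound on
     the whole ball. *)
  have Sge : (0 <= S)%E.
    apply: le_trans (S0 z (ballxx _ rho0)); apply: esum_ge0 => k _.
    by rewrite lee_fin mulr_ge0 ?divr_ge0 ?exprn_ge0 // ltW.
  have Sfin : S \is a fin_num by rewrite ge0_fin_numE.
  apply: (norm1E_bound w0 (ball_open _ _) sb r0 (S := fine S)) => b /S0.
  by rewrite fineK.
have reachE (z : 'rV[R]_(1 + s)) := flow_domain_reached D v t0 z.
have [fl1 fl2] := phi_flow.
have Phi0 (z : 'rV[R]_(1 + s)) : reached tau D V t0 z -> z 0 tau = t0 -> Phi z = z.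
  move=> /reachE rz zt; rewrite /Phi zt; rewrite -(tpointK z) zt in rz *.
  by rewrite fl1.
have PhiV (z : 'rV[R]_(1 + s)) : reached tau D V t0 z -> D (Phi z) /\
    forall i, is_derive z (delta_mx 0 tau) (Defs.coord Phi i) (V (Phi z) 0 i).
  move=> /reachE; rewrite -{1}(tpointK z) => rz.
  have [D1 D2] := fl2 _ _ rz; rewrite tpointK in D1 D2.
  split=> // i.
  have {}D2 := (is_derive_tpoint (fun u => phi (tpoint u (rsubmx z))) (z 0 time_index) _).1 D2 i.
  have := (is_derive_set_coord tau (Defs.coord Phi i) z (z 0 tau) (V (Phi z) 0 i)).2.
  rewrite set_coord_id; apply.
  have -> // : (fun t => Defs.coord Phi i (set_coord tau z t)) =
     (fun u => tpoint u (phi (tpoint u (rsubmx z))) 0 i).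
  apply/funext => u; rewrite /Defs.coord /Phi.
  by rewrite -[z in set_coord tau z u]tpointK set_coord_tpoint tpoint_time.
have gd (z : 'rV[R]_(1 + s)) : flow_domain D v t0 z -> exists r : R, [/\ 0 < r, ball z r `<=` flow_domain D v t0 &
    forall j, wbound (fun p => w (multiplicities p)) (ball z r) (Defs.coord phi j)].
  move=> /reachE rz; have [r [r0 rR rW]] := reached_good W0w Vtau Vb Phi0 PhiV rz.
  exists r; split=> //; first by move=> x /rR /reachE.
  move=> j; have := rW (rshift 1 j).
  have -> // : Defs.coord Phi (rshift 1 j) = Defs.coord phi j.
  by apply/funext => y; rewrite /Defs.coord tpoint_space.
split.
- rewrite openE => z /gd[r [r0 rF _]]; apply: filterS rF _; exact: nbhsx_ballx.
- move=> j p z /gd[r [r0 _ /(_ j)[sj _]]]; apply: sj; exact: ballxx.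
move=> z /gd[r [r0 rF rW]].
have W0p p : 0 < w (multiplicities p) by exact: w0.
have /choice[Mr HMr] : forall j, exists Mr : R * R, [/\ 0 <= Mr.1, 0 <= Mr.2 &
    forall (r' : R) (b : 'rV[R]_(1 + s)), 0 < r' -> 2 * (2 ^+ (1 + s) * Mr.2 * r') <= 1 -> ball z r b ->
    (norm1E w (Defs.coord phi j) b r' <= (Mr.1 * 2 ^+ (1 + s))%:E)%E].
  by move=> j; have [M [rho H]] := wbound_norm1E w0 (rW j); exists (M, rho).
pose M := \sum_j (Mr j).1; pose rho := \sum_j (Mr j).2.
have M0 : 0 <= M by apply: sumr_ge0 => j _; have [] := HMr j.
have rho0 : 0 <= rho by apply: sumr_ge0 => j _; have [] := HMr j.
have K0 : 0 < 2 ^+ (1 + s) :> R by exact: exprn_gt0.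
(* One radius for all components, as [rho] dominates each of their ratios; the added 1 keeps the
   denominator positive. *)
pose r' := (2 * (2 ^+ (1 + s) * (rho + 1)))^-1.
have r'0 : 0 < r' by rewrite invr_gt0 !mulr_gt0 //; lra.
exists (ball z r), r'; split=> //; first exact: nbhsx_ballx.
apply: (@le_lt_trans _ _ (M * 2 ^+ (1 + s))%:E); last exact: ltry.
apply: ge_ereal_sup => _ [b zb <-]; rewrite /normE; apply: bigmax_le.
  by rewrite lee_fin mulr_ge0 // ltW.
move=> j _; have [Mj0 rj0 H] := HMr j; apply: le_trans (H r' b r'0 _ zb) _.
  have rj : (Mr j).2 <= rho + 1.
    by rewrite /rho (bigD1 j) //= -addrA lerDl addr_ge0 // sumr_ge0 // => k _; have [] := HMr k.
  have r1 : 0 < rho + 1 by lra.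
  have E : 2 * (2 ^+ (1 + s) * (rho + 1) * r') = 1.
    by rewrite mulrA /r' mulfV // lt0r_neq0 // !mulr_gt0.
  rewrite -[leRHS]E ler_wpM2l // ler_wpM2r ?(ltW r'0) // ler_wpM2l // ltW //.
rewrite lee_fin; apply: ler_wpM2r; first exact: ltW.
by rewrite /M (bigD1 j) //= lerDl sumr_ge0 // => k _; have [] := HMr k.
Qed.
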